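(* Let $n\ge2$ and let $\mathfrak p=\mathfrak p_{\Pi\setminus\{\alpha_1\}}$. Then $$\overline{\mathrm{Pr}}_k^{\mathcal O_{\min}}=\bigsqcup_{w\in W^{\mathfrak p}}w^{-1}\cdot\Lambda_k(\mathfrak p)$$ (a disjoint union), where $\Lambda_k(\mathfrak p)=\{\mu-\tfrac pq a\omega_1:\mu\in\overline{\mathrm{Pr}}_{k,\mathbb Z},\ a\in\mathbb N,\ a\le q-1\}$ and $W^{\mathfrak p}=\{e,s_1,s_1s_2,\dots,s_1s_2\cdots s_n\}$. Moreover $\overline{\mathrm{Pr}}_k^{\mathcal O_{\min}}$ is non-empty if $q\ge2$.
   Context: Let $\mathfrak g=\mathfrak{sl}_{n+1}(\mathbb C)$, $\mathfrak h$ the traceless diagonal matrices, $\Delta=\{\varepsilon_i-\varepsilon_j:i\ne j\}$, $\Delta_+=\{\varepsilon_i-\varepsilon_j:i<j\}$, $\Delta_-=-\Delta_+$, $\Pi=\{\alpha_1,\dots,\alpha_n\}$, $\alpha_i=\varepsilon_i-\varepsilon_{i+1}$, $\theta=\alpha_1+\dots+\alpha_n$; $(\cdot,\cdot)$ the invariant form on $\mathfrak h^*$ with $(\alpha,\alpha)=2$ for roots; $\omega_i$ fundamental weights, $P^\vee=\bigoplus\mathbb Z\omega_i$, $\rho=\sum\omega_i$; $W$ the Weyl group generated by $s_i$, $w\cdot\mu=w(\mu+\rho)-\rho$. For $\Sigma\subset\Pi$, $\Delta_\Sigma$ is the root subsystem generated by $\Sigma$, $\mathfrak p_\Sigma$ the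 standard parabolic, $W^{\mathfrak p_\Sigma}=\{w\in W:\Delta_+\cap w(\Delta_-)\subset\Delta_+\setminus\Delta_\Sigma\}$. Fix $k\in\mathbb Q$ with $k+n+1=p/q$, $p,q\in\mathbb N$ coprime, $p\ge n+1$. $\overline{\mathrm{Pr}}_{k,\mathbb Z}=\{\sum\lambda_i\omega_i:\lambda_i\in\mathbb N_0,\sum\lambda_i\le p-n-1\}$. For $w\in W,\eta\in P^\vee$, $C(w,\eta)$ means: for all $\alpha\in\Delta_+$, $0\le(\eta,\alpha)\le q-1$ if $w(\alpha)\in\Delta_+$ and $1\le(\eta,\alpha)\le q$ if $w(\alpha)\in\Delta_-$. The admissible weights of level $k$: $\overline{\mathrm{Pr}}_k=\{w\cdot(\mu-\tfrac pq\eta):\mu\in\overline{\mathrm{Pr}}_{k,\mathbb Z},w\in W,\eta\in P^\vee,C(w,\eta)\}$. For $\mu\in\mathfrak h^*$, $J_\mu$ is the annihilator in $U(\mathfrak g)$ of the simple highest weight module $L(\mu)$ (standard Borel), $\mathcal V(J_\mu)\subset\mathfrak g^*$ the zero locus of $\mathrm{gr}J_\mu\subset S(\mathfrak g)$. For a nilpotent orbit $\mathcal O$, $\mathcal O^*$ is its image in $\mathfrak g^*$ via the Killing form and $\overline{\mathrm{Pr}}_k^{\mathcal O}=\{\mu\in\overline{\mathrm{Pr}}_k:\mathcal V(J_\mu)=\overline{\mathcal O^*}\}$. $\mathcal O_{\min}$ is the minimal nonzero nilpotent orbit (Jordan type $[2,1^{n-1}]$). *)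

(* Defs.v *)
From HB Require Import structures.
From mathcomp Require Import all_boot all_order all_algebra all_fingroup.
From mathcomp Require Import mpoly.
Set Implicit Arguments. Unset Strict Implicit. Unset Printing Implicit Defensive.
Import Order.TTheory GRing.Theory Num.Theory.
Local Open Scope ring_scope.

(* g = sl_{n+1}(F), realised inside 'M[F]_(n.+1); F an algebraically closed
   field of characteristic 0 (numClosedFieldType, e.g. algC or complex R). *)

Section Defs.
Variable F : numClosedFieldType.
Variable n : nat.
Local Notation N := n.+1.
Local Notation mat := ('M[F]_N).

Definition sl (X : mat) : Prop := \tr X = 0.

Definition is_gmod (V : lmodType F) (act : mat -> V -> V) : Prop :=
  [/\ (forall X Y v, sl X -> sl Y -> act (X + Y) v = act X v + act Y v),
      (forall c X v, sl X -> act (c *: X) v = c *: act X v),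
      (forall X u v, sl X -> act X (u + v) = act X u + act X v),
      (forall X c v, sl X -> act X (c *: v) = c *: act X v)
    & (forall X Y v, sl X -> sl Y ->
         act (X *m Y - Y *m X) v = act X (act Y v) - act Y (act X v))].

(* Elements of the tensor algebra T(g) (which surjects onto U(g), compatibly
   with the degree filtrations): finite formal sums  c * X_1 ... X_d. *)
Definition tens := seq (F * seq mat).
Definition tens_wf (f : tens) : Prop :=
  forall t, t \in f -> forall X, X \in t.2 -> sl X.
Definition tact (V : lmodType F) (act : mat -> V -> V) (f : tens) (v : V) : V :=
  \sum_(t <- f) t.1 *: foldr act v t.2.

Definition killing (Y X : mat) : F := (2 * N)%:R * \tr (Y *m X).

(* For f of degree <= d, the degree-d symbol of (the image in U(g) of) f,
   an element of S^d(g), evaluated at the point  xi_Y = killing Y . of g^*. *)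
Definition symb (f : tens) (d : nat) (Y : mat) : F :=
  \sum_(t <- f | size t.2 == d) t.1 * \prod_(X <- t.2) killing Y X.

(* Y (traceless) is such that xi_Y = K(Y,.) lies in V(J), J = Ann_{U(g)} V:
   every element of gr J (spanned by symbols of elements of J) vanishes at xi_Y. *)
Definition assoc_var (V : lmodType F) (act : mat -> V -> V) (Y : mat) : Prop :=
  sl Y /\
  forall (f : tens) (d : nat), tens_wf f ->
    (forall t, t \in f -> (size t.2 <= d)%N) ->
    (forall v, tact act f v = 0) -> symb f d Y = 0.

(* a weight lam in h^* is given by its coordinates in the basis of fundamental
   weights: lam = \sum_i lam 0 i * omega_{i+1}. *)
Definition weight := 'rV[F]_n.

(* value of lam on h = diag(d) (traceless): h = \sum_i c_i h_i with
   c_i = d_0 + ... + d_i, and lam(h_i) = lam 0 i. *)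
Definition wt_eval (mu : weight) (d : 'rV[F]_N) : F :=
  \sum_(i < n) mu 0 i * \sum_(j < N | (j <= i)%N) d 0 j.

(* (V, act) is a simple highest weight module of highest weight mu for the
   standard Borel (upper triangular) subalgebra, i.e. a realisation of L(mu). *)
Definition is_hw_simple (V : lmodType F) (act : mat -> V -> V) (mu : weight)
  : Prop :=
  is_gmod act /\
  exists v0 : V,
    [/\ v0 != 0,
        (forall d : 'rV[F]_N, \sum_(j < N) d 0 j = 0 ->
            act (diag_mx d) v0 = wt_eval mu d *: v0),
        (forall a b : 'I_N, (a < b)%N -> act (delta_mx a b) v0 = 0),
        (forall v, exists2 f, tens_wf f & v = tact act f v0)
      & (forall S : V -> Prop, S 0 ->
           (forall u v, S u -> S v -> S (u + v)) ->
           (forall c u, S u -> S (c *: u)) ->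
           (forall X u, sl X -> S u -> S (act X u)) ->
           (forall v, S v) \/ (forall v, S v -> v = 0))].

Definition coords (X : mat) : 'I_(N * N) -> F := fun k => mxvec X 0 k.

Definition zclosure (S : mat -> Prop) (Y : mat) : Prop :=
  forall p : {mpoly F[N * N]},
    (forall X, S X -> p.@[coords X] = 0) -> p.@[coords Y] = 0.

(* O_min: the conjugacy orbit of E_{1,n+1} (Jordan type [2,1^{n-1}]) *)
Definition Omin (Y : mat) : Prop :=
  exists2 g : mat, g \in unitmx & Y = g *m delta_mx ord0 ord_max *m invmx g.

(* epsilon-coordinates of a weight (up to an additive constant) *)
Definition eps (lam : weight) (j : 'I_N) : F :=
  \sum_(i < n | (j <= i)%N) lam 0 i.
Definition fromeps (e : 'I_N -> F) : weight :=
  \row_(i < n) (e (widen_ord (leqnSn n) i) - e (lift ord0 i)).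
(* w acts by eps_j |-> eps_{w^-1 j}; with MathComp's perm product
   ((s * t) x = t (s x)) this is a group homomorphism. *)
Definition wact (w : {perm 'I_N}) (lam : weight) : weight :=
  fromeps (fun k => eps lam (w k)).
Definition rho : weight := const_mx 1.
Definition dot (w : {perm 'I_N}) (lam : weight) : weight :=
  wact w (lam + rho) - rho.
(* simple reflection s_{i+1} (0-based index i) *)
Definition srefl (i : 'I_n) : {perm 'I_N} :=
  tperm (widen_ord (leqnSn n) i) (lift ord0 i).
Definition sprod (j : 'I_N) : {perm 'I_N} :=
  (\prod_(i < n | (i < j)%N) srefl i)%g.

(* (eta, eps_a - eps_b) for a < b, eta in P^vee (integer coordinates) *)
Definition pair_int (eta : 'rV[int]_n) (a b : 'I_N) : int :=
  \sum_(i < n | (a <= i < b)%N) eta 0 i.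

(* C(w, eta); for a < b, w(eps_a - eps_b) = eps_{w^-1 a} - eps_{w^-1 b} *)
Definition Ccond (q : nat) (w : {perm 'I_N}) (eta : 'rV[int]_n) : Prop :=
  forall a b : 'I_N, (a < b)%N ->
    if ((w^-1)%g a < (w^-1)%g b)%N
    then (0 <= pair_int eta a b <= q%:Z - 1)
    else (1 <= pair_int eta a b <= q%:Z).

Definition PrZ (p : nat) (mu : weight) : Prop :=
  exists m : 'I_n -> nat,
    (forall i, mu 0 i = (m i)%:R) /\ (\sum_(i < n) m i <= p - N)%N.

(* \bar{Pr}_k, with k + n + 1 = p / q *)
Definition admissible (p q : nat) (lam : weight) : Prop :=
  exists mu w eta, [/\ PrZ p mu, Ccond q w eta &
    lam = dot w (mu - (p%:R / q%:R) *: map_mx (fun z : int => z%:~R) eta)].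

Definition PrOmin (p q : nat) (lam : weight) : Prop :=
  admissible p q lam /\
  forall (V : lmodType F) (act : mat -> V -> V), is_hw_simple act lam ->
    forall Y : mat, assoc_var act Y <-> zclosure Omin Y.

(* roots eps_a - eps_b lying in the root subsystem generated by Sig *)
Definition inDeltaSigma (Sig : {set 'I_n}) (a b : 'I_N) : Prop :=
  forall i : 'I_n, (minn a b <= i < maxn a b)%N -> i \in Sig.

(* W^{p_Sig}: Delta_+ \cap w(Delta_-) \subset Delta_+ \ Delta_Sig;
   for a < b, w^-1(eps_a - eps_b) = eps_{w a} - eps_{w b} *)
Definition inWpar (Sig : {set 'I_n}) (w : {perm 'I_N}) : Prop :=
  forall a b : 'I_N, (a < b)%N -> (w b < w a)%N -> ~ inDeltaSigma Sig a b.

Definition Sig1 : {set 'I_n} := [set i : 'I_n | val i != 0%N].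

Definition omega1 : weight := \row_(i < n) (if val i == 0%N then 1 else 0).

(* Lambda_k(p), a in N = {1, 2, ...} *)
Definition Lambda (p q : nat) (lam : weight) : Prop :=
  exists mu a, [/\ PrZ p mu, (1 <= a <= q.-1)%N &
    lam = mu - ((p%:R / q%:R) * a%:R) *: omega1].

End Defs.

(* Main.v *)
Require Import Defs.
From HB Require Import structures.
From mathcomp Require Import all_boot all_order all_algebra all_fingroup.
From mathcomp Require Import boolp functions.
From mathcomp Require Import mpoly.
From mathcomp Require Import ring zify.

(* Write lam + rho in epsilon-coordinates e = (e_0, ..., e_n).
   - Reflecting e in a simple root i at which it is not integral does not change
     J_lam: an element of U(g) acts on f_i^k v0 by coefficients polynomial in k,
     and at k = e_i - e_(i+1) they describe its action on the highest weight
     vector of the reflected weight.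
   - A simple root at which e is not integral yields a Whittaker functional on
     L(lam), graded by PBW degree, whose character lies in V(J_lam).  Two
     orthogonal such roots give a character of rank 2, and so does (for sl_3, by
     nondegeneracy of the Shapovalov form) the absence of integral roots.
   - If e_1 > ... > e_n differ by integers, the f_a1 with a > 1 act locally
     nilpotently, so that a product of shifted 2x2 minors annihilates L(lam);
     hence all matrices in V(J_lam) have rank at most 1.
   - For an admissible weight the integrality classes of the coordinates are those
     of eta modulo q.  If all coordinates are congruent, lam is dominant integral
     and V(J_lam) misses O_min.  If exactly one coordinate is off the common class,
     a cyclic rotation of the alcove brings lam to the form w^-1 . Lambda_k(p).  In
     all other cases at most one nonintegral reflection produces two orthogonal
     nonintegral simple roots, unless n = 2 and no root is integral. *)

Set Implicit Arguments. Unset Strict Implicit. Unset Printing Implicit Defensive.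
Import Order.TTheory GRing.Theory Num.Theory.
Local Open Scope ring_scope.

(** [PrOmin] quantifies over all realisations of L(lam), so membership yields information only once
    a realisation exists. One is built by hand: functions on N x N matrices of prescribed degree in
    each row, dehomogenised and partly Fourier transformed so that the constant 1 becomes a highest
    weight vector; the simple quotient is then a space of matrix coefficients. Annihilators are
    tested through one functional [xi], the coefficient of v0: in a simple module u = 0 as soon as
    xi(w u) = 0 for every word w. This reduces them to scalar identities, and such identities, when
    polynomial in an exponent k, extend from the integers to e_i - e_(i+1). V(J) is closed, conical
    and stable under conjugation by transvections. Hence one rank-one nilpotent in it brings in the
    closure of O_min, and one minor relation spreads to enough minors to bound the rank; the
    assumption 2 <= n enters there, since a principal 2x2 minor is reached through a third index.
    Conversely a matrix of rank 2 in V(J) is excluded by a single minor. *)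

Section ModuleRing.
Variables (F : fieldType) (V : lmodType F).

Inductive vexp : Type :=
| VA of nat | VZero | VAdd of vexp & vexp | VOpp of vexp | VScale of F & vexp.

Fixpoint veval (env : seq V) (e : vexp) : V :=
  match e with
  | VA i => env`_i
  | VZero => 0
  | VAdd a b => veval env a + veval env b
  | VOpp a => - veval env a
  | VScale c a => c *: veval env a
  end.

(** Comparing indices by [Nat.eqb] lets [lazy] with a short delta list reduce coefficients to plain
    ring terms. *)
Fixpoint vcoef (e : vexp) (i : nat) : F :=
  match e with
  | VA j => if Nat.eqb i j then 1 else 0
  | VZero => 0
  | VAdd a b => vcoef a i + vcoef b i
  | VOpp a => - vcoef a i
  | VScale c a => c * vcoef a i
  end.

Lemma vevalE env e : veval env e = \sum_(i < size env) vcoef e i *: env`_i.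
Proof.
elim: e => /=.
- move=> j; case: (ltnP j (size env)) => h.
    rewrite (bigD1 (Ordinal h)) //= PeanoNat.Nat.eqb_refl scale1r big1 ?addr0 // => i ij.
    case: PeanoNat.Nat.eqb_spec => [e|_]; last by rewrite scale0r.
    by case/eqP: ij; apply: val_inj.
  rewrite nth_default // big1 // => i _.
  case: PeanoNat.Nat.eqb_spec => [e|_]; last by rewrite scale0r.
  by move: (ltn_ord i); rewrite e ltnNge h.
- by rewrite big1 // => i _; rewrite scale0r.
- by move=> a -> b ->; rewrite -big_split; apply: eq_bigr => i _; rewrite scalerDl.
- by move=> a ->; rewrite -sumrN; apply: eq_bigr => i _; rewrite scaleNr.
by move=> c a ->; rewrite scaler_sumr; apply: eq_bigr => i _; rewrite scalerA.
Qed.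

Fixpoint vcoef_eq (k : nat) (e1 e2 : vexp) : Prop :=
  if k is k'.+1 then vcoef e1 k' = vcoef e2 k' /\ vcoef_eq k' e1 e2 else True.

Lemma veval_eq env e1 e2 : vcoef_eq (size env) e1 e2 -> veval env e1 = veval env e2.
Proof.
move=> h; rewrite !vevalE; apply: eq_bigr => i _; congr (_ *: _).
elim: (size env) h i => [|k IH] /=; first by move=> _ [].
case=> h1 h2 i; have [->//|ik] := eqVneq (i : nat) k.
have ik' : (i < k)%N by rewrite ltn_neqAle ik -ltnS ltn_ord.
exact: (IH h2 (Ordinal ik')).
Qed.
End ModuleRing.

Ltac vmem x l := lazymatch l with
  | nil => constr:(false) | cons x _ => constr:(true) | cons _ ?r => vmem x r end.
Ltac vidx x l := lazymatch l with
  | cons x _ => constr:(O) | cons _ ?r => let k := vidx x r in constr:(S k) end.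
Ltac vatoms e l := lazymatch e with
  | (?a + ?b)%R => let l1 := vatoms a l in vatoms b l1
  | (- ?a)%R => vatoms a l
  | (_ *: ?a)%R => vatoms a l
  | 0%R => l
  | _ => let b := vmem e l in lazymatch b with true => l | _ => constr:(cons e l) end
  end.
Ltac vreify F e l := lazymatch e with
  | (?a + ?b)%R => let x := vreify F a l in let y := vreify F b l in constr:(VAdd x y)
  | (- ?a)%R => let x := vreify F a l in constr:(VOpp x)
  | (?c *: ?a)%R => let x := vreify F a l in constr:(@VScale F c x)
  | 0%R => constr:(@VZero F)
  | _ => let k := vidx e l in constr:(@VA F k)
  end.
(* Identities between linear combinations in an F-module, reduced to ring
   identities between the coefficients. *)
Ltac modring F := cbn [nat_of_bool]; match goal with
  | |- @eq ?T ?lhs ?rhs =>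
    let l0 := constr:(@nil T) in
    let l1 := vatoms lhs l0 in let l := vatoms rhs l1 in
    let x := vreify F lhs l in let y := vreify F rhs l in
    apply: (@veval_eq F _ l x y);
    lazy beta iota zeta delta [vcoef_eq vcoef size Nat.eqb];
    repeat (split; [try (by ring)|]); try exact: I
  end.

(** * Invariance of V(J) under unipotent conjugation and scaling *)

Section Symbols.
Variables (F : numClosedFieldType) (n : nat).
Local Notation N := n.+1.
Local Notation mat := 'M[F]_N.

Definition lie (X Y : mat) : mat := X *m Y - Y *m X.

Lemma sl_lie X Y : sl (lie X Y).
Proof. by rewrite /sl /lie raddfB /= mxtrace_mulC subrr. Qed.

Lemma sl_add X Y : sl X -> sl Y -> sl (X + Y : mat).
Proof. by rewrite /sl raddfD /= => -> ->; rewrite addr0. Qed.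

Lemma sl_scale c X : sl X -> sl (c *: X : mat).
Proof. by rewrite /sl linearZ /= => ->; rewrite mulr0. Qed.

Lemma sl_opp X : sl X -> sl (- X : mat).
Proof. by rewrite /sl raddfN /= => ->; rewrite oppr0. Qed.

Lemma sl0 : sl (0 : mat).
Proof. by rewrite /sl raddf0. Qed.

(** Leibniz rule for the derivation X -> [X, M], kept as a list of words of the same length; [dtens]
    extends it to formal sums. *)
Fixpoint dword (M : mat) (w : seq mat) : seq (seq mat) :=
  if w is X :: w' then (lie X M :: w') :: map (cons X) (dword M w') else [::].

Definition dtens (M : mat) (f : tens F n) : tens F n :=
  flatten [seq [seq (t.1, w) | w <- dword M t.2] | t <- f].

Lemma dword_sl M w : (forall X, X \in w -> sl X) ->
  forall w', w' \in dword M w -> forall X, X \in w' -> sl X.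
Proof.
elim: w => //= A w IH hw w'; rewrite inE => /orP[/eqP -> X|].
  rewrite inE => /orP[/eqP -> | Xw]; first exact: sl_lie.
  by apply: hw; rewrite inE Xw orbT.
case/mapP=> w'' hw'' -> X; rewrite inE => /orP[/eqP -> | Xw].
  by apply: hw; rewrite inE eqxx.
by apply: (IH _ w'') => // Z Zw; apply: hw; rewrite inE Zw orbT.
Qed.

Lemma size_dword M w w' : w' \in dword M w -> size w' = size w.
Proof.
elim: w w' => //= A w IH w'; rewrite inE => /orP[/eqP -> //|].
by case/mapP=> w'' hw'' ->; rewrite /= (IH w'').
Qed.

Lemma dtensP M f t : t \in dtens M f ->
  exists2 s, s \in f & t.1 = s.1 /\ t.2 \in dword M s.2.
Proof. by case/flattenP=> l /mapP[s sf ->] /mapP[w hw ->]; exists s. Qed.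

Lemma dtens_wf M f : tens_wf f -> tens_wf (dtens M f).
Proof.
move=> wf t /dtensP[s sf [_ ts]]; exact: dword_sl (wf _ sf) _ ts.
Qed.

Lemma dtens_deg M f d : (forall t, t \in f -> (size t.2 <= d)%N) ->
  forall t, t \in dtens M f -> (size t.2 <= d)%N.
Proof. by move=> hd t /dtensP[s sf [_ /size_dword ->]]; apply: hd. Qed.

Section Mod.
Variables (V : lmodType F) (act : mat -> V -> V).
Hypothesis gm : is_gmod act.

Lemma actDl X Y v : sl X -> sl Y -> act (X + Y) v = act X v + act Y v.
Proof. by case: gm => + _ _ _ _; apply. Qed.
Lemma actZl c X v : sl X -> act (c *: X) v = c *: act X v.
Proof. by case: gm => _ + _ _ _; apply. Qed.
Lemma actDr X u v : sl X -> act X (u + v) = act X u + act X v.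
Proof. by case: gm => _ _ + _ _; apply. Qed.
Lemma actZr c X v : sl X -> act X (c *: v) = c *: act X v.
Proof. by case: gm => _ _ _ + _; apply. Qed.
Lemma actlie X Y v : sl X -> sl Y -> act (lie X Y) v = act X (act Y v) - act Y (act X v).
Proof. by case: gm => _ _ _ _; apply. Qed.
Lemma act0r X : sl X -> act X 0 = 0.
Proof. by move=> sX; rewrite -[X in act _ X](scale0r 0) actZr // scale0r. Qed.
Lemma actBr X u v : sl X -> act X (u - v) = act X u - act X v.
Proof. by move=> sX; rewrite actDr // -scaleN1r actZr // scaleN1r. Qed.
Lemma act_sum X (I : Type) (r : seq I) (P : pred I) (G : I -> V) : sl X ->
  act X (\sum_(i <- r | P i) G i) = \sum_(i <- r | P i) act X (G i).
Proof.
move=> sX; elim/big_rec2: _; first exact: act0r.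
by move=> i u v _ <-; rewrite actDr.
Qed.
Lemma act_suml (I : Type) (r : seq I) (P : pred I) (G : I -> mat) v :
  (forall i, sl (G i)) ->
  act (\sum_(i <- r | P i) G i) v = \sum_(i <- r | P i) act (G i) v.
Proof.
move=> sG; suff [] : act (\sum_(i <- r | P i) G i) v = \sum_(i <- r | P i) act (G i) v
  /\ sl (\sum_(i <- r | P i) G i) by [].
elim/big_rec2: _.
  split; last exact: sl0.
  by rewrite -[X in act X _](scale0r 0) actZl ?scale0r //; exact: sl0.
move=> i u w _ [<- sw]; split; last exact: sl_add.
by rewrite actDl.
Qed.

Lemma foldr_actD w u v : (forall X, X \in w -> sl X) ->
  foldr act (u + v) w = foldr act u w + foldr act v w.
Proof.
elim: w => //= X w IH hw; rewrite IH; last by move=> Z Zw; apply: hw; rewrite inE Zw orbT.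
by rewrite actDr //; apply: hw; rewrite inE eqxx.
Qed.

Lemma foldr_actZ w c v : (forall X, X \in w -> sl X) ->
  foldr act (c *: v) w = c *: foldr act v w.
Proof.
elim: w => //= X w IH hw; rewrite IH; last by move=> Z Zw; apply: hw; rewrite inE Zw orbT.
by rewrite actZr //; apply: hw; rewrite inE eqxx.
Qed.

(** The derivation is inner: the Leibniz terms telescope to the commutator w M - M w. *)
Lemma dwordE M w v : sl M -> (forall X, X \in w -> sl X) ->
  \sum_(w' <- dword M w) foldr act v w' = foldr act (act M v) w - act M (foldr act v w).
Proof.
move=> sM; elim: w => [|X w IH] hw; first by rewrite big_nil subrr.
have sX : sl X by apply: hw; rewrite inE eqxx.
have hw' Z : Z \in w -> sl Z by move=> Zw; apply: hw; rewrite inE Zw orbT.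
rewrite /= big_cons /= big_map /= -act_sum // IH // actlie // actBr //.
by rewrite addrC addrA subrK.
Qed.

Lemma tact_dtens M f v : sl M -> tens_wf f ->
  tact act (dtens M f) v = tact act f (act M v) - act M (tact act f v).
Proof.
move=> sM wf; rewrite /tact /dtens big_flatten big_map /= act_sum // -sumrB.
rewrite big_seq [RHS]big_seq; apply: eq_bigr => t tf.
rewrite big_map /= -scaler_sumr dwordE //; last exact: wf.
by rewrite scalerBr actZr.
Qed.

Lemma iter_dtens_wf M k f : tens_wf f -> tens_wf (iter k (dtens M) f).
Proof. by move=> wf; elim: k => //= k; exact: dtens_wf. Qed.

Section Conj.
Variables (Y M : mat).
Hypotheses (sM : sl M) (MM : M *m M = 0).

(** The polynomial t -> [killing] Y ((1 - tM) X (1 + tM)), i.e. X paired with the conjugate of Y by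
    1 + tM. Since M^2 = 0, the inverse of 1 + tM is 1 - tM. *)
Definition kpoly (X : mat) : {poly F} :=
  (killing Y X)%:P + killing Y (lie X M) *: 'X - killing Y (M *m X *m M) *: 'X^2.

Definition spoly (f : tens F n) (d : nat) : {poly F} :=
  \sum_(t <- f | size t.2 == d) t.1 *: \prod_(X <- t.2) kpoly X.

Lemma killingZ A c X : killing A (c *: X : mat) = c * killing A X.
Proof. by rewrite /killing -scalemxAr linearZ /= mulrCA. Qed.

(** 1 + tM = exp(tM) is a one-parameter group, so differentiating in t amounts to replacing X by
    [X, M]. *)
Lemma deriv_kpoly X : (kpoly X)^`() = kpoly (lie X M).
Proof.
have e1 : lie (lie X M) M = (-2) *: (M *m X *m M).
  rewrite /lie mulmxBl mulmxBr -(mulmxA X) MM mulmx0 !(mulmxA M M) MM mul0mx.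
  by rewrite (mulmxA M X) subr0 sub0r scaleNr scaler_nat mulr2n opprD.
have e2 : M *m lie X M *m M = 0.
  by rewrite /lie mulmxBr mulmxBl -!mulmxA MM !mulmx0 !mulmxA MM !mul0mx subr0.
rewrite /kpoly e1 e2 derivB derivD derivC !derivZ derivX derivXn /=.
rewrite killingZ.
have -> : killing Y 0 = 0 by rewrite /killing mulmx0 mxtrace0 mulr0.
rewrite scale0r subr0 add0r expr1.
by rewrite alg_polyC -scaler_nat scalerA mulrC mulNr scaleNr.
Qed.

Lemma deriv_spoly f d : (spoly f d)^`() = spoly (dtens M f) d.
Proof.
have dprod w : (\prod_(X <- w) kpoly X)^`() = \sum_(w' <- dword M w) \prod_(X <- w') kpoly X.
  elim: w => [|X w IH] /=; first by rewrite !big_nil derivC.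
  rewrite !big_cons derivM deriv_kpoly IH big_map mulr_sumr; congr (_ + _).
  by apply: eq_bigr => w' _; rewrite big_cons.
rewrite /spoly raddf_sum /= /dtens big_flatten big_map /= big_mkcond /=.
apply: eq_bigr => t _; rewrite [RHS]big_map [RHS]big_mkcond [RHS]big_seq /=.
case: ifP => tz.
  rewrite derivZ dprod scaler_sumr [LHS]big_seq; apply: eq_bigr => w /size_dword ->.
  by rewrite tz.
by rewrite big1 // => w /size_dword ->; rewrite tz.
Qed.

Lemma spolyE f d t :
  (spoly f d).[t] = symb f d ((1%:M + t *: M) *m Y *m (1%:M - t *: M)).
Proof.
rewrite /spoly /symb horner_sum; apply: eq_bigr => s _.
rewrite hornerZ; congr (_ * _).
rewrite horner_prod; apply: eq_bigr => X _.
rewrite /kpoly hornerD hornerN hornerD !hornerZ hornerC hornerX hornerXn /killing.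
have -> : \tr ((1%:M + t *: M) *m Y *m (1%:M - t *: M) *m X) =
   \tr (Y *m (X + t *: lie X M - (t ^+ 2) *: (M *m X *m M))).
  rewrite -!mulmxA mxtrace_mulC -!mulmxA; congr (\tr (Y *m _)).
  rewrite mulmxBl mul1mx mulmxDr mulmx1 /lie scalerBr mulmxDr.
  rewrite -!scalemxAl -!scalemxAr scalerA -expr2.
  by rewrite opprD !addrA; congr (_ - _); rewrite addrAC.
move: (lie X M) => L.
rewrite [in RHS]mulmxBr [in RHS]mulmxDr -!scalemxAr raddfB /= mxtraceD !mxtraceZ.
by ring.
Qed.

(** The hypotheses are the derivatives at t = 0 of the symbol along the conjugation path. In
    characteristic 0 they determine the polynomial, which is evaluated at t = 1. *)
Lemma symb_conj0 f d : tens_wf f -> (forall k, symb (iter k (dtens M) f) d Y = 0) ->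
  symb f d ((1%:M + M) *m Y *m (1%:M - M)) = 0.
Proof.
move=> wf h0; have := spolyE f d 1; rewrite !scale1r => <-.
suff -> : spoly f d = 0 by rewrite horner0.
apply/polyP => k; rewrite coef0.
have dk : (spoly f d)^`(k) = spoly (iter k (dtens M) f) d.
  by elim: k => [|k IH] //; rewrite derivnS IH deriv_spoly.
have := spolyE (iter k (dtens M) f) d 0.
rewrite scale0r addr0 subr0 mul1mx mulmx1 h0 -dk horner_coef0 coef_derivn addn0 => /eqP.
by rewrite -mulr_natl mulf_eq0 pnatr_eq0 -leqn0 leqNgt ffact_gt0 leqnn => /eqP.
Qed.

(** J is a two-sided ideal, so iterated commutators with M of an element of J stay in J without
    raising the degree. *)
Lemma assoc_var_conj : assoc_var act Y -> assoc_var act ((1%:M + M) *m Y *m (1%:M - M)).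
Proof.
case=> sY hY; split.
  rewrite /sl mxtrace_mulC mulmxA mulmxDr mulmx1 mulmxBl mul1mx.
  by rewrite MM subr0 subrK mul1mx.
move=> f d wf hd ann; apply: symb_conj0 => // k; apply: hY; first exact: iter_dtens_wf.
  by elim: k => //= k; exact: dtens_deg.
elim: k => //= k IH v; rewrite tact_dtens ?IH ?sub0r //; last exact: iter_dtens_wf.
by rewrite act0r // oppr0.
Qed.
End Conj.

Lemma symb_scale f d c (Y : mat) : symb f d (c *: Y) = c ^+ d * symb f d Y.
Proof.
rewrite /symb mulr_sumr; apply: eq_bigr => t /eqP td.
rewrite mulrCA; congr (_ * _); rewrite -td; elim: (t.2) => [|X w IH].
  by rewrite !big_nil mulr1.
rewrite !big_cons IH exprS /killing -scalemxAl linearZ /=.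
by ring.
Qed.

Lemma assoc_var_scale c Y : assoc_var act Y -> assoc_var act (c *: Y).
Proof.
case=> sY hY; split; first exact: sl_scale.
by move=> f d wf hd an; rewrite symb_scale (hY f d) ?mulr0.
Qed.
End Mod.
End Symbols.

(** * Transvections, rank-one nilpotent matrices and 2x2 minors *)

Section RankOne.
Variables (F : numClosedFieldType) (n : nat).
Local Notation N := n.+1.
Local Notation mat := 'M[F]_N.

(** The symmetries shared by V(J) and O_min; for b a = 0 the inverse of 1 + ab is 1 - ab. *)
Definition tvstable (Z : mat -> Prop) : Prop :=
  (forall (a : 'cV[F]_N) (b : 'rV[F]_N) Y, b *m a = 0 -> Z Y ->
     Z ((1%:M + a *m b) *m Y *m (1%:M - a *m b))) /\
  (forall c Y, c != 0 -> Z Y -> Z (c *: Y)).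

(** Lying in one orbit, phrased through invariant sets so that the group generated by transvections
    and scalars is not formed. *)
Definition tveq (Y Y' : mat) : Prop := forall Z, tvstable Z -> Z Y <-> Z Y'.

Lemma tveq_trans X Y Z : tveq X Y -> tveq Y Z -> tveq X Z.
Proof. by move=> h1 h2 S hS; split=> [/(h1 S hS)/(h2 S hS)|/(h2 S hS)/(h1 S hS)]. Qed.

Lemma tveq_sym X Y : tveq X Y -> tveq Y X.
Proof. by move=> h S hS; split=> /(h S hS). Qed.

Lemma tv_inv (a : 'cV[F]_N) (b : 'rV[F]_N) : b *m a = 0 ->
  (1%:M - a *m b) *m (1%:M + a *m b) = 1%:M.
Proof.
move=> ba; rewrite mulmxDr mulmx1 mulmxBl mul1mx -mulmxA (mulmxA b) ba mul0mx mulmx0.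
by rewrite subr0 subrK.
Qed.

Lemma tv_inv' (a : 'cV[F]_N) (b : 'rV[F]_N) : b *m a = 0 ->
  (1%:M + a *m b) *m (1%:M - a *m b) = 1%:M.
Proof. by move=> ba; apply: mulmx1C; apply: tv_inv. Qed.

Lemma tveq_step (a : 'cV[F]_N) (b : 'rV[F]_N) (u : 'cV[F]_N) (v : 'rV[F]_N) :
  b *m a = 0 ->
  tveq (u *m v) (((1%:M + a *m b) *m u) *m (v *m (1%:M - a *m b))).
Proof.
move=> ba Z [Z1 _]; split=> [/(Z1 _ _ _ ba)|]; first by rewrite !mulmxA.
have ba' : b *m (- a) = 0 by rewrite mulmxN ba oppr0.
move/(Z1 _ _ _ ba'); rewrite mulNmx opprK !mulmxA tv_inv // mul1mx.
by rewrite -!mulmxA tv_inv // mulmx1.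
Qed.

Lemma tveq_scale c Y : c != 0 -> tveq Y (c *: Y).
Proof.
move=> c0 Z [_ Z2]; split; first exact: Z2.
by move/(Z2 c^-1); rewrite invr_eq0 => /(_ c0); rewrite scalerA mulVf // scale1r.
Qed.

Lemma rank1_move (a : 'cV[F]_N) (b : 'rV[F]_N) (u : 'cV[F]_N) (v : 'rV[F]_N) :
  b *m a = 0 -> v != 0 -> v *m u = 0 ->
  v *m (1%:M - a *m b) != 0 /\ v *m (1%:M - a *m b) *m ((1%:M + a *m b) *m u) = 0.
Proof.
move=> ba v0 vu; split; last by rewrite !mulmxA -(mulmxA v) tv_inv // mulmx1.
apply: contra_neq v0 => h.
by rewrite -[v]mulmx1 -(tv_inv ba) mulmxA h mul0mx.
Qed.

Lemma row_colE (b : 'rV[F]_N) (u : 'cV[F]_N) (a : 'cV[F]_N) :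
  (1%:M + a *m b) *m u = u + (b *m u) 0 0 *: a.
Proof. by rewrite mulmxDl mul1mx -mulmxA [in LHS](mx11_scalar (b *m u)) mul_mx_scalar. Qed.

Lemma row_colE' (v : 'rV[F]_N) (a : 'cV[F]_N) (b : 'rV[F]_N) :
  v *m (1%:M - a *m b) = v - (v *m a) 0 0 *: b.
Proof. by rewrite mulmxBr mulmx1 mulmxA [in LHS](mx11_scalar (v *m a)) mul_scalar_mx. Qed.

Lemma mul_deltal (j : 'I_N) (u : 'cV[F]_N) : (delta_mx 0 j : 'rV_N) *m u = (u j 0)%:M.
Proof.
by apply/matrixP=> x y; rewrite -rowE !mxE !ord1 eqxx mulr1n.
Qed.

Lemma mul_deltar (j : 'I_N) (v : 'rV[F]_N) : v *m (delta_mx j 0 : 'cV_N) = (v 0 j)%:M.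
Proof.
by apply/matrixP=> x y; rewrite -colE !mxE !ord1 eqxx mulr1n.
Qed.

Lemma scalar11 (c : F) : (c%:M : 'M_1) 0 0 = c.
Proof. by rewrite mxE eqxx mulr1n. Qed.

Lemma rank1_col0 (u : 'cV[F]_N) (v : 'rV[F]_N) : u != 0 -> v != 0 -> v *m u = 0 ->
  exists v' : 'rV[F]_N, [/\ v' != 0, v' 0 0 = 0 & tveq (u *m v) (delta_mx 0 0 *m v')].
Proof.
have key (u' : 'cV[F]_N) (v' : 'rV[F]_N) : u' 0 0 != 0 -> v' != 0 -> v' *m u' = 0 ->
  exists v'' : 'rV[F]_N, [/\ v'' != 0, v'' 0 0 = 0 & tveq (u' *m v') (delta_mx 0 0 *m v'')].
  move=> u0 v0 vu.
  (* Chosen so that (1 + ab) u' = u' + u'_0 a = u'_0 e_0, while b a = a_0 = 0. *)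
  pose a : 'cV[F]_N := delta_mx 0 0 - (u' 0 0)^-1 *: u'.
  pose b : 'rV[F]_N := delta_mx 0 0.
  have ba : b *m a = 0.
    rewrite mul_deltal; apply/matrixP=> x y; rewrite !ord1 scalar11 !mxE !eqxx /=.
    by rewrite mulVf // subrr.
  have [v1 vu1] := rank1_move ba v0 vu.
  have eu : (1%:M + a *m b) *m u' = u' 0 0 *: delta_mx 0 0.
    rewrite row_colE mul_deltal scalar11 /a scalerBr scalerA divff // scale1r.
    by rewrite addrC subrK.
  exists (v' *m (1%:M - a *m b)); split=> //.
    move: vu1; rewrite eu -scalemxAr mul_deltar => /matrixP/(_ 0 0).
    by rewrite !mxE eqxx mulr1n => /eqP; rewrite mulf_eq0 (negPf u0) => /eqP.
  apply: tveq_trans (tveq_step u' v' ba) _; rewrite eu -scalemxAl.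
  by apply: tveq_sym; apply: tveq_scale.
move=> u0 v0 vu; have [h|h] := eqVneq (u 0 0) 0; last exact: key.
have [j hj] : exists j, u j 0 != 0.
  apply/existsP; apply: contra_neqT u0 => /existsPn h'.
  by apply/matrixP=> x y; rewrite ord1 [RHS]mxE; apply/eqP/negPn; exact: h'.
have j0 : j != 0 by apply: contraNneq hj => ->; rewrite h.
(* When u_0 = 0, adding a nonzero entry u_j to row 0 restores a nonzero leading entry. *)
pose a : 'cV[F]_N := delta_mx 0 0; pose b : 'rV[F]_N := delta_mx 0 j.
have ba : b *m a = 0.
  rewrite mul_deltal; apply/matrixP=> x y; rewrite !ord1 scalar11 !mxE (negPf j0).
  by [].
have [v1 vu1] := rank1_move ba v0 vu.
have [|v'' [? ? e]] := key _ _ _ v1 vu1.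
  by rewrite row_colE mul_deltal scalar11 !mxE h eqxx add0r mulr1.
exists v''; split=> //; exact: tveq_trans (tveq_step u v ba) e.
Qed.

Lemma rank1_tveq (u : 'cV[F]_N) (v : 'rV[F]_N) : (0 < n)%N ->
  u != 0 -> v != 0 -> v *m u = 0 -> tveq (u *m v) (delta_mx ord0 ord_max).
Proof.
move=> n0 u0 v0 vu.
have mx0 : (ord_max : 'I_N) != 0 by rewrite -val_eqE /= -lt0n.
have key (w : 'rV[F]_N) : w 0 ord_max != 0 -> w 0 0 = 0 ->
    tveq (delta_mx 0 0 *m w) (delta_mx ord0 ord_max).
  move=> w0 w00.
  (* With this pair w (1 - ab) = w - w_max b is a multiple of the last covector, and b e_0 = 0
     because w_0 = 0, so the column e_0 is not disturbed. *)
  pose a : 'cV[F]_N := delta_mx ord_max 0.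
  pose b : 'rV[F]_N := (w 0 ord_max)^-1 *: w - delta_mx 0 ord_max.
  have ba : b *m a = 0.
    rewrite mul_deltar; apply/matrixP=> x y; rewrite !ord1 scalar11 !mxE !eqxx /=.
    by rewrite mulVf // subrr.
  have e0 : (1%:M + a *m b) *m delta_mx 0 0 = delta_mx 0 0 :> 'cV_N.
    rewrite row_colE mul_deltar scalar11 !mxE w00 mulr0 eqxx /= eq_sym (negPf mx0).
    by rewrite oppr0 add0r scale0r addr0.
  have e1 : w *m (1%:M - a *m b) = w 0 ord_max *: delta_mx 0 ord_max.
    rewrite row_colE' mul_deltar scalar11 /b scalerBr scalerA divff // scale1r.
    by rewrite opprB addrC subrK.
  apply: tveq_trans (tveq_step (delta_mx 0 0) w ba) _.
  rewrite e0 e1 -scalemxAr mul_delta_mx; by apply: tveq_sym; apply: tveq_scale.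
have [w [w0 w00 e]] := rank1_col0 u0 v0 vu.
apply: (tveq_trans e).
have [h|h] := eqVneq (w 0 ord_max) 0; last exact: key.
have [l hl] : exists l, w 0 l != 0.
  apply/existsP; apply: contra_neqT w0 => /existsPn h'.
  by apply/matrixP=> x y; rewrite ord1 [RHS]mxE; apply/eqP/negPn; exact: h'.
have l0 : l != 0 by apply: contraNneq hl => ->; rewrite w00.
have lm : l != ord_max by apply: contraNneq hl => ->; rewrite h.
pose a : 'cV[F]_N := delta_mx l 0; pose b : 'rV[F]_N := delta_mx 0 ord_max.
have ba : b *m a = 0.
  rewrite mul_deltal; apply/matrixP=> x y; rewrite !ord1 scalar11 !mxE.
  by rewrite eq_sym (negPf lm).
have e0 : (1%:M + a *m b) *m delta_mx 0 0 = delta_mx 0 0 :> 'cV_N.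
  by rewrite row_colE mul_deltal scalar11 !mxE (negPf mx0) scale0r addr0.
apply: tveq_trans (tveq_step (delta_mx 0 0) w ba) _; rewrite e0; apply: key.
  by rewrite row_colE' mul_deltar scalar11 !mxE h !eqxx mulr1 sub0r oppr_eq0.
by rewrite row_colE' mul_deltar scalar11 !mxE w00 [0 == ord_max]eq_sym (negPf mx0) andbF mulr0 subr0.
Qed.

Lemma Omin_rank1 (Y : mat) : (0 < n)%N -> Omin Y ->
  exists (u : 'cV[F]_N) (v : 'rV[F]_N), [/\ u != 0, v != 0, v *m u = 0 & Y = u *m v].
Proof.
move=> n0 [g gu ->].
exists (g *m delta_mx 0 0), (delta_mx 0 ord_max *m invmx g); split.
- apply/negP => /eqP h.
  have : delta_mx 0 0 = 0 :> 'cV[F]_N by rewrite -[LHS](mulKmx gu) h mulmx0.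
  by move/matrixP/(_ 0 0); rewrite !mxE !eqxx => /eqP; rewrite oner_eq0.
- apply/negP => /eqP h.
  have : delta_mx 0 ord_max = 0 :> 'rV[F]_N by rewrite -[LHS](mulmxKV gu) h mul0mx.
  by move/matrixP/(_ 0 ord_max); rewrite !mxE !eqxx => /eqP; rewrite oner_eq0.
- rewrite mulmxA mulmxKV // mul_delta_mx_cond.
  by rewrite -val_eqE /= eqn0Ngt n0 mulr0n.
by rewrite -(mul_delta_mx (0 : 'I_1)) !mulmxA.
Qed.

Lemma invmx_mul (A B : mat) : A \in unitmx -> B \in unitmx ->
  invmx (A *m B) = invmx B *m invmx A.
Proof.
move=> uA uB; have uAB : A *m B \in unitmx by rewrite unitmx_mul uA.
have e : A *m B *m (invmx B *m invmx A) = 1%:M by rewrite !mulmxA mulmxK // mulmxV.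
by rewrite -[RHS](mulKmx uAB) e mulmx1.
Qed.

Lemma Omin_stable : (0 < n)%N -> tvstable (@Omin F n).
Proof.
move=> n0; split.
  move=> a b Y ba [g gu ->].
  have ia := tv_inv' ba.
  have [u1 _] := mulmx1_unit ia.
  exists ((1%:M + a *m b) *m g); first by rewrite unitmx_mul u1.
  rewrite invmx_mul // -!mulmxA; congr (_ *m (_ *m (_ *m (_ *m _)))).
  by rewrite -[LHS](mulKmx u1) ia mulmx1.
move=> c Y c0 [g gu ->].
(* Conjugation by diag(c, 1, ..., 1) multiplies the matrix unit in the upper right corner by c. *)
pose d : 'rV[F]_N := \row_j (if j == 0 then c else 1).
have d0 j : d 0 j != 0 by rewrite mxE; case: ifP => // _; exact: oner_neq0.
pose d' : 'rV[F]_N := \row_j (d 0 j)^-1.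
have dd : diag_mx d *m diag_mx d' = 1%:M.
  rewrite mulmx_diag -diag_const_mx; congr diag_mx.
  by apply/rowP => j; rewrite [LHS]mxE [d' 0 j]mxE divff // mxE.
have [du _] := mulmx1_unit dd.
have id' : invmx (diag_mx d) = diag_mx d' by rewrite -[RHS](mulKmx du) dd mulmx1.
exists (g *m diag_mx d); first by rewrite unitmx_mul gu du.
rewrite invmx_mul // id' -!mulmxA.
have -> : diag_mx d *m (delta_mx ord0 ord_max *m (diag_mx d' *m invmx g)) =
   c *: (delta_mx ord0 ord_max *m invmx g).
  rewrite !mulmxA scalemxAl; congr (_ *m _).
  apply/matrixP=> i j; rewrite mul_mx_diag mul_diag_mx !mxE.
  have [_|ni] := eqVneq i ord0; last by rewrite /= !(mulr0, mul0r).
  have [->|nj] := eqVneq j ord_max; last by rewrite /= !(mulr0, mul0r).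
  by rewrite /= -val_eqE /= eqn0Ngt n0 /= invr1 !mulr1.
by rewrite -scalemxAr.
Qed.

Lemma rank1_Omin (u : 'cV[F]_N) (v : 'rV[F]_N) : (0 < n)%N ->
  u != 0 -> v != 0 -> v *m u = 0 -> Omin (u *m v).
Proof.
move=> n0 u0 v0 vu; apply/(rank1_tveq n0 u0 v0 vu (Omin_stable n0)).
by exists 1%:M; rewrite ?unitmx1 // invmx1 mul1mx mulmx1.
Qed.

Section Minors.
Variable Z : mat -> Prop.
Hypothesis stZ : tvstable Z.

Definition tv (x y : 'I_N) (Y : mat) : mat :=
  (1%:M + delta_mx x y) *m Y *m (1%:M - delta_mx x y).

Lemma tvE x y Y i j : tv x y Y i j =
  Y i j + (i == x)%:R * Y y j - (j == y)%:R * Y i x - (i == x)%:R * (j == y)%:R * Y y x.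
Proof.
have dl (A : mat) i' j' : (delta_mx x y *m A) i' j' = (i' == x)%:R * A y j'.
  rewrite mxE (bigD1 y) //= big1 ?addr0; first by rewrite mxE eqxx andbT.
  by move=> k ky; rewrite mxE (negPf ky) andbF mul0r.
have dr (A : mat) i' j' : (A *m delta_mx x y) i' j' = (j' == y)%:R * A i' x.
  rewrite mxE (bigD1 x) //= big1 ?addr0; first by rewrite mxE eqxx /= mulrC.
  by move=> k kx; rewrite mxE (negPf kx) /= mulr0.
rewrite /tv mulmxBr mulmx1 mulmxDl mul1mx [LHS]mxE [X in _ + X]mxE dr ![(Y + _) _ _]mxE !dl.
by ring.
Qed.

Lemma tv_stable x y Y : x != y -> Z Y -> Z (tv x y Y).
Proof.
move=> xy; case: stZ => h _ ZY.
have := h (delta_mx x 0) (delta_mx 0 y) Y; rewrite mul_delta_mx; apply=> //.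
by rewrite mul_delta_mx_cond eq_sym (negPf xy) mulr0n.
Qed.

(** Vanishing of the minor with rows a, b and columns b, c, which for distinct indices has the
    single diagonal entry Y_bb. *)
Definition rel3 (a b c : 'I_N) : Prop := forall Y, Z Y -> Y a b * Y b c = Y a c * Y b b.

(** Subtracting from the relation its conjugate by 1 + E_bc leaves exactly the relation for (a, c,
    b). The next two lemmas use 1 + E_ab and 1 + E_dc in the same way. *)
Lemma rel3_swap23 a b c : a != b -> a != c -> b != c -> rel3 a b c -> rel3 a c b.
Proof.
move=> ab ac bc h Y ZY; have h0 := h Y ZY; have := h _ (tv_stable bc ZY).
rewrite !tvE (negPf ab) (negPf bc) !eqxx /= => h1.
apply/subr0_eq; transitivity ((Y a b * Y b c - Y a c * Y b b) -
  ((Y a b) * (Y b c + Y c c - Y b b - Y c b) - (Y a c - Y a b) * (Y b b + Y c b))).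
  by ring.
rewrite h0 subrr sub0r; apply/eqP; rewrite oppr_eq0 subr_eq0; apply/eqP.
by move: h1; rewrite !(mul0r, mul1r, subr0, addr0, mulr0).
Qed.

Lemma rel3_swap12 a b c : a != b -> a != c -> b != c -> rel3 a b c -> rel3 b a c.
Proof.
move=> ab ac bc h Y ZY; have h0 := h Y ZY; have := h _ (tv_stable ab ZY).
rewrite !tvE ![c == b]eq_sym ![b == a]eq_sym (negPf ab) (negPf bc) !eqxx /= => h1.
apply/subr0_eq; transitivity
  (((Y a b + Y b b - Y a a - Y b a) * Y b c - (Y a c + Y b c) * (Y b b - Y b a)) -
   (Y a b * Y b c - Y a c * Y b b)).
  by ring.
rewrite h0 subrr subr0; apply/eqP; rewrite subr_eq0; apply/eqP.
by move: h1; rewrite !(mul0r, mul1r, subr0, addr0, mulr0).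
Qed.

Lemma rel3_repl a b c d : a != b -> a != c -> b != c -> a != d -> b != d -> c != d ->
  rel3 a b c -> rel3 a b d.
Proof.
move=> ab ac bc ad bd cd h Y ZY; have h0 := h Y ZY.
have dc : d != c by rewrite eq_sym.
have := h _ (tv_stable dc ZY).
rewrite !tvE (negPf ad) (negPf bd) (negPf bc) !eqxx /= => h1.
apply/subr0_eq; transitivity ((Y a b * Y b c - Y a c * Y b b) -
  (Y a b * (Y b c - Y b d) - (Y a c - Y a d) * Y b b)).
  by ring.
rewrite h0 subrr sub0r; apply/eqP; rewrite oppr_eq0 subr_eq0; apply/eqP.
by move: h1; rewrite !(mul0r, mul1r, subr0, addr0, mulr0).
Qed.

(** The two transpositions and the free choice of the last index connect all triples of distinct
    indices. *)
Lemma rel3_all a b c : a != b -> a != c -> b != c -> rel3 a b c ->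
  forall i j k, i != j -> i != k -> j != k -> rel3 i j k.
Proof.
pose U a b := forall x, a != x -> b != x -> rel3 a b x.
have U1 a' b' c' : a' != b' -> a' != c' -> b' != c' -> rel3 a' b' c' -> U a' b'.
  move=> ab ac bc h x ax bx; have [<- //|cx] := eqVneq c' x.
  exact: rel3_repl h.
have U2 a' b' c' : a' != b' -> a' != c' -> b' != c' -> U a' b' -> U b' a'.
  move=> ab ac bc h; have h3 := h _ ac bc.
  by apply: (U1 _ _ c') (rel3_swap12 ab ac bc h3); rewrite // eq_sym.
have U3 a' b' x : a' != b' -> a' != x -> U a' b' -> U a' x.
  move=> ab ax h; have [<- //|bx] := eqVneq b' x.
  by apply: (U1 _ _ b') (rel3_swap23 ab ax bx (h _ ax bx)); rewrite // eq_sym.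
move=> ab ac bc h i j k ij ik jk.
have Ua := U1 _ _ _ ab ac bc h.
suff : U i j by apply.
have [ai|ai] := eqVneq a i; first by rewrite -ai; apply: (U3 _ _ _ ab) => //; rewrite ai.
have Uai := U3 _ _ _ ab ai Ua.
have Uia : U i a.
  have [bi|bi] := eqVneq b i.
    by apply: (U2 _ _ c) => //; rewrite -bi.
  by apply: (U2 _ _ b) => //; rewrite eq_sym.
have ia : i != a by rewrite eq_sym.
exact: (U3 _ _ _ ia ij).
Qed.

Hypothesis R3 : forall i j k, i != j -> i != k -> j != k -> rel3 i j k.
Hypothesis n2 : (1 < n)%N.

Lemma third (i l : 'I_N) : exists j, (i != j) && (l != j).
Proof.
have : (2 < #|'I_N|)%N by rewrite card_ord.
apply: contraPP => /forallNP h.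
have : [set: 'I_N] \subset [set i; l].
  apply/subsetP => x _; have := h x; rewrite !inE ![x == _]eq_sym.
  by case: eqP => //=; case: eqP.
move/subset_leq_card; rewrite cardsT => /leq_trans h'; apply/negP; rewrite -leqNgt.
by apply: h'; rewrite cards2; case: eqP.
Qed.

(** Conjugation by 1 + E_ba polarises the relation for (i, a, l) into a minor that avoids the
    diagonal. *)
Lemma rel4 i a l b Y : Z Y -> i != a -> i != l -> a != l -> i != b -> a != b -> l != b ->
  Y a b * Y i l = Y a l * Y i b.
Proof.
move=> ZY ia il al ib ab lb; have h0 := R3 ia il al ZY.
have ba : b != a by rewrite eq_sym.
have := R3 ia il al (tv_stable ba ZY).
rewrite !tvE (negPf ib) (negPf ab) ![l == a]eq_sym (negPf al) !eqxx /= => h1.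
apply/subr0_eq; transitivity ((Y i a - Y i b) * Y a l - Y i l * (Y a a - Y a b) -
  (Y i a * Y a l - Y i l * Y a a)).
  by ring.
rewrite h0 subrr subr0; apply/eqP; rewrite subr_eq0; apply/eqP.
by move: h1; rewrite !(mul0r, mul1r, subr0, addr0, mulr0).
Qed.

Lemma pivot_minors Y i l : Z Y -> i != l -> Y i l != 0 ->
  forall a b, Y a b * Y i l = Y a l * Y i b.
Proof.
move=> ZY il y0.
(* The principal minor on {i, l} is not among the relations. For a third index j, Y_jl times this
   minor is a combination of two [rel3] minors; if Y_jl = 0, conjugation by 1 + E_ji replaces it by
   Y_il. *)
have prin : Y l i * Y i l = Y l l * Y i i.
  have [j /andP[ij lj]] := third i l.
  have li : l != i by rewrite eq_sym.
  have prin1 Y' : Z Y' -> Y' j l != 0 -> Y' l i * Y' i l = Y' l l * Y' i i.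
    move=> ZY' yjl; have ji : j != i by rewrite eq_sym.
    have jl : j != l by rewrite eq_sym.
    have e1 := R3 ji jl il ZY'.
    have e2 := R3 jl ji li ZY'.
    apply: (mulfI yjl); apply/subr0_eq; transitivity
      ((Y' j l * Y' l i - Y' j i * Y' l l) * Y' i l + (Y' j i * Y' i l - Y' j l * Y' i i) * Y' l l).
      by ring.
    by rewrite e1 e2 !subrr !mul0r addr0.
  have [yjl|yjl] := eqVneq (Y j l) 0; last exact: prin1.
  have ji : j != i by rewrite eq_sym.
  have := prin1 _ (tv_stable ji ZY).
  rewrite !tvE (negPf li) (negPf lj) (negPf ij) !eqxx yjl /=.
  rewrite !(mul0r, mul1r, subr0, addr0, mulr0, add0r) => /(_ y0) h1.
  have h2 := R3 il ij lj ZY.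
  apply/subr0_eq; transitivity (((Y l i - Y l j) * Y i l - Y l l * (Y i i - Y i j))
     + (Y i l * Y l j - Y i j * Y l l)).
    by ring.
  by rewrite h1 h2 !subrr addr0.
move=> a b; have [->|ai] := eqVneq a i; first by rewrite mulrC.
have [->|bl] := eqVneq b l; first by [].
have [->|al] := eqVneq a l.
  have [-> //|bi] := eqVneq b i.
  have ib : i != b by rewrite eq_sym.
  have lb : l != b by rewrite eq_sym.
  by rewrite mulrC (R3 il ib lb ZY) mulrC.
have [->|bi] := eqVneq b i.
  exact: R3.
have [<-|ab] := eqVneq a b.
  by rewrite mulrC [RHS]mulrC; symmetry; apply: R3 => //; rewrite eq_sym.
by apply: rel4 => //; rewrite eq_sym.
Qed.

Lemma pivot_rank1 Y i l : Z Y -> i != l -> Y i l != 0 ->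
  exists (u : 'cV[F]_N) (v : 'rV[F]_N), Y = u *m v.
Proof.
move=> ZY il y0; exists (\col_a (Y a l / Y i l)), (\row_b Y i b).
apply/matrixP => a b; rewrite !mxE big_ord1 !mxE.
by apply: (mulIf y0); rewrite (pivot_minors ZY il y0) mulrAC divfK.
Qed.

Lemma minors_rank1 Y : (forall Y, Z Y -> sl Y) -> Z Y -> Y = 0 \/ Omin Y.
Proof.
move=> slZ ZY.
suff : Y = 0 \/ exists (u : 'cV[F]_N) (v : 'rV[F]_N), Y = u *m v.
  case=> [|[u [v e]]]; first by left.
  have [u0|u0] := eqVneq u 0; first by left; rewrite e u0 mul0mx.
  have [v0|v0] := eqVneq v 0; first by left; rewrite e v0 mulmx0.
  right; rewrite e; apply: rank1_Omin => //; first exact: ltnW.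
  have := slZ _ ZY; rewrite /sl e mxtrace_mulC [v *m u]mx11_scalar mxtrace_scalar mulr1n => ->.
  by rewrite -scalemx1 scale0r.
have [/existsP[i /existsP[l /andP[il yil]]]|/existsPn hd] :=
  boolP [exists i, exists l, (i != l) && (Y i l != 0)].
  by right; exact: pivot_rank1 yil.
have off i l : i != l -> Y i l = 0.
  by move=> il; have /existsPn/(_ l) := hd i; rewrite il /= negbK => /eqP.
have [/existsP[i /existsP[l yil]]|/existsPn hs] :=
  boolP [exists i, exists l, Y i i != Y l l].
  right.
  have il : i != l by apply: contraNneq yil => ->.
  (* A diagonal matrix with two different entries acquires an off-diagonal pivot under 1 + E_il;
     undoing the conjugation keeps rank one. The remaining case is scalar, hence zero by
     tracelessness. *)
  have [||u [v e]] := @pivot_rank1 (tv i l Y) i l _ il; first exact: tv_stable.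
    have li : l != i by rewrite eq_sym.
    by rewrite tvE !eqxx (off _ _ il) (off _ _ li) /= !mul1r subr0 add0r subr_eq0 eq_sym.
  have ba : (delta_mx 0 l : 'rV[F]_N) *m (delta_mx i 0 : 'cV_N) = 0.
    by rewrite mul_delta_mx_cond eq_sym (negPf il) mulr0n.
  have i1 := tv_inv ba; rewrite mul_delta_mx in i1.
  exists ((1%:M - delta_mx i l) *m u), (v *m (1%:M + delta_mx i l)).
  rewrite -mulmxA (mulmxA u) -e /tv -!mulmxA i1 mulmx1 mulmxA i1.
  by rewrite mul1mx.
left; have := slZ _ ZY; rewrite /sl /mxtrace => tr0.
have dg i : Y i i = Y 0 0.
  by have /existsPn/(_ 0) := hs i; rewrite negbK => /eqP.
move: tr0; under eq_bigr do rewrite dg.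
rewrite sumr_const card_ord -mulr_natl => /eqP; rewrite mulf_eq0 pnatr_eq0 /= => /eqP y0.
apply/matrixP => i j; rewrite [RHS]mxE; have [->|/off //] := eqVneq i j.
by rewrite dg y0.
Qed.
End Minors.
End RankOne.

(** * Highest weight modules: depth grading, vacuum functional, Whittaker functionals *)

Section Letters.
Variables (F : numClosedFieldType) (n : nat).
Local Notation N := n.+1.
Local Notation mat := 'M[F]_N.

(* The elementary matrix E_ab, corrected by a scalar so as to be traceless: in an
   sl-module these letters satisfy the commutation relations of gl. *)
Definition eb (a b : 'I_N) : mat := delta_mx a b - ((a == b)%:R / N%:R)%:M.

Lemma N_neq0 : N%:R != 0 :> F.
Proof. by rewrite pnatr_eq0. Qed.

Lemma tr_delta a b : \tr (delta_mx a b : mat) = (a == b)%:R.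
Proof.
rewrite /mxtrace (bigD1 a) //= big1 ?addr0 ?mxE ?eqxx //= => i ia.
by rewrite mxE (negPf ia).
Qed.

Lemma sl_eb a b : sl (eb a b).
Proof.
rewrite /sl /eb raddfB /= tr_delta mxtrace_scalar -[X in _ - X]mulr_natr divfK ?subrr //.
exact: N_neq0.
Qed.
Hint Resolve sl_eb : core.

Lemma lie_eb a b c d : lie (eb a b) (eb c d) = (b == c)%:R *: eb a d - (d == a)%:R *: eb c b.
Proof.
have -> : lie (eb a b) (eb c d) = lie (delta_mx a b) (delta_mx c d).
  rewrite /lie /eb !mulmxBl !mulmxBr -!scalar_mxM !mul_scalar_mx !mul_mx_scalar.
  move: ((a == b)%:R / N%:R) ((c == d)%:R / N%:R) => s t.
  rewrite [t * s]mulrC; move: (_ *m _) (_ *m _) (s * t)%:M => P Q R.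
  by apply/matrixP => i j; rewrite !mxE; ring.
rewrite /lie !mul_delta_mx_cond /eb.
have [->|bc] := eqVneq b c; have [->|da] := eqVneq d a; rewrite /= ?mulr1n ?mulr0n ?scale1r ?scale0r ?eqxx.
- by rewrite opprB addrA subrK.
- by rewrite mul0r (raddf0 (@scalar_mx F N)) !subr0.
- by rewrite mul0r (raddf0 (@scalar_mx F N)) !subr0.
by [].
Qed.

Lemma mat_eb (X : mat) : sl X -> X = \sum_a \sum_b X a b *: eb a b.
Proof.
move=> sX; rewrite {1}[X]matrix_sum_delta.
under [RHS]eq_bigr => a _.
  under eq_bigr => b _ do rewrite /eb scalerBr.
  rewrite sumrB; over.
rewrite sumrB; rewrite [X in _ - X](_ : _ = 0) ?subr0 //.
under eq_bigr => a _.
  rewrite (bigD1 a) //= big1 ?addr0; last first.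
    by move=> b ba; rewrite eq_sym (negPf ba) mul0r raddf0 scaler0.
  rewrite eqxx; over.
by rewrite -scaler_suml -/(mxtrace X) (sX : \tr X = 0) scale0r.
Qed.

Section Mod.
Variables (V : lmodType F) (act : mat -> V -> V).

Definition el (a b : 'I_N) (v : V) : V := act (eb a b) v.

(** A principal grading element: E_ab shifts its eigenvalue by b - a, so lowering letters strictly
    decrease it. *)
Definition hop (v : V) : V := - \sum_a (val a)%:R *: el a a v.

Definition hwmod (v0 : V) (g : 'I_N -> F) : Prop :=
  [/\ is_gmod act, v0 != 0, (forall a b : 'I_N, (a < b)%N -> el a b v0 = 0),
      (forall a, el a a v0 = g a *: v0)
    & (forall v, exists2 f, tens_wf f & v = tact act f v0)].

Hypothesis gm : is_gmod act.

Lemma elD a b u v : el a b (u + v) = el a b u + el a b v.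
Proof. exact: actDr. Qed.
Lemma elZ a b c u : el a b (c *: u) = c *: el a b u.
Proof. exact: actZr. Qed.
Lemma el0 a b : el a b 0 = 0.
Proof. exact: act0r. Qed.
Lemma elN a b u : el a b (- u) = - el a b u.
Proof. by rewrite -scaleN1r elZ scaleN1r. Qed.
Lemma elB a b u v : el a b (u - v) = el a b u - el a b v.
Proof. by rewrite elD elN. Qed.
Lemma el_sum a b (I : Type) (r : seq I) (P : pred I) (G : I -> V) :
  el a b (\sum_(i <- r | P i) G i) = \sum_(i <- r | P i) el a b (G i).
Proof. exact: act_sum. Qed.

Lemma el_comm a b c d v :
  el a b (el c d v) = el c d (el a b v) + (b == c)%:R *: el a d v - (d == a)%:R *: el c b v.
Proof.
have := actlie gm v (sl_eb a b) (sl_eb c d); rewrite lie_eb.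
have s1 : sl ((b == c)%:R *: eb a d) by exact: sl_scale.
have s2 : sl (- ((d == a)%:R *: eb c b)) by apply/sl_opp/sl_scale.
have eN : act (- ((d == a)%:R *: eb c b)) v = - ((d == a)%:R *: act (eb c b) v).
  by rewrite -[- (_ *: eb c b)]scaleNr actZl // scaleNr.
by rewrite actDl // eN actZl // /el -addrA => ->; rewrite addrC subrK.
Qed.

Lemma act_el X v : sl X -> act X v = \sum_a \sum_b X a b *: el a b v.
Proof.
move=> sX; rewrite {1}(mat_eb sX) act_suml //; last first.
  by move=> a; apply: (big_ind (@sl F n)); [exact: sl0|exact: sl_add|move=> b _; exact: sl_scale].
apply: eq_bigr => a _; rewrite act_suml //; last by move=> b; exact: sl_scale.
by apply: eq_bigr => b _; rewrite actZl.
Qed.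

(** The sl2 identity [e^K, f] = K (h - K + 1) e^(K-1) for e = E_ab and f = E_ba; with a and b
    exchanged it also serves for powers of a lowering letter. *)
Lemma sl2_comm a b K u : a != b ->
  iter K (el a b) (el b a u) = el b a (iter K (el a b) u)
   + K%:R *: (el a a (iter K.-1 (el a b) u) - el b b (iter K.-1 (el a b) u))
   - (K%:R * (K%:R - 1)) *: iter K.-1 (el a b) u.
Proof.
move=> ab; elim: K => [|K IH]; first by rewrite /= mul0r !scale0r addr0 subr0.
rewrite iterS IH /= elB elD !elZ elB el_comm !eqxx !scale1r.
case: K {IH} => [|K].
  by rewrite /= !mul0r !scale0r addr0 subr0 subrr mulr0 scale0r subr0 scale1r addrA.
rewrite [K.+1.-1]/= -[el a b (iter K _ u)]/(iter K.+1 (el a b) u).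
rewrite [el a b (el a a _)]el_comm [el a b (el b b _)]el_comm !eqxx.
rewrite [b == a]eq_sym (negPf ab) /= -[el a b (iter K _ u)]/(iter K.+1 (el a b) u).
move: (iter K.+1 _ u) => w; rewrite -[K.+2%:R]natr1.
by move: (K.+1%:R : F) => k; modring F.
Qed.

Inductive low (u0 : V) : nat -> V -> Prop :=
| low_0 r : low u0 r 0
| low_base r : low u0 r u0
| low_add r u v : low u0 r u -> low u0 r v -> low u0 r (u + v)
| low_scale r c u : low u0 r u -> low u0 r (c *: u)
| low_el r (a b : 'I_N) u : (b < a)%N -> low u0 r u -> low u0 r.+1 (el a b u).

Lemma low_leq u0 r s u : low u0 r u -> (r <= s)%N -> low u0 s u.
Proof.
move=> h; elim: h s => {r u}.
- by move=> *; exact: low_0.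
- by move=> *; exact: low_base.
- by move=> r u v _ IH1 _ IH2 s rs; apply: low_add; [exact: IH1|exact: IH2].
- by move=> r c u _ IH s rs; apply/low_scale/IH.
by move=> r a b u ba _ IH [|s] // rs; apply: low_el => //; exact: IH.
Qed.

Definition hwvec (u0 : V) : Prop :=
  (forall a b : 'I_N, (a < b)%N -> el a b u0 = 0) /\ (forall a, exists c, el a a u0 = c *: u0).

Lemma low_opp u0 r u : low u0 r u -> low u0 r (- u).
Proof. by move=> h; rewrite -scaleN1r; exact: low_scale. Qed.

(** Moving a non-lowering letter towards u0 only creates commutators that replace a letter, so the
    number of lowering letters does not grow. This is what makes non-lowering letters invisible in
    top degree. *)
Lemma low_up u0 r u (a b : 'I_N) : hwvec u0 -> low u0 r u -> (a <= b)%N -> low u0 r (el a b u).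
Proof.
case=> hu hd h; elim: h a b => {r u}.
- by move=> r a b _; rewrite el0; exact: low_0.
- move=> r a b; rewrite leq_eqVlt => /orP[/eqP/val_inj ->|/hu ->]; last exact: low_0.
  by case: (hd b) => c ->; apply/low_scale/low_base.
- by move=> r u v _ IH1 _ IH2 a b ab; rewrite elD; apply: low_add; [exact: IH1|exact: IH2].
- by move=> r c u _ IH a b ab; rewrite elZ; apply/low_scale/IH.
move=> r a b u ba hl IH c d cd.
have any x y : low u0 r.+1 (el x y u).
  case: (ltnP y x) => xy; first exact: low_el.
  exact: low_leq (IH _ _ xy) (leqnSn r).
rewrite el_comm; apply: low_add; first apply: low_add.
- by apply: low_el => //; exact: IH.
- exact/low_scale/any.
exact/low_opp/low_scale/any.
Qed.

Lemma low_any u0 r u a b : hwvec u0 -> low u0 r u -> low u0 r.+1 (el a b u).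
Proof.
move=> hw hl; case: (ltnP b a) => ba; first exact: low_el.
exact: low_leq (low_up hw hl ba) (leqnSn r).
Qed.

Lemma low_act u0 r u X : hwvec u0 -> sl X -> low u0 r u -> low u0 r.+1 (act X u).
Proof.
move=> hw sX hl; rewrite act_el //.
apply: big_ind => [||a _]; [exact: low_0|exact: low_add|].
apply: big_ind => [||b _]; [exact: low_0|exact: low_add|].
exact/low_scale/low_any.
Qed.

Lemma low_word u0 w : hwvec u0 -> (forall X, X \in w -> sl X) ->
  low u0 (size w) (foldr act u0 w).
Proof.
move=> hw; elim: w => [|X w IH] hs /=; first exact: low_base.
apply: low_act => //; first by apply: hs; rewrite inE eqxx.
by apply: IH => Z Zw; apply: hs; rewrite inE Zw orbT.
Qed.

Lemma low_tens u0 f : hwvec u0 -> tens_wf f -> exists r, low u0 r (tact act f u0).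
Proof.
move=> hw wf; exists (\max_(t <- f) size t.2); rewrite /tact [X in low _ _ X]big_seq.
apply: big_ind => [||t tf]; [exact: low_0|exact: low_add|].
apply/low_scale/low_leq; first exact: (low_word hw (wf t tf)).
exact: leq_bigmax_seq.
Qed.

Lemma hopD u v : hop (u + v) = hop u + hop v.
Proof. by rewrite /hop -opprD -big_split; congr (- _); apply: eq_bigr => a _; rewrite elD scalerDr. Qed.
Lemma hopZ c u : hop (c *: u) = c *: hop u.
Proof.
rewrite /hop scalerN scaler_sumr; congr (- _); apply: eq_bigr => a _.
by rewrite elZ !scalerA mulrC.
Qed.

Lemma hop_el (a b : 'I_N) u : hop (el a b u) = el a b (hop u) + (b%:R - a%:R) *: el a b u.
Proof.
have key : \sum_c (val c)%:R *: el c c (el a b u) =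
    \sum_c el a b ((val c)%:R *: el c c u) + (a%:R - b%:R) *: el a b u.
  rewrite (eq_bigr (fun c : 'I_N => el a b (c%:R *: el c c u) +
     ((c == a)%:R *: (c%:R *: el c b u) - (b == c)%:R *: (c%:R *: el a c u)))); last first.
    by move=> c _; rewrite el_comm elZ; modring F.
  rewrite big_split sumrB; congr (_ + _); rewrite scalerBl; congr (_ - _).
    rewrite (bigD1 a) //= eqxx scale1r big1 ?addr0 // => c ca.
    by rewrite (negPf ca) scale0r.
  rewrite (bigD1 b) //= eqxx scale1r big1 ?addr0 // => c cb.
  by rewrite eq_sym (negPf cb) scale0r.
by rewrite /hop elN el_sum key; modring F.
Qed.

Variables (v0 : V) (g : 'I_N -> F).

Definition hlam : F := - \sum_(a < N) a%:R * g a.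
Definition heig (s : nat) (u : V) : Prop := hop u = (hlam - s%:R) *: u.

Lemma heigZ s c u : heig s u -> heig s (c *: u).
Proof. by rewrite /heig hopZ => ->; rewrite !scalerA mulrC. Qed.

Lemma heig_el s (a b : 'I_N) u : (b < a)%N -> heig s u -> heig (s + (a - b)) (el a b u).
Proof.
move=> ba; rewrite /heig hop_el => ->; rewrite elZ -scalerDl; congr (_ *: _).
by rewrite natrD natrB 1?ltnW //; ring.
Qed.

Lemma heig_diag s a u : heig s u -> heig s (el a a u).
Proof. by rewrite /heig hop_el => ->; rewrite elZ subrr scale0r addr0. Qed.

(** Kills depths 1 to R and multiplies depth 0 by R!: a projection to the highest weight line that
    uses no weight decomposition of the module. *)
Fixpoint hprod (R : nat) (u : V) : V :=
  if R is R'.+1 then let w := hprod R' u in hop w - (hlam - R%:R) *: w else u.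

Lemma hprodD R u v : hprod R (u + v) = hprod R u + hprod R v.
Proof. by elim: R => //= R ->; rewrite hopD scalerDr opprD addrACA. Qed.

Lemma hprodZ R c u : hprod R (c *: u) = c *: hprod R u.
Proof. by elim: R => //= R ->; rewrite hopZ scalerBr !scalerA mulrC. Qed.

Lemma hprod_eig R s u : heig s u ->
  hprod R u = (\prod_(t < R) (t.+1%:R - s%:R)) *: u.
Proof.
move=> hs; elim: R => [|R IH] /=; first by rewrite big_ord0 scale1r.
rewrite IH hopZ (hs : hop u = _) big_ord_recr /= !scalerA -scalerBl; congr (_ *: _).
by ring.
Qed.

Inductive neg : V -> Prop :=
| neg_0 : neg 0
| neg_add u v : neg u -> neg v -> neg (u + v)
| neg_eig s u : heig s.+1 u -> neg u.

Lemma negZ c u : neg u -> neg (c *: u).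
Proof.
elim=> {u}; first by rewrite scaler0; exact: neg_0.
  by move=> u v _ h1 _ h2; rewrite scalerDr; exact: neg_add.
by move=> s u /(heigZ c); exact: neg_eig.
Qed.

Lemma neg_el (a b : 'I_N) u : (b < a)%N -> neg u -> neg (el a b u).
Proof.
move=> ba; elim=> {u}; first by rewrite el0; exact: neg_0.
  by move=> u v _ h1 _ h2; rewrite elD; exact: neg_add.
by move=> s u /(heig_el ba); rewrite addSn; exact: neg_eig.
Qed.

Lemma neg_diag a u : neg u -> neg (el a a u).
Proof.
elim=> {u}; first by rewrite el0; exact: neg_0.
  by move=> u v _ h1 _ h2; rewrite elD; exact: neg_add.
by move=> s u /(heig_diag a); exact: neg_eig.
Qed.

Lemma neg_hprod u : neg u -> exists R0, forall R, (R0 <= R)%N -> hprod R u = 0.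
Proof.
elim=> {u}.
- by exists 0%N => R _; rewrite -[X in hprod R X](scale0r 0) hprodZ scale0r.
- move=> u v _ [R1 h1] _ [R2 h2]; exists (maxn R1 R2) => R.
  by rewrite geq_max => /andP[r1 r2]; rewrite hprodD h1 // h2 // addr0.
move=> s u hs; exists s.+1 => R sR.
by rewrite (hprod_eig _ hs) (bigD1 (Ordinal sR)) //= subrr mul0r scale0r.
Qed.

Hypothesis hv0 : hwmod v0 g.

Lemma hwmod_hwvec : hwvec v0.
Proof. by case: hv0 => _ _ h1 h2 _; split=> // a; exists (g a). Qed.

Lemma heig_v0 : heig 0 v0.
Proof.
case: hv0 => _ _ _ h _; rewrite /heig /hop /hlam subr0 scaleNr scaler_suml.
by congr (- _); apply: eq_bigr => a _; rewrite h scalerA.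
Qed.

(** For large R, [hprod R] kills the left-hand vector but multiplies v0 by R!, which is nonzero in
    characteristic 0. *)
Lemma neg_v0 c : neg (c *: v0) -> c = 0.
Proof.
case/neg_hprod => R /(_ R (leqnn R)).
rewrite hprodZ (hprod_eig R heig_v0) => /eqP; rewrite !scaler_eq0.
have v00 : v0 != 0 by case: hv0.
rewrite (negPf v00) orbF => /orP[/eqP //|]; rewrite prodf_seq_eq0 => /hasP[t _].
by rewrite /= subr0 pnatr_eq0.
Qed.

Lemma low_neg r u : low v0 r u -> exists c, neg (u - c *: v0).
Proof.
elim=> {r u}.
- by move=> _; exists 0; rewrite scale0r subr0; exact: neg_0.
- by move=> _; exists 1; rewrite scale1r subrr; exact: neg_0.
- move=> r u v _ [c hc] _ [d hd]; exists (c + d).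
  by rewrite scalerDl opprD addrACA; exact: neg_add.
- by move=> r d u _ [c hc]; exists (d * c); rewrite -scalerA -scalerBr; exact: negZ.
move=> r a b u ba _ [c hc]; exists 0; rewrite scale0r subr0.
rewrite -[u](subrK (c *: v0)) elD; apply: neg_add; first exact: neg_el.
rewrite elZ; apply: negZ; have := heig_el ba heig_v0; rewrite add0n.
by case: (a - b)%N (subn_gt0 b a) => [|s _]; [rewrite ba|exact: neg_eig].
Qed.

Definition vacuum (xi : V -> F) : Prop :=
  [/\ (forall u v, xi (u + v) = xi u + xi v), (forall c u, xi (c *: u) = c * xi u),
      xi v0 = 1, (forall (a b : 'I_N) u, (b < a)%N -> xi (el a b u) = 0)
    & (forall a u, xi (el a a u) = g a * xi u)].

(** The value at u is the c with u - c v0 of positive depth. Its uniqueness ([neg_v0]) gives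
    linearity, and stability of [neg] under lowering and diagonal letters gives the last two
    properties. *)
Lemma vacuum_exists : exists xi, vacuum xi.
Proof.
have ex u : exists c, neg (u - c *: v0).
  case: hv0 => _ _ _ _ /(_ u)[f wf ->].
  by case: (low_tens hwmod_hwvec wf) => r; exact: low_neg.
pose xi u := projT1 (cid (ex u)).
have xiP u : neg (u - xi u *: v0) := projT2 (cid (ex u)).
have uniq u c : neg (u - c *: v0) -> xi u = c.
  move=> h; apply/subr0_eq/neg_v0; have := neg_add h (negZ (-1) (xiP u)).
  by rewrite scaleN1r opprB addrC addrA subrK -scalerBl.
exists xi; split.
- move=> u v; apply: uniq; rewrite scalerDl opprD addrACA; exact: neg_add.
- by move=> c u; apply: uniq; rewrite -scalerA -scalerBr; exact: negZ.
- by apply: uniq; rewrite scale1r subrr; exact: neg_0.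
- move=> a b u ba; apply: uniq; rewrite scale0r subr0.
  rewrite -[u](subrK (xi u *: v0)) elD; apply: neg_add; first exact/neg_el/xiP.
  rewrite elZ; apply: negZ; have := heig_el ba heig_v0; rewrite add0n.
  by case: (a - b)%N (subn_gt0 b a) => [|s _]; [rewrite ba|exact: neg_eig].
move=> a u; apply: uniq.
have h : el a a v0 = g a *: v0 by case: hv0.
rewrite mulrC -scalerA -h -elZ -elB; exact/neg_diag/xiP.
Qed.

(* [psi d] is the degree-d component of a Whittaker functional of character Y. *)
Definition whit (psi : nat -> V -> F) (Y : mat) : Prop :=
  [/\ (forall d u v, psi d (u + v) = psi d u + psi d v),
      (forall d c u, psi d (c *: u) = c * psi d u),
      (forall d (a b : 'I_N) u, (b < a)%N ->
         psi d (el a b u) = Y b a * (if d is d'.+1 then psi d' u else 0))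
    & (forall d, psi d v0 = (d == 0%N)%:R)].

Definition supper (Y : mat) : Prop := forall a b : 'I_N, (b <= a)%N -> Y a b = 0.

(** Apply psi_d to f v0 = 0: words shorter than d contribute 0, and a word of length d contributes
    the product of its trace pairings with Y. The sum is the symbol at Y up to the factor (2N)^d of
    the Killing form. *)
Lemma whit_assoc psi Y : whit psi Y -> supper Y -> assoc_var act Y.
Proof.
case=> pD pZ pl p0 uY; split; first by rewrite /sl /mxtrace big1 // => i _; exact: uY.
have low0 r u d : low v0 r u -> (r < d)%N -> psi d u = 0.
  move=> h; elim: h d => {r u}.
  - by move=> r d _; rewrite -[X in psi d X](scale0r 0) pZ mul0r.
  - by move=> r [|d] // _; rewrite p0.
  - by move=> r u v _ h1 _ h2 d rd; rewrite pD h1 // h2 // addr0.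
  - by move=> r c u _ h d rd; rewrite pZ h // mulr0.
  by move=> r a b u ba _ h [|d] // rd; rewrite pl // h // mulr0.
have p_sum d (I : Type) (r : seq I) (G : I -> V) :
    psi d (\sum_(i <- r) G i) = \sum_(i <- r) psi d (G i).
  elim/big_rec2: _ => [|i x y _ <-]; last by rewrite pD.
  by rewrite -[X in psi d X](scale0r 0) pZ mul0r.
have word d w : (forall X, X \in w -> sl X) -> (size w <= d)%N ->
    psi d (foldr act v0 w) = if size w == d then \prod_(X <- w) \tr (Y *m X) else 0.
  elim: w d => [|X w IH] [|d] hs //= hd.
  - by rewrite p0 big_nil.
  have hs' Z : Z \in w -> sl Z by move=> Zw; apply: hs; rewrite inE Zw orbT.
  rewrite act_el; last by apply: hs; rewrite inE eqxx.
  rewrite p_sum; set u := foldr _ _ _.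
  have -> : \sum_(i < N) psi d.+1 (\sum_b X i b *: el i b u) = \tr (Y *m X) * psi d u.
    rewrite mxtrace_mulC /mxtrace mulr_suml; apply: eq_bigr => a _.
    rewrite p_sum mxE mulr_suml; apply: eq_bigr => b _; rewrite pZ -mulrA; congr (_ * _).
    case: (ltnP b a) => ba; first exact: pl.
    rewrite (uY b a ba) mul0r; apply: (low0 (size w)) => //.
    by apply: low_up => //; [exact: hwmod_hwvec|exact: (low_word hwmod_hwvec)].
  rewrite IH // eqSS big_cons; case: ifP => // _; by rewrite mulr0.
move=> f d wf hd an; have := an v0; rewrite /tact => /(congr1 (psi d)).
rewrite p_sum -[X in psi d X](scale0r 0) pZ mul0r => h.
transitivity ((2 * N)%:R ^+ d * \sum_(t <- f) psi d (t.1 *: foldr act v0 t.2)); last first.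
  by rewrite h mulr0.
rewrite /symb mulr_sumr big_mkcond big_seq [RHS]big_seq; apply: eq_bigr => t tf.
rewrite pZ word; [|exact: wf|exact: hd].
case: eqP => [<-|_]; last by rewrite !mulr0.
rewrite mulrCA; congr (_ * _); elim: (t.2) => [|X w IH]; first by rewrite !big_nil mulr1.
by rewrite !big_cons IH /killing /= exprS mulrACA.
Qed.

Section AddRoot.
Variables (i i' : 'I_N) (nu : F).
Hypotheses (ii' : i' = i.+1 :> nat) (nuN : forall k : nat, nu != k%:R).

(** The scalar by which e^K f^K acts on an sl2 highest weight vector of weight nu. *)
Definition cfac (K : nat) : F := \prod_(j < K) (j.+1%:R * (nu - j%:R)).

Lemma cfac_neq0 K : cfac K != 0.
Proof.
apply/prodf_neq0 => j _; rewrite mulf_neq0 ?pnatr_eq0 //.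
by rewrite subr_eq0.
Qed.

(** Replacing u by f u turns the K-th term into K (nu - K + 1) psi(e^(K-1) u) / cfac K, and [cfac K]
    contains that same factor. The series is thus reproduced one degree lower: f acts with
    eigenvalue 1. *)
Definition addroot (psi : nat -> V -> F) (d : nat) (u : V) : F :=
  \sum_(K < d.+1) psi (d - K)%N (iter K (el i i') u) / cfac K.

Variables (psi : nat -> V -> F) (Y : mat).
Hypotheses (wpsi : whit psi Y) (uY : supper Y).
(** The commutators of E_ii' with other lowering letters are of the form E_ib or E_ai'; a zero
    column i and a zero row i' make psi vanish on them. *)
Hypotheses (Yi : forall b, Y b i = 0) (Yi' : forall a, Y i' a = 0) (Yii : Y i i' = 0).
Hypothesis hi : forall d u, psi d (el i i u - el i' i' u) = nu * psi d u.

Lemma iterelD K a b u v : iter K (el a b) (u + v) = iter K (el a b) u + iter K (el a b) v.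
Proof. by elim: K => //= K ->; rewrite elD. Qed.
Lemma iterelZ K a b c u : iter K (el a b) (c *: u) = c *: iter K (el a b) u.
Proof. by elim: K => //= K ->; rewrite elZ. Qed.

Lemma i_neq_i' : i != i'.
Proof. by rewrite -val_eqE /= ii' neq_ltn ltnSn. Qed.

Lemma addroot_other K d (a b : 'I_N) u : (b < a)%N -> (a, b) != (i', i) ->
  psi d (iter K (el i i') (el a b u)) =
  Y b a * (if d is d'.+1 then psi d' (iter K (el i i') u) else 0).
Proof.
case: wpsi => pD pZ pl _.
have pB e x y : psi e (x - y) = psi e x - psi e y by rewrite pD -scaleN1r pZ mulN1r.
elim: K a b u => [|K IH] a b u ba ne; first exact: pl.
rewrite iterSr el_comm iterelD -scaleNr !iterelD !iterelZ !pD !pZ IH //.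
have -> : (i' == a)%:R * psi d (iter K (el i i') (el i b u)) = 0.
  case: eqVneq => [e|_]; last by rewrite mul0r.
  rewrite mul1r IH ?Yi ?mul0r //; last first.
    by rewrite xpair_eqE negb_and i_neq_i'.
  move: ba ne; rewrite -e xpair_eqE eqxx /= ii' ltnS leq_eqVlt => /orP[/eqP/val_inj ->|//].
  by rewrite eqxx.
have -> : (- (b == i)%:R) * psi d (iter K (el i i') (el a i' u)) = 0.
  case: eqVneq => [e|_]; last by rewrite oppr0 mul0r.
  rewrite IH ?Yi' ?mul0r ?mulr0 //; last first.
    by rewrite xpair_eqE negb_and [i' == i]eq_sym i_neq_i' orbT.
  move: ba ne; rewrite e xpair_eqE eqxx andbT ii' => ia ai.
  by rewrite ltn_neqAle ia andbT -ii' eq_sym val_eqE.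
by rewrite !addr0; congr (_ * _); case: (d) => // d'; rewrite iterSr.
Qed.

Lemma addroot_same K d u :
  psi d (iter K (el i i') (el i' i u)) =
  (K%:R * (nu - K%:R + 1)) * psi d (iter K.-1 (el i i') u).
Proof.
case: wpsi => pD pZ pl _.
rewrite sl2_comm ?i_neq_i' // pD -scaleNr pD !pZ hi pl; last by rewrite ii'.
by rewrite Yii mul0r add0r; ring.
Qed.

Lemma whit_addroot : whit (addroot psi) (Y + delta_mx i i').
Proof.
case: (wpsi) => pD pZ pl p0; split.
- move=> d u v; rewrite /addroot -big_split /=; apply: eq_bigr => K _.
  by rewrite iterelD pD mulrDl.
- move=> d c u; rewrite /addroot mulr_sumr; apply: eq_bigr => K _.
  by rewrite iterelZ pZ mulrA.
- move=> d a b u ba; rewrite !mxE.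
  case: (eqVneq (a, b) (i', i)) => [[-> ->]|ne].
    rewrite Yii !eqxx add0r mul1r /addroot.
    case: d => [|d]; first by rewrite big_ord1 addroot_same /= !mul0r.
    rewrite big_ord_recl [X in X + _](_ : _ = 0) ?add0r; last first.
      by rewrite addroot_same /= !mul0r.
    apply: eq_bigr => K _; rewrite lift0 addroot_same subSS [K.+1.-1]/=.
    rewrite /cfac big_ord_recr /= -/(cfac K).
    have := cfac_neq0 K; have h2 : K.+1%:R != 0 :> F by rewrite pnatr_eq0.
    have h3 : nu - K%:R != 0 by rewrite subr_eq0.
    move: (psi _ _) => x; move: h2 h3; rewrite -natr1 => h2 h3 h1; field.
    by rewrite h1 h2 h3.
  have -> : (b == i) && (a == i') = false.
    by apply: negbTE; rewrite andbC -xpair_eqE.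
  rewrite addr0 /addroot; case: d => [|d].
    by rewrite big_ord1 addroot_other // sub0n !mulr0 mul0r.
  rewrite big_ord_recr addroot_other //= subnn mulr0 mul0r addr0 mulr_sumr.
  apply: eq_bigr => K _; have Kd : (K <= d)%N by rewrite -ltnS.
  rewrite addroot_other // subSn //.
  by rewrite mulrA.
move=> d; rewrite /addroot big_ord_recl /= subn0 p0 /cfac big_ord0 divr1.
rewrite big1 ?addr0 // => K _.
have -> : el i i' (iter (0 + K) (el i i') v0) = 0.
  rewrite add0n -[LHS]/(iter K.+1 (el i i') v0) iterSr.
  have -> : el i i' v0 = 0 by case: hv0 => _ _ hu _ _; apply: hu; rewrite ii'.
  by elim: (val K) => //= k ->; rewrite el0.
by rewrite -[X in psi _ X](scale0r 0) pZ !mul0r.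
Qed.

(** The coroot of an orthogonal root commutes with E_ii', which allows a second application of
    [addroot]. *)
Lemma addroot_weight (k k' : 'I_N) (nu' : F) : i != k -> i != k' -> i' != k -> i' != k' ->
  (forall d u, psi d (el k k u - el k' k' u) = nu' * psi d u) ->
  forall d u, addroot psi d (el k k u - el k' k' u) = nu' * addroot psi d u.
Proof.
move=> ik ik' i'k i'k' h d u; rewrite /addroot mulr_sumr; apply: eq_bigr => K _.
rewrite mulrA -h; congr (psi _ _ / _).
elim: (val K) u => //= m IH u; rewrite IH elB.
rewrite !(el_comm i i').
by rewrite ![_ == i]eq_sym (negPf ik) (negPf ik') (negPf i'k) (negPf i'k') !scale0r !addr0 !subr0.
Qed.
End AddRoot.

Lemma whit_vacuum xi : vacuum xi -> whit (fun d u => (d == 0%N)%:R * xi u) 0.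
Proof.
case=> xD xZ x0 xl _; split.
- by move=> d u v; rewrite xD mulrDr.
- by move=> d c u; rewrite xZ mulrCA.
- by move=> d a b u ba; rewrite xl // mulr0 mxE mul0r.
by move=> d; rewrite x0 mulr1.
Qed.
End Mod.
End Letters.

Arguments eb {F n} a b.

(** * Powers of root vectors acting on weight vectors *)

Section GmodFacts.
Variables (F : numClosedFieldType) (n : nat).
Local Notation N := n.+1.
Local Notation mat := 'M[F]_N.
Variables (V : lmodType F) (act : mat -> V -> V).
Hypothesis gm : is_gmod act.
Local Notation el := (el act).

Lemma el_eig_iter a c d K u x : el a a u = x *: u ->
  el a a (iter K (el c d) u) =
  (x + K%:R * ((a == c)%:R - (a == d)%:R)) *: iter K (el c d) u.
Proof.
move=> h; elim: K => [|K IH]; first by rewrite mul0r addr0.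
rewrite iterS el_comm // IH elZ // -natr1 [d == a]eq_sym.
by case: (eqVneq a c) => [ac|_]; case: (eqVneq a d) => [ad|_]; rewrite -?ac -?ad; modring F.
Qed.

(** The positive root vectors other than E_ii' span the nilradical of a minimal parabolic, which the
    sl2 of the simple root normalises. *)
Lemma upper_iter (i i' : 'I_N) (y : V) : i' = i.+1 :> nat ->
  (forall a b : 'I_N, (a < b)%N -> (a, b) != (i, i') -> el a b y = 0) ->
  forall a b : 'I_N, (a < b)%N -> (a, b) != (i, i') ->
    el a b (el i' i y) = 0 /\ el a b (el i i' y) = 0.
Proof.
move=> ii' h a b ab ne; rewrite (el_comm gm a b i' i) (el_comm gm a b i i') !(h a b) // !el0 //; split.
  have -> : (b == i')%:R *: el a i y = 0.
    have [e|_] := eqVneq b i'; last by rewrite scale0r.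
    move: ab ne; rewrite e xpair_eqE eqxx andbT ii' ltnS leq_eqVlt val_eqE => /orP[->//|ai] _.
    by rewrite h ?scaler0 // xpair_eqE negb_and -[i == i']val_eqE /= ii' neq_ltn ltnSn orbT.
  have -> : (i == a)%:R *: el i' b y = 0.
    have [e|_] := eqVneq i a; last by rewrite scale0r.
    move: ab ne; rewrite -e xpair_eqE eqxx /= => ib bi'.
    rewrite h ?scaler0 //; first by rewrite ii' ltn_neqAle ib andbT -ii' eq_sym val_eqE.
    by rewrite xpair_eqE negb_and -val_eqE /= ii' neq_ltn ltnSn orbT.
  by rewrite addr0 subr0.
have -> : (b == i)%:R *: el a i' y = 0.
  have [e|_] := eqVneq b i; last by rewrite scale0r.
  move: ab; rewrite e => ai; rewrite h ?scaler0 //; first by rewrite ii' ltnW.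
  by rewrite xpair_eqE negb_and -val_eqE /= neq_ltn ai.
have -> : (i' == a)%:R *: el i b y = 0.
  have [e|_] := eqVneq i' a; last by rewrite scale0r.
  move: ab; rewrite -e ii' => ib; rewrite h ?scaler0 //; first exact: ltnW.
  by rewrite xpair_eqE negb_and -[b == i']val_eqE /= ii' (gtn_eqF ib) orbT.
by rewrite addr0 subr0.
Qed.

Lemma upper_fiter (i i' : 'I_N) (y : V) K : i' = i.+1 :> nat ->
  (forall a b : 'I_N, (a < b)%N -> (a, b) != (i, i') -> el a b y = 0) ->
  forall a b : 'I_N, (a < b)%N -> (a, b) != (i, i') -> el a b (iter K (el i' i) y) = 0.
Proof.
move=> ii' h; elim: K => //= K IH a b ab ne.
by case: (upper_iter ii' IH ab ne).
Qed.

Lemma upper_eiter (i i' : 'I_N) (y : V) K : i' = i.+1 :> nat ->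
  (forall a b : 'I_N, (a < b)%N -> (a, b) != (i, i') -> el a b y = 0) ->
  forall a b : 'I_N, (a < b)%N -> (a, b) != (i, i') -> el a b (iter K (el i i') y) = 0.
Proof.
move=> ii' h; elim: K => //= K IH a b ab ne.
by case: (upper_iter ii' IH ab ne).
Qed.

Lemma iter_el0 a b k : iter k (el a b) 0 = 0.
Proof. by elim: k => //= k ->; rewrite el0. Qed.

Lemma iter_el_ge a b k l u : (k <= l)%N -> iter k (el a b) u = 0 -> iter l (el a b) u = 0.
Proof. by move=> kl h; rewrite -(subnK kl) iterD h iter_el0. Qed.

(** Two extra powers suffice because ad(E_ab)^3 = 0: [X1] is the first commutator with the letter,
    and its own commutator is a multiple of E_ab. *)
Lemma iter_el_letter a b c d m u : a != b -> iter m (el a b) u = 0 ->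
  iter m.+2 (el a b) (el c d u) = 0.
Proof.
move=> ab.
pose X1 u := (b == c)%:R *: el a d u - (d == a)%:R *: el c b u.
have e0 x : el a b (el c d x) = el c d (el a b x) + X1 x.
  by rewrite el_comm // /X1 addrA.
have e1 x : el a b (X1 x) = X1 (el a b x) + (- 2 * ((b == c)%:R * (d == a)%:R)) *: el a b x.
  rewrite /X1 elB // !elZ // (el_comm gm a b a d) (el_comm gm a b c b) ![b == a]eq_sym (negPf ab).
  have [bc|_] := eqVneq b c; have [da|_] := eqVneq d a; rewrite ?bc ?da; modring F.
have p1 k x : iter k (el a b) x = 0 -> iter k.+1 (el a b) (X1 x) = 0.
  elim: k x => [|k IH] x h.
    by rewrite (h : x = 0) /X1 /= !el0 // !scaler0 subr0 el0.
  rewrite iterSr e1 iterelD // iterelZ // IH; last by rewrite -iterSr.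
  by rewrite -iterSr (iter_el_ge (leqnSn _) h) scaler0 addr0.
elim: m u => [|m IH] u h.
  by rewrite (h : u = 0) /= !el0.
rewrite iterSr e0 iterelD // IH ?add0r; last by rewrite -iterSr.
exact: p1.
Qed.

End GmodFacts.

(** * Simplicity, local nilpotency and elements of the annihilator *)

Section Annihilators.
Variables (F : numClosedFieldType) (n : nat).
Local Notation N := n.+1.
Local Notation mat := 'M[F]_N.
Variables (V : lmodType F) (act : mat -> V -> V) (v0 : V) (g : 'I_N -> F).
Hypothesis hv0 : hwmod act v0 g.
Local Notation el := (el act).

Definition gmod_simple : Prop :=
  forall S : V -> Prop, S 0 ->
    (forall u v, S u -> S v -> S (u + v)) ->
    (forall c u, S u -> S (c *: u)) ->
    (forall X u, sl X -> S u -> S (act X u)) ->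
    (forall v, S v) \/ (forall v, S v -> v = 0).

Let gm : is_gmod act. Proof. by case: hv0. Qed.

Lemma e_fiter (i i' : 'I_N) K : i' = i.+1 :> nat ->
  el i i' (iter K (el i' i) v0) =
  (K%:R * (g i - g i' - K%:R + 1)) *: iter K.-1 (el i' i) v0.
Proof.
move=> ii'; case: hv0 => _ _ hu hd _.
have ne : i' != i by rewrite -val_eqE /= ii' neq_ltn ltnSn orbT.
have := sl2_comm gm K v0 ne; rewrite (hu i i') ?ii' //.
have -> : iter K (el i' i) 0 = 0 by elim: K => //= K ->; rewrite el0.
rewrite !(el_eig_iter gm _ _ _ (hd _)) !eqxx (negPf ne) [i == i']eq_sym (negPf ne).
case: K => [|K]; first by rewrite /= !mul0r !scale0r addr0 subr0 => <-.
rewrite [K.+1.-1]/= -natr1; move: (iter K _ _) (el i i' _) => w z h.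
apply/subr0_eq; rewrite [RHS]h; move: (g i) (g i') (K%:R : F) => x y k.
by modring F.
Qed.

Section Simple.
Hypothesis smp : gmod_simple.
Variable xi : V -> F.
Hypothesis vac : vacuum act v0 g xi.

(** The vectors with this property form a submodule, which is proper because xi(v0) = 1. *)
Lemma simple_xi u : (forall w, (forall X, X \in w -> sl X) -> xi (foldr act u w) = 0) -> u = 0.
Proof.
case: vac => xD xZ x0 _ _.
pose S u := forall w, (forall X, X \in w -> sl X) -> xi (foldr act u w) = 0.
have xi00 : xi 0 = 0 by rewrite -[X in xi X](scale0r 0) xZ mul0r.
have [||||h|h] := smp (S := S).
- by move=> w hw; rewrite -[X in foldr act X](scale0r 0) foldr_actZ // scale0r.
- by move=> x y hx hy w hw; rewrite foldr_actD // xD hx // hy // addr0.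
- by move=> c x hx w hw; rewrite foldr_actZ // xZ hx // mulr0.
- move=> X x sX hx w hw; have := hx (rcons w X); rewrite foldr_rcons; apply.
  by move=> Z; rewrite mem_rcons inE => /orP[/eqP -> //|/hw].
- have /eqP := h v0 [::] (fun _ => ltac:(by [])).
  by rewrite /= x0 oner_eq0.
exact: h.
Qed.

Lemma xi_hop u : xi (hop act u) = hlam g * xi u.
Proof.
case: vac => xD xZ _ _ xd.
have xi00 : xi 0 = 0 by rewrite -[X in xi X](scale0r 0) xZ mul0r.
have xs (I : Type) (r : seq I) (G : I -> V) : xi (\sum_(i <- r) G i) = \sum_(i <- r) xi (G i).
  by elim/big_rec2: _ => // i x y _ <-; rewrite xD.
rewrite /hop -scaleN1r xZ xs /hlam mulN1r mulNr mulr_suml; congr (- _).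
by apply: eq_bigr => a _; rewrite xZ xd mulrA.
Qed.

Lemma xi_neg u : neg act g u -> xi u = 0.
Proof.
case: vac => xD xZ _ _ _; elim=> {u}.
- by rewrite -[X in xi X](scale0r 0) xZ mul0r.
- by move=> u v _ h1 _ h2; rewrite xD h1 h2 addr0.
move=> s u hs; have := xi_hop u; rewrite (hs : hop act u = _) xZ => /eqP.
rewrite -subr_eq0 -mulrBl addrAC subrr sub0r mulf_eq0 oppr_eq0 pnatr_eq0 /=.
by move/eqP.
Qed.

(** The submodule generated by u stays in positive depth, where xi vanishes. *)
Lemma singular0 u s : hwvec act u -> heig act g s.+1 u -> u = 0.
Proof.
move=> hw hs; apply: simple_xi => w hwf; apply: xi_neg.
have := low_word gm hw hwf; move: (size w) (foldr _ _ _) => r x; elim=> {r x}.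
- by move=> _; exact: neg_0.
- by move=> _; exact: neg_eig hs.
- by move=> r x y _ h1 _ h2; exact: neg_add.
- by move=> r c x _ h; exact: negZ.
by move=> r a b x ba _ h; exact: neg_el.
Qed.

Lemma simple_root_nil (i i' : 'I_N) m : i' = i.+1 :> nat -> g i - g i' = m%:R ->
  iter m.+1 (el i' i) v0 = 0.
Proof.
move=> ii' hm; case: (hv0) => _ _ hu hd _.
have hu' : forall a b : 'I_N, (a < b)%N -> (a, b) != (i, i') -> el a b v0 = 0.
  by move=> a b ab _; exact: hu.
apply: (@singular0 _ m).
  split=> [a b ab|a]; last first.
    by eexists; rewrite (el_eig_iter gm _ _ _ (hd a)).
  have [[-> ->]|ne] := eqVneq (a, b) (i, i'); last exact: (upper_fiter gm _ ii' hu').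
  by rewrite e_fiter // hm -natr1 opprD addrA subrr sub0r addNr mulr0 scale0r.
have : forall k, heig act g k (iter k (el i' i) v0).
  elim=> [|k IH]; first exact: heig_v0.
  have lt : (i < i')%N by rewrite ii'.
  have := heig_el gm lt IH; rewrite ii' subSn // subnn addn1.
  by rewrite iterS.
exact.
Qed.
End Simple.

Definition lnil (a b : 'I_N) : Prop := forall u, exists k, iter k (el a b) u = 0.

Lemma lnil_gen a b : a != b -> (exists k, iter k (el a b) v0 = 0) -> lnil a b.
Proof.
move=> ab h0 u; case: (hv0) => _ _ _ _ /(_ u)[f wf ->].
have [r] := low_tens gm (hwmod_hwvec hv0) wf.
elim=> {r}.
- by move=> _; exists 0%N.
- by [].
- move=> _ x y _ [k hk] _ [l hl]; exists (maxn k l); rewrite iterelD //.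
  by rewrite (iter_el_ge gm _ hk) ?leq_maxl // (iter_el_ge gm _ hl) ?leq_maxr // addr0.
- by move=> _ c x _ [k hk]; exists k; rewrite iterelZ // hk scaler0.
by move=> _ c d x _ _ [k hk]; exists k.+2; exact: (iter_el_letter gm).
Qed.

(** Put X = E_ac, Y = E_cb and Z = [X, Y] = E_ab, which commutes with both. If X x = 0 then X^k Y^k
    x = k! Z^k x, so Z is nilpotent on ker X; an induction on the power of X that kills u does the
    rest. *)
Lemma lnil_heis a c b : a != c -> c != b -> a != b -> lnil a c -> lnil c b -> lnil a b.
Proof.
move=> ac cb ab hX hY u.
have XZ x : el a c (el a b x) = el a b (el a c x).
  by rewrite el_comm // [c == a]eq_sym (negPf ac) [b == a]eq_sym (negPf ab) !scale0r addr0 subr0.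
have XY x : el a c (el c b x) = el c b (el a c x) + el a b x.
  by rewrite el_comm // eqxx [b == a]eq_sym (negPf ab) scale1r scale0r subr0.
have XZk k x : el a c (iter k (el a b) x) = iter k (el a b) (el a c x).
  by elim: k => //= k IH; rewrite XZ IH.
have YZ x : el c b (el a b x) = el a b (el c b x).
  by rewrite el_comm // [b == a]eq_sym (negPf ab) [b == c]eq_sym (negPf cb) !scale0r addr0 subr0.
have YZk k x : el c b (iter k (el a b) x) = iter k (el a b) (el c b x).
  by elim: k => //= k IH; rewrite YZ IH.
have step x k : el a c x = 0 ->
    el a c (iter k.+1 (el c b) x) = k.+1%:R *: el a b (iter k (el c b) x).
  move=> x0; elim: k => [|k IH]; first by rewrite /= XY x0 el0 // add0r scale1r.
  rewrite iterS XY IH elZ // YZ -iterS; rewrite -[k.+2%:R]natr1; modring F.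
have ZYk k x : el a b (iter k (el c b) x) = iter k (el c b) (el a b x).
  by elim: k => //= k IH; rewrite -YZ IH.
have fact k x : el a c x = 0 ->
    iter k (el a c) (iter k (el c b) x) = k`!%:R *: iter k (el a b) x.
  elim: k x => [|k IH] x x0; first by rewrite scale1r.
  rewrite iterSr step // iterelZ // ZYk IH; last by rewrite XZ x0 el0.
  by rewrite scalerA -natrM -iterSr.
have base x : el a c x = 0 -> exists k, iter k (el a b) x = 0.
  move=> x0; have [k hk] := hY x; exists k; have := fact k x x0; rewrite hk (iter_el0 gm).
  by move/esym/eqP; rewrite scaler_eq0 pnatr_eq0 eqn0Ngt fact_gt0 => /eqP.
have [p] := hX u; elim: p u => [|p IH] u hp; first by exists 0%N.
have [k hk] : exists k, iter k (el a b) (el a c u) = 0 by apply: IH; rewrite -iterSr.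
have [l hl] : exists l, iter l (el a b) (iter k (el a b) u) = 0.
  by apply: base; rewrite XZk.
by exists (l + k)%N; rewrite iterD.
Qed.

Lemma lnil_range (xi : V -> F) (a b : 'I_N) : gmod_simple -> vacuum act v0 g xi -> (b < a)%N ->
  (forall i i' : 'I_N, (b <= i)%N -> (i' <= a)%N -> i' = i.+1 :> nat ->
     exists m : nat, g i - g i' = m%:R) -> lnil a b.
Proof.
move=> smp vac; have [k] := ubnP (a - b)%N; elim: k a => // k IH a hk ba h.
have a0 : (0 < a)%N by exact: leq_ltn_trans ba.
have hc : (a.-1 < N)%N by exact: leq_ltn_trans (leq_pred _) (ltn_ord a).
pose c : 'I_N := Ordinal hc.
have ca : a = c.+1 :> nat by rewrite /= prednK.
have nac : a != c by apply/eqP => e; have := ca; rewrite {1}e => /n_Sn.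
have lac : lnil a c.
  apply: lnil_gen => //; have bc' : (b <= c)%N by rewrite -ltnS -ca.
  have [m hm] := h c a bc' (leqnn _) ca.
  by exists m.+1; exact: (simple_root_nil smp vac ca hm).
have [e|cb] := eqVneq c b; first by rewrite -e.
have bc : (b < c)%N by rewrite ltn_neqAle -ltnS -ca ba andbT eq_sym.
apply: (lnil_heis nac cb) => //; first by rewrite -val_eqE /= gtn_eqF.
have ck : (c - b < k)%N by move: hk bc; rewrite ca; lia.
apply: (IH c ck bc) => i i' bi ic; apply: h => //.
by apply: leq_trans ic _; rewrite ca.
Qed.

Definition tmul (f1 f2 : tens F n) : tens F n :=
  [seq (x.1 * y.1, x.2 ++ y.2) | x <- f1, y <- f2].

Lemma tact_tmul f1 f2 v : tens_wf f1 -> tact act (tmul f1 f2) v = tact act f1 (tact act f2 v).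
Proof.
move=> wf; rewrite /tact /tmul big_allpairs_dep /= big_seq [RHS]big_seq.
apply: eq_bigr => x xf.
have fs (r : seq (F * seq mat)) G : foldr act (\sum_(t <- r) G t) x.2 = \sum_(t <- r) foldr act (G t) x.2.
  elim/big_rec2: _ => [|t u w _ <-]; last by rewrite foldr_actD //; exact: wf.
  by rewrite -[X in foldr act X](scale0r 0) foldr_actZ ?scale0r //; exact: wf.
rewrite fs scaler_sumr; apply: eq_bigr => y _.
by rewrite foldr_actZ ?foldr_cat ?scalerA //; exact: wf.
Qed.

Lemma tmul_wf f1 f2 : tens_wf f1 -> tens_wf f2 -> tens_wf (tmul f1 f2).
Proof.
move=> w1 w2 t /allpairsP[[x y] /= [xf yf ->]] X /=; rewrite mem_cat => /orP[].
  exact: w1.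
exact: w2.
Qed.

Definition tdeg (d : nat) (f : tens F n) : Prop := forall t, t \in f -> (size t.2 <= d)%N.

Lemma tmul_deg d e f1 f2 : tdeg d f1 -> tdeg e f2 -> tdeg (d + e) (tmul f1 f2).
Proof.
move=> h1 h2 t /allpairsP[[x y] /= [xf yf ->]] /=; rewrite size_cat.
by apply: leq_add; [exact: h1|exact: h2].
Qed.

Lemma symb_tmul d e f1 f2 Y : tdeg d f1 -> tdeg e f2 ->
  symb (tmul f1 f2) (d + e) Y = symb f1 d Y * symb f2 e Y.
Proof.
move=> h1 h2; rewrite /symb /tmul [LHS]big_mkcond big_allpairs_dep /= mulr_suml [RHS]big_mkcond.
rewrite [LHS]big_seq [RHS]big_seq; apply: eq_bigr => x xf.
rewrite [X in _ * X]big_mkcond; case: ifP => [/eqP xd|/negP xd].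
  rewrite mulr_sumr; apply: eq_bigr => y _; rewrite size_cat xd eqn_add2l.
  by case: ifP => _; rewrite ?mulr0 // big_cat /= mulrACA.
rewrite big_seq big1 // => y yf; rewrite size_cat; case: ifP => // /eqP hh; case: xd.
have := h1 _ xf; have := h2 _ yf; rewrite eqn_leq => a1 a2; rewrite a2 /=.
by rewrite -(leq_add2r e) -hh leq_add2l.
Qed.

Lemma killing_eb (Y : mat) a b : sl Y -> killing Y (eb a b) = (2 * N)%:R * Y b a.
Proof.
move=> sY; rewrite /killing /eb mulmxBr raddfB /= mul_mx_scalar linearZ /= (sY : \tr Y = 0).
rewrite mulr0 subr0; congr (_ * _).
rewrite /mxtrace (bigD1 b) //= mxE (bigD1 a) //= !mxE !eqxx mulr1 !big1 ?addr0 //.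
  by move=> i ib; rewrite mxE big1 // => j _; rewrite mxE [i == b](negPf ib) andbF mulr0.
by move=> i ia; rewrite mxE (negPf ia) mulr0.
Qed.

Lemma twoN_neq0 : (2 * N)%:R != 0 :> F.
Proof. by rewrite pnatr_eq0 muln_eq0. Qed.

(** The lowest root vector commutes with every lowering letter, so a power that kills v0 kills the
    module; its symbol is a power of the corner entry of Y. *)
Lemma nil_corner (Y : mat) d : iter d (el ord_max ord0) v0 = 0 -> assoc_var act Y ->
  Y ord0 ord_max = 0.
Proof.
move=> hd [sY hY].
have kill u : iter d (el ord_max ord0) u = 0.
  case: (hv0) => _ _ _ _ /(_ u)[f wf ->].
  have [r] := low_tens gm (hwmod_hwvec hv0) wf; elim=> {r}.
  - by move=> _; rewrite (iter_el0 gm).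
  - by [].
  - by move=> _ x y _ h1 _ h2; rewrite iterelD // h1 h2 addr0.
  - by move=> _ c x _ h; rewrite iterelZ // h scaler0.
  move=> _ a b x ba _ h.
  have cm y : el ord_max ord0 (el a b y) = el a b (el ord_max ord0 y).
    rewrite el_comm //; have -> : ord0 == a = false.
      by apply/negbTE; rewrite -val_eqE /= neq_ltn (leq_ltn_trans _ ba).
    have -> : b == ord_max = false.
      by apply/negbTE; rewrite -val_eqE /= neq_ltn (leq_trans ba) // -ltnS.
    by rewrite !scale0r addr0 subr0.
  have -> : iter d (el ord_max ord0) (el a b x) = el a b (iter d (el ord_max ord0) x).
    by elim: (d) => //= k ->; rewrite cm.
  by rewrite h el0.
have := hY [:: (1, nseq d (eb ord_max ord0))] d.
rewrite /symb big_cons big_nil /= size_nseq eqxx addr0 mul1r.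
have -> : \prod_(X <- nseq d (eb ord_max ord0)) killing Y X = ((2 * N)%:R * Y ord0 ord_max) ^+ d.
  by elim: (d) => [|k IH]; rewrite ?big_nil // big_cons IH killing_eb // exprS.
have -> : (forall v, tact act [:: (1, nseq d (eb ord_max ord0))] v = 0) = True.
  apply/propext; split=> // _ v; rewrite /tact big_cons big_nil /= scale1r addr0.
  have -> : foldr act v (nseq d (eb ord_max ord0)) = iter d (el ord_max ord0) v.
    by elim: (d) => //= k ->.
  exact: kill.
move=> /(_ _ _ I) h; have /eqP : ((2 * N)%:R * Y ord0 ord_max) ^+ d = 0.
  apply: h => [t|t]; rewrite inE => /eqP ->; rewrite ?size_nseq //.
  by move=> X /=; rewrite mem_nseq => /andP[_ /eqP ->]; exact: sl_eb.
by rewrite expf_eq0 => /andP[_]; rewrite mulf_eq0 (negPf twoN_neq0) => /eqP.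
Qed.
End Annihilators.

(** * A product of shifted minors in the annihilator *)

Section MinorAnnihilator.
Variables (F : numClosedFieldType) (n : nat).
Local Notation N := n.+1.
Local Notation mat := 'M[F]_N.
Variables (V : lmodType F) (act : mat -> V -> V) (v0 : V) (g : 'I_N -> F).
Hypothesis hv0 : hwmod act v0 g.
Local Notation el := (el act).
Let gm : is_gmod act. Proof. by case: hv0. Qed.
Let lin := (elD gm, elN gm, elZ gm, el0 gm).
Variable o : 'I_N.
Hypotheses (o1 : o = 1%N :> nat) (n2 : (1 < n)%N).
Local Notation z := (ord0 : 'I_N).
Local Notation m := (ord_max : 'I_N).

Lemma ozF : (o == z) = false. Proof. by rewrite -val_eqE /= o1. Qed.
Lemma zoF : (z == o) = false. Proof. by rewrite -val_eqE /= o1. Qed.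
Lemma omF : (o == m) = false. Proof. by rewrite -val_eqE /= o1 ltn_eqF. Qed.
Lemma moF : (m == o) = false. Proof. by rewrite eq_sym omF. Qed.
Lemma mzF : (m == z) = false. Proof. by rewrite -val_eqE /= gtn_eqF // ltnW. Qed.
Lemma zmF : (z == m) = false. Proof. by rewrite eq_sym mzF. Qed.
Let eqs := (ozF, zoF, omF, moF, mzF, zmF).

(* Modulo lower order, the 2x2 minor in rows 1, n and columns 0, 1; the shift s
   makes its diagonal term vanish on one E_11-eigenspace. *)
Definition mnr (s : F) (u : V) : V := el o z (el m o u) - el m z (el o o u - s *: u).

Lemma mnrD s u v : mnr s (u + v) = mnr s u + mnr s v.
Proof. by rewrite /mnr !lin; modring F. Qed.
Lemma mnrZ s c u : mnr s (c *: u) = c *: mnr s u.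
Proof. by rewrite /mnr !lin; modring F. Qed.

(** The lowering letters of these two kinds commute with every [mnr s]; the lowering letters left
    over are E_(x,o) with x > 1. *)
Definition zlet (x y : 'I_N) : bool := ((y == z) && (x != z)) || ((1 < y < x)%N).

Lemma mnr_zlet s x y u : zlet x y -> mnr s (el x y u) = el x y (mnr s u).
Proof.
case/orP=> [/andP[/eqP -> xz]|/andP[y1 yx]].
  have zx : (z == x) = false by rewrite eq_sym (negPf xz).
  rewrite /mnr (el_comm gm m o x z) (el_comm gm o o x z) eqs.
  rewrite !lin !(el_comm gm o z x z) !(el_comm gm m z x z) zx !eqs.
  have [ex|_] := eqVneq o x; last by modring F.
  by rewrite -ex !(el_comm gm o z m z) !eqs; modring F.
have ox : (o == x) = false by rewrite -val_eqE /= o1 ltn_eqF // (ltn_trans y1).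
have zx : (z == x) = false by rewrite -val_eqE /= ltn_eqF // (leq_ltn_trans _ yx).
have ym : (y == m) = false by rewrite -val_eqE /= ltn_eqF // (leq_trans yx) // -ltnS.
have yo : (y == o) = false by rewrite -val_eqE /= o1 gtn_eqF.
rewrite /mnr (el_comm gm m o x y) (el_comm gm o o x y) ox ym yo.
rewrite !lin !(el_comm gm o z x y) !(el_comm gm m z x y) zx yo ym.
by modring F.
Qed.

Definition mword (l : seq 'I_N) : V := foldr (fun a u => el a o u) v0 l.

Inductive spn : V -> Prop :=
| spn_0 : spn 0
| spn_add u v : spn u -> spn v -> spn (u + v)
| spn_scale c u : spn u -> spn (c *: u)
| spn_m l : all (fun a : 'I_N => (1 < a)%N) l -> spn (mword l)
| spn_z x y u : zlet x y -> spn u -> spn (el x y u).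

(** Only E_(x,o) needs an argument: moved past a [zlet] letter it leaves commutators that are again
    a [zlet] letter or some E_(c,o). *)
Lemma spn_low (x y : 'I_N) u : (y < x)%N -> spn u -> spn (el x y u).
Proof.
move=> yx hu.
have [zxy|] := boolP (zlet x y); first exact: spn_z.
rewrite negb_or => /andP[h1 h2].
have yo : y = o.
  apply: val_inj; rewrite /= o1; move: h1 h2; rewrite yx andbT -leqNgt.
  have -> : x != z by rewrite -val_eqE /= gtn_eqF // (leq_ltn_trans _ yx).
  by rewrite andbT -val_eqE /=; case: (nat_of_ord y) => [|[]].
rewrite {}yo in yx h1 h2 *; rewrite o1 in yx.
elim: hu x yx {h1 h2} => {u}.
- by move=> x _; rewrite el0 //; exact: spn_0.
- by move=> u v _ h1 _ h2 x hx; rewrite elD //; apply: spn_add; [exact: h1|exact: h2].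
- by move=> c u _ h x hx; rewrite elZ //; apply/spn_scale/h.
- by move=> l hl x hx; apply: (spn_m (l := x :: l)); rewrite /= hx.
move=> c d u zcd hu IH x hx; rewrite (el_comm gm x o c d); apply: spn_add; first apply: spn_add.
- by apply: spn_z => //; exact: IH.
- have [oc|_] := eqVneq o c; last by rewrite scale0r; exact: spn_0.
  apply/spn_scale/spn_z => //.
  move: zcd; rewrite /zlet -oc o1 => /orP[/andP[/eqP -> _]|/andP[h1 h2]].
    by rewrite eqxx -val_eqE /= gtn_eqF // ltnW.
  by have := leq_trans h1 (ltnW h2).
rewrite -scaleN1r; apply: spn_scale.
have [dx|_] := eqVneq d x; last by rewrite scale0r; exact: spn_0.
apply/spn_scale/IH; move: zcd; rewrite /zlet dx => /orP[/andP[/eqP e _]|/andP[h1 h2]].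
  by rewrite e in hx.
exact: ltn_trans h2.
Qed.

Lemma spn_all u : spn u.
Proof.
case: (hv0) => _ _ _ _ /(_ u)[f wf ->].
have [r] := low_tens gm (hwmod_hwvec hv0) wf; elim=> {r}.
- by move=> _; exact: spn_0.
- by move=> _; exact: (spn_m (l := [::])).
- by move=> _ x y _ h1 _ h2; exact: spn_add.
- by move=> _ c x _ h; exact: spn_scale.
by move=> _ a b x ba _ h; exact: spn_low.
Qed.

Lemma mword_comm a b u : a != o -> b != o -> el a o (el b o u) = el b o (el a o u).
Proof.
move=> ao bo; rewrite (el_comm gm a o b o) ![o == _]eq_sym (negPf ao) (negPf bo).
by modring F.
Qed.

Lemma mword_count a l : all (fun a : 'I_N => (1 < a)%N) (a :: l) ->
  mword l = foldr (fun a u => el a o u) (iter (count_mem a l) (el a o) v0) (filter (predC1 a) l).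
Proof.
case/andP=> ha; elim: l => //= b l IH /andP[hb hl]; rewrite IH //.
have no (c : 'I_N) : (1 < c)%N -> c != o by move=> hc; rewrite -val_eqE /= o1 gtn_eqF.
case: (eqVneq b a) => [->|ne]; last by []. rewrite iterD /=.
move: (iter _ _ _) => w {IH hb}; elim: l hl => //= c l IHl /andP[hc hl].
by case: ifP => //= _; rewrite -IHl // mword_comm // no.
Qed.

Lemma size_count (l : seq 'I_N) : size l = (\sum_(a : 'I_N) count_mem a l)%N.
Proof.
elim: l => [|b l IH] /=; first by rewrite big1.
rewrite big_split /= -IH (bigD1 b) //= eqxx big1 // => a ab.
by rewrite eq_sym (negPf ab).
Qed.

(** The letters E_(a,o) commute; by the pigeonhole principle a long word contains a power of one of
    them that kills v0. *)
Lemma mword_bound : (forall a : 'I_N, (1 < a)%N -> lnil act a o) ->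
  exists M, forall l, all (fun a : 'I_N => (1 < a)%N) l -> (M < size l)%N -> mword l = 0.
Proof.
move=> hl.
have [K hK] : exists K : 'I_N -> nat, forall a : 'I_N, (1 < a)%N -> iter (K a) (el a o) v0 = 0.
  have ex (a : 'I_N) : exists k, (1 < a)%N -> iter k (el a o) v0 = 0.
    have [ha|ha] := boolP (1 < a)%N; last by exists 0%N.
    by have [k hk] := hl a ha v0; exists k.
  by have [K hK] := boolp.choice ex; exists K.
exists (\sum_a K a)%N => l al sl_.
have [a /andP[ha hc]] : exists a : 'I_N, (1 < a)%N && (K a <= count_mem a l)%N.
  apply/existsP; apply: contraLR sl_ => /existsPn h; rewrite -leqNgt size_count.
  apply: leq_sum => a _; have := h a; rewrite negb_and => /orP[na|]; last by rewrite -ltnNge => /ltnW.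
  rewrite (_ : count_mem a l = 0%N) //; apply/count_memPn; apply: contra na.
  by move: al => /allP/(_ a).
rewrite (mword_count (a := a)) /= ?ha //.
have -> : iter (count_mem a l) (el a o) v0 = 0.
  by apply: (iter_el_ge gm hc); exact: hK.
by elim: [seq _ <- l | _] => //= b l' ->; rewrite el0.
Qed.

Lemma mword_eig l : all (fun a : 'I_N => (1 < a)%N) l ->
  el o o (mword l) = (g o - (size l)%:R) *: mword l.
Proof.
elim: l => [|a l IH] /=; first by case: hv0 => _ _ _ -> _; rewrite subr0.
case/andP=> ha hl; rewrite (el_comm gm o o a o) IH // elZ // eqxx.
have -> : (o == a) = false by rewrite -val_eqE /= o1 ltn_eqF.
by rewrite -natr1; modring F.
Qed.

Fixpoint mprod (k j : nat) (u : V) : V :=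
  if k is k'.+1 then mprod k' j.+1 (mnr (g o - j%:R) u) else u.

Lemma mprodD k j u v : mprod k j (u + v) = mprod k j u + mprod k j v.
Proof. by elim: k j u v => //= k IH j u v; rewrite mnrD IH. Qed.
Lemma mprodZ k j c u : mprod k j (c *: u) = c *: mprod k j u.
Proof. by elim: k j u => //= k IH j u; rewrite mnrZ IH. Qed.
Lemma mprod_zlet k j x y u : zlet x y -> mprod k j (el x y u) = el x y (mprod k j u).
Proof. by move=> h; elim: k j u => //= k IH j u; rewrite mnr_zlet. Qed.

(** On a word of length exactly j the shift g_o - j removes the diagonal term and E_(m,o) lengthens
    the word; on a longer word both terms already have length above j. After k factors every length
    exceeds M. *)
Lemma mprod_mword M k j l :
  (forall l, all (fun a : 'I_N => (1 < a)%N) l -> (M < size l)%N -> mword l = 0) ->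
  (j + k = M.+1)%N -> all (fun a : 'I_N => (1 < a)%N) l -> (j <= size l)%N ->
  mprod k j (mword l) = 0.
Proof.
move=> hM; elim: k j l => [|k IH] j l e hl jl.
  by rewrite /= hM // -e addn0.
have jk : (j.+1 + k = M.+1)%N by rewrite addSnnS.
rewrite /= /mnr mword_eig // -scalerBl elZ // mprodD -scaleN1r mprodZ mprodZ.
rewrite mprod_zlet; last by rewrite /zlet eqxx eqs.
rewrite [mprod _ _ (el m z _)]mprod_zlet; last by rewrite /zlet eqxx eqs.
rewrite -[el m o (mword l)]/(mword (m :: l)) IH //=; last by rewrite n2.
move: jl; rewrite leq_eqVlt => /orP[/eqP ->|jl].
  by rewrite subrr scale0r scaler0 addr0 el0.
by rewrite (IH _ _ jk hl jl) !el0 // !scaler0 addr0.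
Qed.

Lemma mprod_kill : (forall a : 'I_N, (1 < a)%N -> lnil act a o) ->
  exists k, forall u, mprod k 0 u = 0.
Proof.
case/mword_bound => M hM; exists M.+1 => u; elim: (spn_all u) => {u}.
- by rewrite -[X in mprod _ _ X](scale0r 0) mprodZ scale0r.
- by move=> u v _ h1 _ h2; rewrite mprodD h1 h2 addr0.
- by move=> c u _ h; rewrite mprodZ h scaler0.
- by move=> l hl; apply: (mprod_mword hM).
by move=> x y u h _ IH; rewrite mprod_zlet // IH el0.
Qed.

Definition mnrt (s : F) : tens F n :=
  [:: (1, [:: eb o z; eb m o]); (-1, [:: eb m z; eb o o]); (s, [:: eb m z])].

Lemma mnrtE s u : tact act (mnrt s) u = mnr s u.
Proof.
rewrite /tact /mnrt !big_cons big_nil /= /mnr -!/(el _ _ _) elB // elZ //.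
by modring F.
Qed.

Lemma mnrt_wf s : tens_wf (mnrt s).
Proof.
move=> t; rewrite !inE => /or3P[] /eqP -> X /=; rewrite !inE.
- by case/orP=> /eqP ->; exact: sl_eb.
- by case/orP=> /eqP ->; exact: sl_eb.
by move/eqP ->; exact: sl_eb.
Qed.

Lemma mnrt_deg s : tdeg 2 (mnrt s).
Proof. by move=> t; rewrite !inE => /or3P[] /eqP ->. Qed.

Fixpoint mprodt (k j : nat) : tens F n :=
  if k is k'.+1 then tmul (mprodt k' j.+1) (mnrt (g o - j%:R)) else [:: (1, [::])].

Lemma mprodtP k j : [/\ tens_wf (mprodt k j), tdeg (k * 2) (mprodt k j) &
  forall u, tact act (mprodt k j) u = mprod k j u].
Proof.
elim: k j => [|k IH] j /=.
  split; [by move=> t; rewrite inE => /eqP -> | by move=> t; rewrite inE => /eqP -> |].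
  by move=> u; rewrite /tact big_cons big_nil /= scale1r addr0.
have [w d e] := IH j.+1; split; first by apply: tmul_wf => //; exact: mnrt_wf.
  by rewrite mulSn addnC; apply: tmul_deg => //; exact: mnrt_deg.
by move=> u; rewrite (tact_tmul hv0) // e mnrtE.
Qed.

Lemma symb_mprodt k j Y : sl Y -> symb (mprodt k j) (k * 2) Y =
  ((2 * N)%:R ^+ 2 * (Y z o * Y o m - Y z m * Y o o)) ^+ k.
Proof.
move=> sY; elim: k j => [|k IH] j.
  by rewrite /symb /= big_cons big_nil /= big_nil mulr1 addr0.
rewrite mulSn addnC /= symb_tmul; [|by case: (mprodtP k j.+1)|exact: mnrt_deg].
rewrite IH [RHS]exprSr; congr (_ * _).
rewrite /symb /mnrt !(big_cons, big_nil) /= ?(big_cons, big_nil) !killing_eb //.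
by ring.
Qed.

Lemma minor_relation Y : (forall a : 'I_N, (1 < a)%N -> lnil act a o) ->
  assoc_var act Y -> Y z o * Y o m = Y z m * Y o o.
Proof.
move=> hl [sY hY]; have [k hk] := mprod_kill hl.
have [w d e] := mprodtP k 0.
have /eqP := hY _ _ w d (fun v => etrans (e v) (hk v)).
rewrite symb_mprodt // expf_eq0 => /andP[_]; rewrite mulf_eq0 expf_eq0 /=.
by rewrite (negPf (twoN_neq0 F n)) /= subr_eq0 => /eqP.
Qed.
End MinorAnnihilator.

(** * Annihilators under a nonintegral simple reflection *)

Section Reflection.
Variables (F : numClosedFieldType) (n : nat).
Local Notation N := n.+1.
Local Notation mat := 'M[F]_N.
Variables (i i' : 'I_N) (g : 'I_N -> F).
Hypothesis ii' : i' = i.+1 :> nat.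

Definition ralpha (a : 'I_N) : F := (a == i)%:R - (a == i')%:R.

(* A vector that behaves like [f_i^kappa v0] for an arbitrary scalar [kappa]. *)
Record strvec := StrVec {
  svV :> lmodType F; svact : mat -> svV -> svV; svgm : is_gmod svact;
  svy : svV; svk : F;
  svup : forall a b : 'I_N, (a < b)%N -> (a, b) != (i, i') -> el svact a b svy = 0;
  svdiag : forall a, el svact a a svy = (g a - svk * ralpha a) *: svy }.

Definition ulow (x : 'I_N * 'I_N) : bool := (x.2 < x.1)%N && (x != (i', i)).

Definition nfterm : Type := ({poly F} * (seq ('I_N * 'I_N) * (nat * nat)))%type.

Definition nfvec (s : strvec) (z : seq ('I_N * 'I_N)) (A B : nat) : s :=
  foldr (fun x u => el (@svact s) x.1 x.2 u)
    (iter A (el (@svact s) i' i) (iter B (el (@svact s) i i') (svy s))) z.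

Definition nfeval (s : strvec) (l : seq nfterm) : s :=
  \sum_(t <- l) t.1.[svk s] *: nfvec s t.2.1 t.2.2.1 t.2.2.2.

Definition nfok (l : seq nfterm) : bool := all (fun t : nfterm => all ulow t.2.1) l.

(** One list of terms p(kappa) z f^A e^B y must serve all string vectors at once: this uniformity
    carries an identity at integral kappa in one module over to another kappa in another module. *)
Definition repr (G : forall s : strvec, s) : Prop :=
  exists2 l, nfok l & forall s, G s = nfeval s l.

Lemma repr_eq G H : (forall s, G s = H s) -> repr G -> repr H.
Proof. by move=> e [l ok h]; exists l => // s; rewrite -e. Qed.

Lemma repr0 : repr (fun s => 0).
Proof. by exists [::] => // s; rewrite /nfeval big_nil. Qed.

Lemma reprD G H : repr G -> repr H -> repr (fun s => G s + H s).
Proof.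
case=> l ok h [l' ok' h']; exists (l ++ l'); first by rewrite /nfok all_cat; apply/andP.
by move=> s; rewrite h h' /nfeval big_cat.
Qed.

Lemma reprP (p : {poly F}) G : repr G -> repr (fun s => p.[svk s] *: G s).
Proof.
case=> l ok h; exists [seq (p * t.1, t.2) | t <- l].
  by rewrite /nfok all_map.
move=> s; rewrite h /nfeval big_map scaler_sumr; apply: eq_bigr => t _.
by rewrite hornerM scalerA.
Qed.

Lemma reprZ c G : repr G -> repr (fun s => c *: G s).
Proof. by move/(reprP c%:P); apply: repr_eq => s; rewrite hornerC. Qed.

Lemma repr_sum (I : Type) (r : seq I) (G : I -> forall s : strvec, s) :
  (forall j, repr (G j)) -> repr (fun s => \sum_(j <- r) G j s).
Proof.
move=> h; elim: r => [|j r IH].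
  by apply: repr_eq repr0 => s; rewrite big_nil.
by apply: repr_eq (reprD (h j) IH) => s; rewrite big_cons.
Qed.

Lemma repr_ulow x G : ulow x -> repr G -> repr (fun s => el (@svact s) x.1 x.2 (G s)).
Proof.
move=> hx [l ok h]; exists [seq (t.1, (x :: t.2.1, t.2.2)) | t <- l].
  by rewrite /nfok all_map; apply: sub_all ok => t /= ->; rewrite hx.
move=> s; rewrite h /nfeval big_map el_sum //; last exact: svgm.
by apply: eq_bigr => t _; rewrite elZ //; exact: svgm.
Qed.

Lemma repr_vec z A B : all ulow z -> repr (fun s => nfvec s z A B).
Proof.
move=> hz; exists [:: (1, (z, (A, B)))]; first by rewrite /nfok /= hz.
by move=> s; rewrite /nfeval big_cons big_nil /= hornerC scale1r addr0.
Qed.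

Let ne : i != i'. Proof. by rewrite -val_eqE /= ii' ltn_eqF. Qed.

Lemma repr_base (a b : 'I_N) A B : repr (fun s => el (@svact s) a b (nfvec s [::] A B)).
Proof.
have hy (s : strvec) (c : 'I_N) : el (@svact s) c c (iter B (el (@svact s) i i') (svy s)) =
    (g c - svk s * ralpha c + B%:R * ralpha c) *: iter B (el (@svact s) i i') (svy s).
  exact: (el_eig_iter (svgm s) i i' B (svdiag s c)).
case: (ltngtP a b) => [ab|ba|/val_inj ->].
- have [[-> ->]|nab] := eqVneq (a, b) (i, i'); last first.
    apply: repr_eq repr0 => s; rewrite /nfvec /=.
    rewrite (upper_fiter (svgm s) A ii' _ ab nab) // => a' b' ab' nab'.
    exact: (upper_eiter (svgm s) B ii' (@svup s) ab' nab').
  (* For w = e^B y, of h-weight mu = g_i - g_i' - 2 kappa + 2B, one has e f^A w = f^A e w + A (mu -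
     A + 1) f^(A-1) w. *)
  pose p : {poly F} := (A%:R * (g i - g i' - A%:R + 1 + 2 * B%:R))%:P - (2 * A%:R) *: 'X.
  have := reprD (repr_vec A B.+1 (z := [::]) isT) (reprP p (repr_vec A.-1 B (z := [::]) isT)).
  apply: repr_eq => s; rewrite /nfvec /= /p hornerD hornerN hornerZ hornerX hornerC.
  set y := iter B _ _.
  have nei : i' != i by rewrite eq_sym ne.
  have := sl2_comm (svgm s) A y nei.
  rewrite !(el_eig_iter (svgm s) i' i _ (hy s _)) /ralpha !eqxx (negPf ne) (negPf nei).
  case: A {p} => [|A]; first by move=> _ /=; modring F.
  rewrite [A.+1.-1]/= -natr1 -/y => h; rewrite h; move: (iter A _ _) (el _ i i' _) => w x.
  by move: (g i) (g i') (A%:R : F) (B%:R : F) (svk s) => *; modring F.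
- have [[-> ->]|nab] := eqVneq (a, b) (i', i).
    by apply: repr_eq (repr_vec A.+1 B (z := [::]) isT).
  have hx : ulow (a, b) by rewrite /ulow ba.
  exact: (repr_ulow hx (repr_vec A B (z := [::]) isT)).
pose p : {poly F} := (g b + (B%:R - A%:R) * ralpha b)%:P - ralpha b *: 'X.
apply: repr_eq (reprP p (repr_vec A B (z := [::]) isT)) => s.
rewrite /nfvec /= /p hornerD hornerN hornerZ hornerX hornerC.
rewrite (el_eig_iter (svgm s) i' i A (hy s b)); congr (_ *: _).
by rewrite /ralpha; ring.
Qed.

Lemma repr_letter z a b A B : all ulow z -> repr (fun s => el (@svact s) a b (nfvec s z A B)).
Proof.
elim: z a b => [|x z IH] a b hz; first exact: repr_base.
have /andP[hx hz'] : ulow x && all ulow z by [].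
pose G c d := fun s : strvec => el (@svact s) c d (nfvec s z A B).
have rG c d : repr (G c d) by exact: IH.
have := reprD (reprD (repr_ulow hx (rG a b)) (reprZ (b == x.1)%:R (rG a x.2)))
   (reprZ (-1) (reprZ (x.2 == a)%:R (rG x.1 b))).
apply: repr_eq => s; rewrite /G /= (el_comm (svgm s) a b x.1 x.2) scaleN1r.
by [].
Qed.

Lemma repr_el a b G : repr G -> repr (fun s => el (@svact s) a b (G s)).
Proof.
case=> l ok h.
have : repr (fun s => \sum_(t <- [seq t <- l | all ulow t.2.1]) t.1.[svk s] *: el (@svact s) a b (nfvec s t.2.1 t.2.2.1 t.2.2.2)).
  elim: l {ok h} => [|t l IH] /=; first by apply: repr_eq repr0 => s; rewrite big_nil.
  case: ifP => // ht; apply: repr_eq (reprD (reprP t.1 (repr_letter a b t.2.2.1 t.2.2.2 ht)) IH) => s.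
  by rewrite big_cons.
apply: repr_eq => s; rewrite h /nfeval el_sum; last exact: svgm.
rewrite (all_filterP ok); apply: eq_bigr => t _.
by rewrite elZ //; exact: svgm.
Qed.

Lemma repr_word w : (forall X, X \in w -> sl X) ->
  repr (fun s => foldr (@svact s) (svy s) w).
Proof.
elim: w => [|X w IH] hw; first by apply: repr_eq (repr_vec 0 0 (z := [::]) isT).
have sX : sl X by apply: hw; rewrite inE eqxx.
have IH' := IH (fun Z Zw => hw Z (mem_behead (Zw : Z \in behead (X :: w)))).
apply: (@repr_eq (fun s => \sum_a \sum_b X a b *: el (@svact s) a b (foldr (@svact s) (svy s) w))).
  by move=> s /=; rewrite [RHS]act_el //; exact: svgm.
by do 2!(apply: repr_sum => ?); apply: reprZ; exact: repr_el.
Qed.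

Lemma repr_tens f : tens_wf f -> repr (fun s => tact (@svact s) f (svy s)).
Proof.
move=> wf; elim: f wf => [|t f IH] wf.
  by apply: repr_eq repr0 => s; rewrite /tact big_nil.
have h1 := repr_word (wf t (mem_head _ _)).
have h2 := IH (fun u uf => wf u (mem_behead (uf : u \in behead (t :: f)))).
by apply: repr_eq (reprD (reprZ t.1 h1) h2) => s; rewrite /tact big_cons.
Qed.

Variables (V V' : lmodType F) (act : mat -> V -> V) (act' : mat -> V' -> V').
Variables (v0 : V) (v0' : V').
Let nu := g i - g i'.
(** The dot-reflected weight: kappa = nu + 1 is the zero of the string factor nu - kappa + 1, i.e.
    the exponent at which f^kappa v0 would be singular. *)
Let g' a := g a - (nu + 1) * ralpha a.
Hypotheses (hv : hwmod act v0 g) (hv' : hwmod act' v0' g').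
Hypothesis nuN : forall k : nat, nu != k%:R.
Variables (xi : V -> F) (xi' : V' -> F).
Hypotheses (vac : vacuum act v0 g xi) (vac' : vacuum act' v0' g' xi').
Let gm : is_gmod act. Proof. by case: hv. Qed.
Let gm' : is_gmod act'. Proof. by case: hv'. Qed.

Definition sv1 (k : nat) : strvec.
Proof.
apply: (@StrVec V act gm (iter k (el act i' i) v0) k%:R).
  move=> a b ab nab; apply: (upper_fiter gm k ii' _ ab nab) => a' b' ab' _.
  by case: hv => _ _ hu _ _; exact: hu.
move=> a; have hd : el act a a v0 = g a *: v0 by case: hv.
rewrite (el_eig_iter gm i' i k hd) /ralpha; congr (_ *: _).
by rewrite -opprB mulrN.
Defined.

Definition sv2 : strvec.
Proof.
apply: (@StrVec V' act' gm' v0' (nu + 1)).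
  by move=> a b ab _; case: hv' => _ _ hu _ _; exact: hu.
by move=> a; case: hv'.
Defined.

(** The coefficient in e^A f^k v0 = epol_A(k) f^(k-A) v0, as a polynomial in k. For A > 0 it
    vanishes at k = nu + 1. *)
Definition epol (A : nat) : {poly F} :=
  \prod_(s < A) (('X - s%:R%:P) * ((nu + 1 + s%:R)%:P - 'X)).

Lemma e_iter_fiter A k : (A <= k)%N ->
  iter A (el act i i') (iter k (el act i' i) v0) = (epol A).[k%:R] *: iter (k - A) (el act i' i) v0.
Proof.
elim: A => [|A IH] hA; first by rewrite /epol big_ord0 hornerC scale1r subn0.
rewrite iterS IH 1?ltnW // elZ // (e_fiter hv _ ii') /epol big_ord_recr /= hornerM scalerA.
rewrite -subnS; congr (_ *: _); congr (_ * _).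
by rewrite !(hornerE, hornerM) /= natrB 1?ltnW // -/nu; ring.
Qed.

(** A commutator of E_ii' with a lowering letter other than E_i'i is again of this kind, so such a
    letter ends up on the left, where xi kills it. *)
Lemma xi_ulow k x (u : V) : ulow x -> xi (iter k (el act i i') (el act x.1 x.2 u)) = 0.
Proof.
case: vac => xD xZ _ xl _.
have xB w1 w2 : xi (w1 - w2) = xi w1 - xi w2 by rewrite xD -scaleN1r xZ mulN1r.
elim: k x u => [|k IH] [a b] u /andP[/= ba nab]; first exact: xl.
rewrite -[el act i i' (iter k _ _)]/(iter k.+1 (el act i i') _) iterSr.
rewrite (el_comm gm) iterelD // -scaleNr !iterelD // !iterelZ // !xD !xZ.
rewrite (IH (a, b)); last by rewrite /ulow ba.
have -> : (i' == a)%:R * xi (iter k (el act i i') (el act i b u)) = 0.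
  case: eqVneq => [e|_]; last by rewrite mul0r.
  rewrite (IH (i, b)) ?mulr0 // /ulow /= xpair_eqE (negPf ne) andbT.
  move: ba nab; rewrite -e xpair_eqE eqxx /= ii' ltnS leq_eqVlt => /orP[/eqP/val_inj ->|//].
  by rewrite eqxx.
have -> : (- (b == i)%:R) * xi (iter k (el act i i') (el act a i' u)) = 0.
  case: eqVneq => [e|_]; last by rewrite oppr0 mul0r.
  rewrite (IH (a, i')) ?mulr0 // /ulow /= xpair_eqE [i' == i]eq_sym (negPf ne) andbF andbT.
  move: ba nab; rewrite e xpair_eqE eqxx andbT ii' => ia ai.
  by rewrite ltn_neqAle ia andbT -ii' eq_sym val_eqE.
by rewrite !addr0.
Qed.

Lemma cfac_f k : iter k (el act i i') (iter k (el act i' i) v0) = (epol k).[k%:R] *: v0.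
Proof. by rewrite e_iter_fiter // subnn. Qed.

Lemma epol_neq0 k : (epol k).[k%:R] != 0.
Proof.
rewrite /epol horner_prod; apply/prodf_neq0 => s _; rewrite hornerM mulf_neq0 //.
  by rewrite hornerXsubC subr_eq0 eqr_nat gtn_eqF.
rewrite !hornerE /=; have := nuN (k - s.+1)%N; apply: contra_neq.
rewrite natrB // -natr1 => h; apply/subr0_eq; rewrite -[RHS]h; ring.
Qed.

Lemma xi_nfvec k z A B : all ulow z ->
  xi (iter k (el act i i') (nfvec (sv1 k) z A B)) =
  if nilp z && (A == B) then (epol A).[k%:R] * (epol k).[k%:R] else 0.
Proof.
case: (vac) => xD xZ x0 xl _.
have xi00 : xi 0 = 0 by rewrite -[X in xi X](scale0r 0) xZ mul0r.
case: z => [|x z] hz; last first.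
  by rewrite /nfvec /=; apply: xi_ulow; case/andP: hz.
rewrite /nfvec /= => {hz}.
case: (leqP B k) => Bk; last first.
  have -> : iter B (el act i i') (iter k (el act i' i) v0) = 0.
    rewrite -(subnK Bk) addnS -addSn iterD cfac_f iterelZ // iterSr.
    have -> : el act i i' v0 = 0 by case: hv => _ _ hu _ _; apply: hu; rewrite ii'.
    by rewrite (iter_el0 gm) scaler0.
  rewrite !(iter_el0 gm) xi00; case: eqP => // ->.
  rewrite /epol horner_prod (bigD1 (Ordinal Bk)) //= hornerM hornerXsubC subrr.
  by rewrite !mul0r.
rewrite e_iter_fiter // iterelZ // iterelZ // xZ -iterD.
case: (ltngtP A B) => AB.
- have -> : iter k (el act i i') (iter (A + (k - B)) (el act i' i) v0) = 0.
    have lt : (A + (k - B) < k)%N by lia.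
    rewrite -{1}(subnK lt) addnS -addSn iterD cfac_f iterelZ // iterSr.
    have -> : el act i i' v0 = 0 by case: hv => _ _ hu _ _; apply: hu; rewrite ii'.
    by rewrite (iter_el0 gm) scaler0.
  by rewrite xi00 mulr0.
- have h : (k <= A + (k - B))%N by lia.
  rewrite e_iter_fiter // xZ.
  have -> : (A + (k - B) - k = (A - B).-1.+1)%N by lia.
  by rewrite iterS xl ?mulr0 // ii'.
by rewrite AB subnKC // cfac_f xZ x0 mulr1.
Qed.

Lemma xi'_nfvec z A B : all ulow z ->
  xi' (nfvec sv2 z A B) = ([&& nilp z, A == 0%N & B == 0%N])%:R.
Proof.
case: (vac') => xD xZ x0 xl _.
have xi00 : xi' 0 = 0 by rewrite -[X in xi' X](scale0r 0) xZ mul0r.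
case: z => [|x z] hz; last first.
  by rewrite /nfvec /= xl //; case/andP: hz => /andP[].
rewrite /nfvec /=; case: B => [|B].
  case: A => [|A]; first by rewrite /= x0.
  by rewrite iterS xl // ii'.
rewrite iterSr.
have -> : el act' i i' v0' = 0 by case: hv' => _ _ hu _ _; apply: hu; rewrite ii'.
by rewrite !(iter_el0 gm') xi00 andbF.
Qed.

(** Q collects the terms with empty z and A = B, the ones that xi detects in e^k f f^k v0. It
    vanishes at all naturals because f kills V, hence identically; at nu + 1 only A = B = 0
    survives, and Q(nu + 1) is the value of xi' sought. *)
Lemma reflect_xi f : tens_wf f -> (forall v, tact act f v = 0) -> xi' (tact act' f v0') = 0.
Proof.
move=> wf an; have [l ok h] := repr_tens wf.
pose Q : {poly F} := \sum_(t <- l | nilp t.2.1 && (t.2.2.1 == t.2.2.2)) t.1 * epol t.2.2.1.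
have okt t : t \in l -> all ulow t.2.1 by move/(allP ok).
have Qk k : Q.[k%:R] = 0.
  have := h (sv1 k); rewrite /= an => /(congr1 (fun u => xi (iter k (el act i i') u))).
  case: (vac) => xD xZ _ _ _.
  have xi00 : xi 0 = 0 by rewrite -[X in xi X](scale0r 0) xZ mul0r.
  rewrite (iter_el0 gm) xi00.
  have -> : xi (iter k (el act i i') (nfeval (sv1 k) l)) = Q.[k%:R] * (epol k).[k%:R].
    rewrite /nfeval /Q horner_sum mulr_suml [RHS]big_mkcond /=.
    transitivity (\sum_(t <- l) xi (iter k (el act i i') (t.1.[k%:R] *: nfvec (sv1 k) t.2.1 t.2.2.1 t.2.2.2))).
      elim/big_rec2: _ => [|t u w _ <-]; first by rewrite (iter_el0 gm).
      by rewrite iterelD.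
    rewrite big_seq [RHS]big_seq; apply: eq_bigr => t tl.
    rewrite iterelZ // xZ xi_nfvec; last exact: okt.
    by case: ifP => _; rewrite ?mulr0 // hornerM mulrA.
  by move/esym/eqP; rewrite mulf_eq0 (negPf (epol_neq0 k)) orbF => /eqP.
have Q0 : Q = 0.
  apply/eqP/negPn/negP => Qn.
  have u : uniq [seq k%:R : F | k <- iota 0 (size Q)].
    by rewrite map_inj_uniq ?iota_uniq // => x y /eqP; rewrite eqr_nat => /eqP.
  have r : all (root Q) [seq k%:R : F | k <- iota 0 (size Q)].
    by apply/allP => _ /mapP[k _ ->]; rewrite /root Qk.
  by have := max_poly_roots Qn r u; rewrite size_map size_iota ltnn.
have := h sv2; rewrite /= => ->; case: (vac') => xD xZ _ _ _.
have xi00 : xi' 0 = 0 by rewrite -[X in xi' X](scale0r 0) xZ mul0r.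
transitivity (Q.[nu + 1]); last by rewrite Q0 horner0.
rewrite /nfeval /Q horner_sum [RHS]big_mkcond /=.
transitivity (\sum_(t <- l) xi' (t.1.[nu + 1] *: nfvec sv2 t.2.1 t.2.2.1 t.2.2.2)).
  by elim/big_rec2: _ => // t u w _ <-; rewrite xD.
rewrite big_seq [RHS]big_seq; apply: eq_bigr => t tl.
rewrite xZ xi'_nfvec; last exact: okt.
case: (nilp _) => /=; last by rewrite mulr0.
case: (t.2.2.1) => [|A] /=.
  rewrite eq_sym; case: eqP => _; rewrite ?mulr0 // /epol big_ord0 hornerM hornerC //.
rewrite mulr0; case: ifP => // _; rewrite hornerM /epol big_ord_recl hornerM hornerM /=.
have -> : ((nu + 1 + 0)%:P - 'X).[nu + 1] = 0.
  by rewrite hornerD hornerN hornerX hornerC addr0 subrr.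
by rewrite mulr0 mul0r mulr0.
Qed.
End Reflection.

(** * Subspaces as modules, and linear maps *)

Record subspace (F : fieldType) (W : lmodType F) := Subspace {
  ss :> W -> Prop; ss0 : ss 0; ssD : forall u v, ss u -> ss v -> ss (u + v);
  ssZ : forall c u, ss u -> ss (c *: u) }.

Section SubLmod.
Variables (F : fieldType) (W : lmodType F) (S : subspace W).
Definition sspred : {pred W} := fun w => `[< S w >].

Lemma sspred_closed : submod_closed sspred.
Proof.
split; first exact/asboolP/ss0.
by move=> c u v /asboolP hu /asboolP hv; apply/asboolP/ssD => //; exact: ssZ.
Qed.
HB.instance Definition _ := GRing.isSubmodClosed.Build F W sspred sspred_closed.

Record ssub := SSub { ssval :> W; ssvalP : ssval \in sspred }.
HB.instance Definition _ := [isSub for ssval].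
HB.instance Definition _ := [Choice of ssub by <:].
HB.instance Definition _ := [SubChoice_isSubLmodule of ssub by <:].
End SubLmod.

Section LinOp.
Variables (F : fieldType) (M M' : lmodType F).

Definition lin (f : M -> M') : Prop :=
  (forall u v, f (u + v) = f u + f v) /\ (forall c u, f (c *: u) = c *: f u).

Lemma lin0 f : lin f -> f 0 = 0.
Proof. by case=> _ h; rewrite -[X in f X](scale0r 0) h scale0r. Qed.
Lemma linN f u : lin f -> f (- u) = - f u.
Proof. by case=> _ h; rewrite -scaleN1r h scaleN1r. Qed.
Lemma lin_sum f (I : Type) (r : seq I) (P : pred I) (G : I -> M) : lin f ->
  f (\sum_(i <- r | P i) G i) = \sum_(i <- r | P i) f (G i).
Proof.
move=> lf; elim/big_rec2: _; first exact: lin0.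
by move=> i u v _ <-; case: lf.
Qed.
End LinOp.

(** * A polynomial realisation of gl with arbitrary highest weight *)

Section WeylGl.
Variables (F : fieldType) (n : nat).
Local Notation N := n.+1.
Variables (M : lmodType F) (P Q : 'I_N -> 'I_N -> M -> M).
Hypotheses (linP : forall k i, lin (P k i)) (linQ : forall k i, lin (Q k i)).
(** The model is x_(k,i) and d_(k,j) on matrices, row k being normalised by x_(k,k) = 1. Then
    d_(k,k) becomes a degree minus an Euler operator, which explains the correction terms at j = k
    and b = k below. *)
Hypothesis PP : forall k i l a p, P k i (P l a p) = P l a (P k i p).
Hypothesis QP : forall k j l a p, Q k j (P l a p) =
  P l a (Q k j p) + (k == l)%:R *: ((j == a)%:R *: p - (j == k)%:R *: P l a p).
Hypothesis QQ : forall k j l b p, Q k j (Q l b p) =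
  Q l b (Q k j p) + (k == l)%:R *: ((j == k)%:R *: Q l b p - (b == k)%:R *: Q k j p).

Definition wE (i j : 'I_N) (p : M) : M := \sum_k P k i (Q k j p).

Lemma wE_lin i j : lin (wE i j).
Proof.
split=> [u v|c u]; rewrite /wE.
  rewrite -big_split; apply: eq_bigr => k _.
  by case: (linQ k j) => -> _; case: (linP k i) => -> _.
rewrite scaler_sumr; apply: eq_bigr => k _.
by case: (linQ k j) => _ ->; case: (linP k i) => _ ->.
Qed.

Lemma wE_comm i j a b p :
  wE i j (wE a b p) = wE a b (wE i j p) + (j == a)%:R *: wE i b p - (b == i)%:R *: wE a j p.
Proof.
have ex x y z t : wE x y (wE z t p) = \sum_k \sum_l P k x (Q k y (P l z (Q l t p))).
  rewrite /wE; apply: eq_bigr => k _.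
  by rewrite (lin_sum _ _ _ (linQ k y)) (lin_sum _ _ _ (linP k x)).
rewrite !ex [in RHS]exchange_big /= /wE !scaler_sumr -big_split -sumrB /=.
apply: eq_bigr => k _.
have -> : (j == a)%:R *: P k i (Q k b p) = \sum_l (k == l)%:R *: ((j == a)%:R *: P k i (Q k b p)).
  by rewrite (bigD1 k) //= eqxx scale1r big1 ?addr0 // => l lk; rewrite eq_sym (negPf lk) scale0r.
have -> : (b == i)%:R *: P k a (Q k j p) = \sum_l (k == l)%:R *: ((b == i)%:R *: P k a (Q k j p)).
  by rewrite (bigD1 k) //= eqxx scale1r big1 ?addr0 // => l lk; rewrite eq_sym (negPf lk) scale0r.
rewrite -big_split -sumrB /=; apply: eq_bigr => l _.
have PD c d u v : P c d (u + v) = P c d u + P c d v by case: (linP c d).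
have PZ c d e u : P c d (e *: u) = e *: P c d u by case: (linP c d).
have PN c d u : P c d (- u) = - P c d u by exact: linN.
rewrite !QP QQ !(PD, PN, PZ) [P l a (P k i _)]PP [P l a (P k i _)]PP.
rewrite [l == k]eq_sym; have [<-|_] := eqVneq k l; last by modring F.
by modring F.
Qed.
End WeylGl.

Section Fock.
Variables (F : numClosedFieldType) (n : nat).
Local Notation N := n.+1.
Local Notation K := #|{: 'I_N * 'I_N}|.
Local Notation M := {mpoly F[K]}.
Variable c : 'I_N -> F.

Definition vix (i k : 'I_N) : 'I_K := enum_rank (i, k).

Lemma vix_eq i k j l : (vix i k == vix j l) = (i == j) && (k == l).
Proof. by rewrite (inj_eq enum_rank_inj) xpair_eqE. Qed.

Definition xm (i k : 'I_N) (p : M) : M := 'X_(vix i k) * p.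
Definition dm (i k : 'I_N) (p : M) : M := p^`M(vix i k).

Lemma xm_lin i k : lin (xm i k).
Proof. by split=> *; rewrite /xm ?mulrDr // scalerAr. Qed.
Lemma dm_lin i k : lin (dm i k).
Proof. by split=> *; rewrite /dm ?mderivD // mderivZ. Qed.

Lemma xx i k j l p : xm i k (xm j l p) = xm j l (xm i k p).
Proof. by rewrite /xm mulrCA. Qed.
Lemma ddC i k j l p : dm i k (dm j l p) = dm j l (dm i k p).
Proof. by rewrite /dm mderiv_comm. Qed.
Lemma dX i k j l : ('X_(vix j l) : M)^`M(vix i k) = ((i == j) && (k == l))%:R%:MP.
Proof.
rewrite mderivX mnm1E -vix_eq eq_sym; case: eqVneq => [->|_].
  have -> : (U_(vix j l) - U_(vix j l))%MM = 0%MM by apply/mnmP => x; rewrite !mnmE subnn.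
  by rewrite scale1r mpolyX0.
by rewrite scale0r mpolyC0.
Qed.
Lemma dx i k j l p : dm i k (xm j l p) = xm j l (dm i k p) + ((i == j) && (k == l))%:R *: p.
Proof. by rewrite /dm /xm mderivM dX mul_mpolyC addrC. Qed.

Lemma dx_ne i k j l p : ~~ ((i == j) && (k == l)) -> dm i k (xm j l p) = xm j l (dm i k p).
Proof. by rewrite dx => /negPf ->; rewrite scale0r addr0. Qed.

(** Coordinates above the diagonal are kept; below it the Fourier transform x -> d, d -> -x is
    applied (see [q0]), so that raising letters kill the constant 1. *)
Definition p0 (k i : 'I_N) : M -> M := if (k < i)%N then xm i k else dm i k.
Definition q0 (k j : 'I_N) : M -> M := if (k < j)%N then dm j k else fun p => - xm j k p.

Lemma p0_lin k i : lin (p0 k i).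
Proof. by rewrite /p0; case: ifP => _; [exact: xm_lin|exact: dm_lin]. Qed.
Lemma q0_lin k i : lin (q0 k i).
Proof.
rewrite /q0; case: ifP => _; first exact: dm_lin.
by case: (xm_lin i k) => h1 h2; split=> *; rewrite ?h1 ?h2 ?opprD ?scalerN.
Qed.

Lemma vix_ne (i k j l : 'I_N) : (k < i)%N <> (l < j)%N -> ~~ ((i == j) && (k == l)).
Proof. by move=> h; apply/negP => /andP[/eqP e1 /eqP e2]; case: h; rewrite e1 e2. Qed.

Lemma p0p0 k i l a p : p0 k i (p0 l a p) = p0 l a (p0 k i p).
Proof.
rewrite /p0; case: ifP => ki; case: ifP => la.
- exact: xx.
- by rewrite dx_ne // vix_ne // ki la.
- by rewrite dx_ne // vix_ne // ki la.
exact: ddC.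
Qed.

Lemma q0q0 k i l a p : q0 k i (q0 l a p) = q0 l a (q0 k i p).
Proof.
have xN i' k' u : xm i' k' (- u) = - xm i' k' u by exact: linN (xm_lin _ _).
have dN i' k' u : dm i' k' (- u) = - dm i' k' u by exact: linN (dm_lin _ _).
rewrite /q0; case: ifP => ki; case: ifP => la.
- exact: ddC.
- by rewrite dN dx_ne // vix_ne // ki la.
- by rewrite dN dx_ne // vix_ne // ki la.
by rewrite !xN xx.
Qed.

Lemma q0p0 k j l a p : q0 k j (p0 l a p) = p0 l a (q0 k j p) + ((k == l) && (j == a))%:R *: p.
Proof.
have xN i' k' u : xm i' k' (- u) = - xm i' k' u by exact: linN (xm_lin _ _).
have dN i' k' u : dm i' k' (- u) = - dm i' k' u by exact: linN (dm_lin _ _).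
have ne (x y : bool) : (k < j)%N = x -> (l < a)%N = y -> x <> y -> ((k == l) && (j == a)) = false.
  by move=> <- <- h; rewrite andbC; apply/negbTE/vix_ne.
rewrite /q0 /p0; case: ifP => kj; case: ifP => la.
- by rewrite dx andbC.
- by rewrite (ne _ _ kj la) // scale0r addr0 ddC.
- by rewrite (ne _ _ kj la) // scale0r addr0 xN xx.
by rewrite dN dx [a == j]eq_sym [l == k]eq_sym andbC; modring F.
Qed.

Definition Nop (k : 'I_N) (p : M) : M := \sum_(l | l != k) p0 k l (q0 k l p).

Lemma Nop_lin k : lin (Nop k).
Proof.
split=> [u v|e u]; rewrite /Nop.
  rewrite -big_split; apply: eq_bigr => l _.
  by case: (q0_lin k l) => -> _; case: (p0_lin k l) => -> _.
rewrite scaler_sumr; apply: eq_bigr => l _.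
by case: (q0_lin k l) => _ ->; case: (p0_lin k l) => _ ->.
Qed.

Lemma Np0 k l a p : a != l -> Nop k (p0 l a p) = p0 l a (Nop k p) + (k == l)%:R *: p0 l a p.
Proof.
move=> al; rewrite /Nop (lin_sum _ _ _ (p0_lin l a)).
have -> : (k == l)%:R *: p0 l a p = \sum_(m | m != k) ((k == l) && (m == a))%:R *: p0 k m p.
  have [kl|_] := eqVneq k l; last by rewrite big1 ?scale0r // => m _; rewrite scale0r.
  rewrite (bigD1 a) ?kl //= eqxx big1 ?addr0 // => m /andP[_ /negPf ->].
  by rewrite scale0r.
rewrite -big_split; apply: eq_bigr => m _; rewrite q0p0 p0p0 /=.
by case: (p0_lin k m) => h1 h2; rewrite h1 h2 p0p0.
Qed.

Lemma Nq0 k l b p : b != l -> Nop k (q0 l b p) = q0 l b (Nop k p) - (k == l)%:R *: q0 l b p.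
Proof.
move=> bl; rewrite /Nop (lin_sum _ _ _ (q0_lin l b)).
have -> : (k == l)%:R *: q0 l b p = \sum_(m | m != k) ((k == l) && (m == b))%:R *: q0 k m p.
  have [kl|_] := eqVneq k l; last by rewrite big1 ?scale0r // => m _; rewrite scale0r.
  rewrite (bigD1 b) ?kl //= eqxx big1 ?addr0 // => m /andP[_ /negPf ->].
  by rewrite scale0r.
rewrite -sumrB; apply: eq_bigr => m _; rewrite q0p0 q0q0 [l == k]eq_sym [b == m]eq_sym.
by rewrite addrK.
Qed.

Lemma NN k l p : Nop k (Nop l p) = Nop l (Nop k p).
Proof.
rewrite {2}/Nop (lin_sum _ _ _ (Nop_lin k)) [RHS]/Nop; apply: eq_bigr => m ml.
rewrite Np0 // Nq0 //; case: (p0_lin l m) => h1 h2.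
by rewrite h1 (linN _ (p0_lin l m)) h2 subrK.
Qed.

(** Dehomogenisation of functions of degree c_k in row k: x_(k,k) becomes 1 and d_(k,k) becomes c_k
    minus the transformed Euler operator [Nop k]. As c_k is any scalar, all highest weights are
    reached. *)
Definition fP (k i : 'I_N) : M -> M := if i == k then id else p0 k i.
Definition fQ (k j : 'I_N) : M -> M := if j == k then fun p => c k *: p - Nop k p else q0 k j.

Lemma fP_lin k i : lin (fP k i).
Proof. by rewrite /fP; case: ifP => _; [|exact: p0_lin]. Qed.
Lemma fQ_lin k i : lin (fQ k i).
Proof.
rewrite /fQ; case: ifP => _; last exact: q0_lin.
by case: (Nop_lin k) => h1 h2; split=> *; rewrite ?h1 ?h2; modring F.
Qed.

Lemma fPP k i l a p : fP k i (fP l a p) = fP l a (fP k i p).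
Proof. by rewrite /fP; case: ifP => // _; case: ifP => // _; rewrite p0p0. Qed.

Lemma fQP k j l a p : fQ k j (fP l a p) =
  fP l a (fQ k j p) + (k == l)%:R *: ((j == a)%:R *: p - (j == k)%:R *: fP l a p).
Proof.
rewrite /fQ /fP; case: (eqVneq j k) => [->|jk]; case: (eqVneq a l) => [->|al].
- by case: (eqVneq k l) => _; modring F.
- rewrite Np0 //; case: (p0_lin l a) => h1 h2; rewrite h1 h2 (linN _ (p0_lin l a)).
  have [e|_] := eqVneq k l; last by modring F.
  by move: al; rewrite -e eq_sym => /negPf ->; modring F.
- have [e|_] := eqVneq k l; last by modring F.
  by move: jk; rewrite e => /negPf ->; modring F.
by rewrite q0p0; case: (k == l); case: (j == a); rewrite /=; modring F.
Qed.

Lemma fQQ k j l b p : fQ k j (fQ l b p) =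
  fQ l b (fQ k j p) + (k == l)%:R *: ((j == k)%:R *: fQ l b p - (b == k)%:R *: fQ k j p).
Proof.
have ND x u v : Nop x (u + v) = Nop x u + Nop x v by case: (Nop_lin x).
have NZ x e u : Nop x (e *: u) = e *: Nop x u by case: (Nop_lin x).
have NN' x u : Nop x (- u) = - Nop x u by exact: linN (Nop_lin x).
have qD x y u v : q0 x y (u + v) = q0 x y u + q0 x y v by case: (q0_lin x y).
have qZ x y e u : q0 x y (e *: u) = e *: q0 x y u by case: (q0_lin x y).
have qN x y u : q0 x y (- u) = - q0 x y u by exact: linN (q0_lin x y).
rewrite /fQ; case: (eqVneq j k) => [_|jk]; case: (eqVneq b l) => [->|bl].
- rewrite !(ND, NZ, NN') NN; have [->|_] := eqVneq k l; rewrite ?eqxx; modring F.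
- rewrite Nq0 // !(qD, qZ, qN); have [e|_] := eqVneq k l; last by modring F.
  by rewrite e (negPf bl); modring F.
- rewrite Nq0 // !(qD, qZ, qN) [l == k]eq_sym; have [e|_] := eqVneq k l; last by modring F.
  by modring F.
rewrite q0q0; have [e|_] := eqVneq k l; last by modring F.
by rewrite e (negPf bl); modring F.
Qed.

Definition fE := wE fP fQ.

Lemma fE_lin i j : lin (fE i j).
Proof. exact: wE_lin fP_lin fQ_lin _ _. Qed.

Lemma fE_comm i j a b p :
  fE i j (fE a b p) = fE a b (fE i j p) + (j == a)%:R *: fE i b p - (b == i)%:R *: fE a j p.
Proof. exact: (wE_comm fP_lin fQ_lin fPP fQP fQQ). Qed.

Definition ev0 (p : M) : F := p.@[fun _ => 0].

Lemma ev0D u v : ev0 (u + v) = ev0 u + ev0 v. Proof. exact: mevalD. Qed.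
Lemma ev0Z e u : ev0 (e *: u) = e * ev0 u. Proof. exact: mevalZ. Qed.
Lemma ev0_xm i k p : ev0 (xm i k p) = 0.
Proof. by rewrite /ev0 /xm mevalM mevalXU mul0r. Qed.
Lemma ev0_sum (I : Type) (r : seq I) (P : pred I) (G : I -> M) :
  ev0 (\sum_(i <- r | P i) G i) = \sum_(i <- r | P i) ev0 (G i).
Proof.
elim/big_rec2: _ => [|i u v _ <-]; last exact: ev0D.
exact: meval0.
Qed.

Lemma ev0_pq k l p : ev0 (p0 k l (q0 k l p)) = - ((l <= k)%N)%:R * ev0 p.
Proof.
rewrite /p0 /q0; case: (ltnP k l) => kl /=; first by rewrite ev0_xm oppr0 mul0r.
rewrite (linN _ (dm_lin _ _)) dx !eqxx scale1r -scaleN1r ev0Z ev0D ev0_xm add0r.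
by rewrite mulN1r.
Qed.

Lemma d1 i k : dm i k 1 = 0.
Proof. by rewrite /dm -mpolyC1 mderivC. Qed.

Lemma pq1 k l : p0 k l (q0 k l 1) = - ((l <= k)%N)%:R *: 1.
Proof.
rewrite /p0 /q0; case: (ltnP k l) => kl /=; first by rewrite d1 (lin0 (xm_lin _ _)) oppr0 scale0r.
by rewrite (linN _ (dm_lin _ _)) dx !eqxx d1 (lin0 (xm_lin _ _)) add0r scaleN1r scale1r.
Qed.

(** The two counts are the constants produced by d x = x d + 1 in the Fourier transformed
    variables. *)
Definition fwt (i : 'I_N) : F :=
  c i + \sum_(l | l != i) ((l <= i)%N)%:R - \sum_(k | k != i) ((i <= k)%N)%:R.

Lemma Nop1 k : Nop k 1 = (- \sum_(l | l != k) ((l <= k)%N)%:R) *: 1.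
Proof.
rewrite /Nop -sumrN scaler_suml; apply: eq_bigr => l _; exact: pq1.
Qed.

Lemma fE_diag1 i : fE i i 1 = fwt i *: 1.
Proof.
rewrite /fE /wE (bigD1 i) //= /fP /fQ eqxx Nop1 /fwt !scalerDl scaleNr opprK; congr (_ + _).
rewrite -sumrN scaler_suml; apply: eq_bigr => k ki.
by rewrite eq_sym (negPf ki) pq1.
Qed.

Lemma ev0_fE_diag i p : ev0 (fE i i p) = fwt i * ev0 p.
Proof.
rewrite /fE /wE ev0_sum (bigD1 i) //= /fP /fQ eqxx /fwt !mulrDl; congr (_ + _).
  rewrite ev0D ev0Z -scaleN1r ev0Z /Nop ev0_sum; congr (_ + _).
  rewrite mulr_sumr mulr_suml; apply: eq_bigr => l _; rewrite ev0_pq.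
  by rewrite mulNr mulN1r opprK.
rewrite -sumrN mulr_suml; apply: eq_bigr => k ki.
by rewrite eq_sym (negPf ki) ev0_pq.
Qed.

Lemma fE_up (i j : 'I_N) : (i < j)%N -> fE i j 1 = 0.
Proof.
move=> ij; rewrite /fE /wE big1 // => k _; rewrite /fP /fQ.
have nij : (i == j) = false by rewrite -val_eqE /= ltn_eqF.
case: (eqVneq j k) => [jk|jk].
  rewrite -jk nij Nop1 -scalerBl; case: (p0_lin j i) => _ ->.
  by rewrite /p0 ltnNge (ltnW ij) /= d1 scaler0.
rewrite /q0; case: (ltnP k j) => kj.
  by rewrite d1; case: ifP => // _; exact: lin0 (p0_lin _ _).
have kj' : (j < k)%N by rewrite ltn_neqAle kj andbT.
have nik : (i == k) = false by rewrite -val_eqE /= ltn_eqF // (ltn_trans ij).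
rewrite nik /p0 ltnNge (ltnW (ltn_trans ij kj')) /= (linN _ (dm_lin _ _)).
by rewrite dx nij scale0r addr0 d1 (lin0 (xm_lin _ _)) oppr0.
Qed.
End Fock.

(** * The simple quotient as a space of matrix coefficients *)

Section Existence.
Variables (F : numClosedFieldType) (n : nat).
Local Notation N := n.+1.
Local Notation mat := 'M[F]_N.
Local Notation M := {mpoly F[#|{: 'I_N * 'I_N}|]}.
Variable c : 'I_N -> F.

(** Projecting away the trace makes the action total, so that words may contain arbitrary
    matrices. *)
Definition tl (X : mat) : mat := X - (\tr X / N%:R)%:M.

Lemma tl_sl X : sl X -> tl X = X.
Proof. by move=> h; rewrite /tl (h : \tr X = 0) mul0r (raddf0 (@scalar_mx F N)) subr0. Qed.

Lemma sl_tl X : sl (tl X).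
Proof.
rewrite /sl /tl raddfB /= mxtrace_scalar -[X in _ - X]mulr_natr divfK ?subrr //.
exact: N_neq0.
Qed.

Definition fact (X : mat) (p : M) : M := \sum_a \sum_b tl X a b *: fE c a b p.

Lemma fact_sl X p : sl X -> fact X p = \sum_a \sum_b X a b *: fE c a b p.
Proof. by move=> h; rewrite /fact tl_sl. Qed.

Lemma fact_lin X : lin (fact X).
Proof.
split=> [u v|e u]; rewrite /fact.
  rewrite -big_split; apply: eq_bigr => a _; rewrite -big_split; apply: eq_bigr => b _.
  by case: (fE_lin c a b) => -> _; rewrite scalerDr.
rewrite scaler_sumr; apply: eq_bigr => a _; rewrite scaler_sumr; apply: eq_bigr => b _.
by case: (fE_lin c a b) => _ ->; rewrite !scalerA mulrC.
Qed.

Lemma fact_tl X p : fact (tl X) p = fact X p.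
Proof. by rewrite /fact (tl_sl (sl_tl X)). Qed.

Lemma fact_gmod : is_gmod fact.
Proof.
split.
- move=> X Y v sX sY; rewrite !fact_sl //; last exact: sl_add.
  rewrite -big_split; apply: eq_bigr => a _; rewrite -big_split; apply: eq_bigr => b _.
  by rewrite mxE scalerDl.
- move=> e X v sX; rewrite !fact_sl //; last exact: sl_scale.
  rewrite scaler_sumr; apply: eq_bigr => a _; rewrite scaler_sumr; apply: eq_bigr => b _.
  by rewrite mxE scalerA.
- by move=> X u v _; case: (fact_lin X).
- by move=> X e v _; case: (fact_lin X).
move=> X Y v sX sY; rewrite fact_sl; last exact: sl_lie.
have ex (A B : mat) : sl A -> sl B -> fact A (fact B v) =
    \sum_a \sum_b \sum_d \sum_e (A a b * B d e) *: fE c a b (fE c d e v).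
  move=> sA sB; rewrite fact_sl //; apply: eq_bigr => a _; apply: eq_bigr => b _.
  rewrite fact_sl // (lin_sum _ _ _ (fE_lin c a b)) scaler_sumr; apply: eq_bigr => d _.
  rewrite (lin_sum _ _ _ (fE_lin c a b)) scaler_sumr; apply: eq_bigr => e _.
  by case: (fE_lin c a b) => _ ->; rewrite scalerA.
rewrite (ex X Y) // (ex Y X) //.
have -> : \sum_a \sum_b \sum_d \sum_e (Y a b * X d e) *: fE c a b (fE c d e v) =
   \sum_a \sum_b \sum_d \sum_e (X a b * Y d e) *: fE c d e (fE c a b v).
  have sw (G : 'I_N -> 'I_N -> 'I_N -> 'I_N -> M) :
      \sum_a \sum_b \sum_d \sum_e G a b d e = \sum_d \sum_e \sum_a \sum_b G a b d e.
    transitivity (\sum_a \sum_d \sum_b \sum_e G a b d e).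
      by apply: eq_bigr => a _; exact: exchange_big.
    rewrite exchange_big; apply: eq_bigr => d _ /=.
    transitivity (\sum_a \sum_e \sum_b G a b d e).
      by apply: eq_bigr => a _; exact: exchange_big.
    exact: exchange_big.
  rewrite sw; do 4!(apply: eq_bigr => ? _); by rewrite mulrC.
rewrite -sumrB.
have -> : \sum_a (\sum_b \sum_d \sum_e (X a b * Y d e) *: fE c a b (fE c d e v) -
      \sum_b \sum_d \sum_e (X a b * Y d e) *: fE c d e (fE c a b v)) =
    \sum_a \sum_b \sum_d \sum_e ((X a b * Y d e) *: ((b == d)%:R *: fE c a e v) -
       (X a b * Y d e) *: ((e == a)%:R *: fE c d b v)).
  apply: eq_bigr => a _; rewrite -sumrB; apply: eq_bigr => b _; rewrite -sumrB.
  apply: eq_bigr => d _; rewrite -sumrB; apply: eq_bigr => e _.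
  by rewrite fE_comm; modring F.
have -> : \sum_a \sum_b \sum_d \sum_e ((X a b * Y d e) *: ((b == d)%:R *: fE c a e v) -
       (X a b * Y d e) *: ((e == a)%:R *: fE c d b v)) =
   \sum_a \sum_b \sum_e (X a b * Y b e) *: fE c a e v -
   \sum_a \sum_b \sum_d (X a b * Y d a) *: fE c d b v.
  rewrite -sumrB; apply: eq_bigr => a _; rewrite -sumrB; apply: eq_bigr => b _.
  under eq_bigr => d _ do rewrite sumrB.
  rewrite sumrB; congr (_ - _).
    rewrite (bigD1 b) //= [X in _ + X]big1 ?addr0.
      by apply: eq_bigr => e _; rewrite eqxx scale1r.
    by move=> d db; rewrite big1 // => e _; rewrite eq_sym (negPf db) scale0r scaler0.
  apply: eq_bigr => d _; rewrite (bigD1 a) //= eqxx scale1r big1 ?addr0 //.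
  by move=> e ea; rewrite (negPf ea) scale0r scaler0.
under eq_bigr => a _ do under eq_bigr => b _ do rewrite !mxE scalerBl.
under eq_bigr => a _ do rewrite sumrB.
rewrite sumrB; congr (_ - _).
  apply: eq_bigr => a _; rewrite exchange_big; apply: eq_bigr => e _ /=.
  by rewrite scaler_suml.
rewrite [RHS]exchange_big /= exchange_big /=; apply: eq_bigr => b _.
rewrite [RHS]exchange_big; apply: eq_bigr => d _ /=.
by rewrite scaler_suml; apply: eq_bigr => a _; rewrite mulrC.
Qed.

Lemma fact_eb a b p : fact (eb a b) p = fE c a b p - ((a == b)%:R / N%:R) *: \sum_d fE c d d p.
Proof.
rewrite fact_sl; last exact: sl_eb.
have -> : \sum_a0 \sum_b0 eb a b a0 b0 *: fE c a0 b0 p =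
   \sum_a0 \sum_b0 ((a0 == a) && (b0 == b))%:R *: fE c a0 b0 p -
   \sum_a0 \sum_b0 (((a == b)%:R / N%:R) *+ (a0 == b0)) *: fE c a0 b0 p.
  rewrite -sumrB; apply: eq_bigr => x _; rewrite -sumrB; apply: eq_bigr => y _.
  by rewrite /eb !mxE scalerBl.
congr (_ - _).
  rewrite (bigD1 a) //= [X in _ + X]big1 ?addr0.
    rewrite (bigD1 b) //= !eqxx scale1r big1 ?addr0 // => y yb.
    by rewrite (negPf yb) scale0r.
  by move=> x xa; rewrite big1 // => y _; rewrite (negPf xa) scale0r.
rewrite scaler_sumr; apply: eq_bigr => d _; rewrite (bigD1 d) //= eqxx mulr1n big1 ?addr0 //.
by move=> y yd; rewrite [d == y]eq_sym (negPf yd) mulr0n scale0r.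
Qed.

Definition fg (a : 'I_N) : F := fwt c a - (\sum_d fwt c d) / N%:R.

Lemma fact_up (a b : 'I_N) : (a < b)%N -> fact (eb a b) 1 = 0.
Proof.
move=> ab; rewrite fact_eb fE_up //; have -> : (a == b) = false by rewrite -val_eqE /= ltn_eqF.
by rewrite mul0r scale0r subr0.
Qed.

Lemma fact_diag a : fact (eb a a) 1 = fg a *: 1.
Proof.
rewrite fact_eb fE_diag1 eqxx /fg; under eq_bigr do rewrite fE_diag1.
rewrite -scaler_suml scalerA -scalerBl; congr (_ *: _).
by rewrite mul1r mulrC.
Qed.

Lemma ev0_fact_diag a p : ev0 (fact (eb a a) p) = fg a * ev0 p.
Proof.
rewrite fact_eb ev0D ev0_fE_diag -scaleNr ev0Z ev0_sum eqxx mul1r /fg.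
under eq_bigr do rewrite ev0_fE_diag.
by rewrite -mulr_suml; ring.
Qed.

Local Notation W := (seq mat -> F^o).

(** The kernel on U.1 is the largest submodule on which [ev0] vanishes, so the image of U.1 is the
    simple quotient, found inside a function space. There X acts by appending it to the word
    ([wact0]). *)
Definition mcoef (p : M) : W := fun w => ev0 (foldr fact p w).

Lemma foldr_fact_lin w : lin (fun p => foldr fact p w).
Proof.
elim: w => [|X w [h1 h2]]; first by split.
by case: (fact_lin X) => g1 g2; split=> *; rewrite /= ?h1 ?g1 ?h2 ?g2.
Qed.

Lemma mcoef_lin : lin mcoef.
Proof.
split=> [u v|e u]; apply/funext => w; rewrite /mcoef.
  by case: (foldr_fact_lin w) => -> _; rewrite ev0D.
by case: (foldr_fact_lin w) => _ ->; rewrite ev0Z.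
Qed.

Definition Lset : W -> Prop := fun phi => exists2 f, tens_wf f & phi = mcoef (tact fact f 1).

Lemma Lset0 : Lset 0.
Proof. by exists [::] => //; rewrite /tact big_nil (lin0 mcoef_lin). Qed.
Lemma LsetD u v : Lset u -> Lset v -> Lset (u + v).
Proof.
case=> f wf -> [f' wf' ->]; exists (f ++ f').
  by move=> t; rewrite mem_cat => /orP[/wf|/wf'].
by rewrite /tact big_cat; case: mcoef_lin => ->.
Qed.
Lemma LsetZ e u : Lset u -> Lset (e *: u).
Proof.
case=> f wf ->; exists [seq (e * t.1, t.2) | t <- f].
  by move=> t /mapP[s sf ->] X; exact: wf sf X.
rewrite /tact big_map; case: mcoef_lin => _ <-; rewrite scaler_sumr; congr (mcoef _).
by apply: eq_bigr => t _; rewrite scalerA.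
Qed.
Definition Lspace := Subspace Lset0 LsetD LsetZ.
Definition Lmod : lmodType F := ssub Lspace.

Definition wact0 (X : mat) (phi : W) : W := fun w => phi (rcons w (tl X)).

Lemma wact0_mcoef X p : wact0 X (mcoef p) = mcoef (fact X p).
Proof. by apply/funext => w; rewrite /wact0 /mcoef foldr_rcons fact_tl. Qed.

Lemma Lset_act X phi : Lset phi -> Lset (wact0 X phi).
Proof.
case=> f wf ->; exists [seq (t.1, tl X :: t.2) | t <- f].
  move=> t /mapP[s sf ->] Z /=; rewrite inE => /orP[/eqP ->|]; first exact: sl_tl.
  exact: wf sf Z.
rewrite wact0_mcoef; congr (mcoef _); rewrite /tact big_map.
rewrite (lin_sum _ _ _ (fact_lin X)); apply: eq_bigr => t _.
by case: (fact_lin X) => _ ->; rewrite /= fact_tl.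
Qed.

Lemma LmodP (phi : Lmod) : Lset (ssval phi).
Proof. by case: phi => x /= /asboolP. Qed.

Definition mkL (phi : W) (h : Lset phi) : Lmod := @SSub F W Lspace phi (introT (asboolP _) h).

Definition Lact (X : mat) (phi : Lmod) : Lmod := mkL (Lset_act X (LmodP phi)).

Lemma Lmod_inj (x y : Lmod) : ssval x = ssval y -> x = y.
Proof. exact: val_inj. Qed.

Lemma ssvalD (x y : Lmod) : ssval (x + y) = ssval x + ssval y. Proof. by []. Qed.
Lemma ssvalZ e (x : Lmod) : ssval (e *: x) = e *: ssval x. Proof. by []. Qed.
Lemma ssval0 : ssval (0 : Lmod) = 0. Proof. by []. Qed.
Lemma ssvalN (x : Lmod) : ssval (- x) = - ssval x. Proof. by []. Qed.

Lemma Lact_gmod : is_gmod Lact.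
Proof.
have [g1 g2 g3 g4 g5] := fact_gmod.
split.
- move=> X Y v sX sY; apply: Lmod_inj; rewrite ssvalD /=.
  case: (LmodP v) => f wf ->; rewrite !wact0_mcoef g1 //.
  by case: mcoef_lin => ->.
- move=> e X v sX; apply: Lmod_inj; rewrite ssvalZ /=.
  case: (LmodP v) => f wf ->; rewrite !wact0_mcoef g2 //.
  by case: mcoef_lin => _ ->.
- by move=> X u v sX; apply: Lmod_inj.
- by move=> X e v sX; apply: Lmod_inj.
move=> X Y v sX sY; apply: Lmod_inj; rewrite ssvalD ssvalN /=.
case: (LmodP v) => f wf ->; rewrite !wact0_mcoef g5 //.
by case: mcoef_lin => -> _; rewrite (linN _ mcoef_lin).
Qed.

Lemma Lset_v0 : Lset (mcoef 1).
Proof.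
exists [:: (1, [::])]; first by move=> t; rewrite inE => /eqP ->.
by rewrite /tact big_cons big_nil /= scale1r addr0.
Qed.
Definition Lv0 : Lmod := mkL Lset_v0.

Lemma Lact_foldr w : ssval (foldr Lact Lv0 w) = mcoef (foldr fact 1 w).
Proof. by elim: w => //= X w ->; rewrite wact0_mcoef. Qed.

Lemma ssval_sum (I : Type) (r : seq I) (G : I -> Lmod) :
  ssval (\sum_(i <- r) G i) = \sum_(i <- r) ssval (G i).
Proof. by elim/big_rec2: _ => // i u v _ <-. Qed.

Lemma Lact_tact f : ssval (tact Lact f Lv0) = mcoef (tact fact f 1).
Proof.
rewrite /tact ssval_sum (lin_sum _ _ _ mcoef_lin); apply: eq_bigr => t _.
by rewrite ssvalZ Lact_foldr; case: mcoef_lin => _ ->.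
Qed.

Definition Lev (x : Lmod) : F := ssval x [::].
Lemma LevD (x y : Lmod) : Lev (x + y) = Lev x + Lev y. Proof. by []. Qed.
Lemma LevZ e (x : Lmod) : Lev (e *: x) = e * Lev x. Proof. by []. Qed.
Lemma Lev_sum (I : Type) (r : seq I) (G : I -> Lmod) :
  Lev (\sum_(i <- r) G i) = \sum_(i <- r) Lev (G i).
Proof. by elim/big_rec2: _ => // i u v _ <-. Qed.

Lemma Lact_hwmod : hwmod Lact Lv0 fg.
Proof.
split.
- exact: Lact_gmod.
- apply/eqP => h; have := congr1 (fun x : Lmod => ssval x [::]) h.
  by rewrite ssval0 /= /mcoef /= /ev0 meval1 => /eqP; rewrite oner_eq0.
- move=> a b ab; apply: Lmod_inj; rewrite /= wact0_mcoef fact_up //.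
  exact: lin0 mcoef_lin.
- move=> a; apply: Lmod_inj; rewrite ssvalZ /= wact0_mcoef fact_diag.
  by case: mcoef_lin => _ ->.
move=> v; case: (LmodP v) => f wf e; exists f => //.
by apply: Lmod_inj; rewrite Lact_tact.
Qed.

(** A nonzero coefficient of an element of S yields a vector of S with nonzero [Lev]; [hprod] cuts
    it down to a nonzero multiple of the generator [Lv0]. *)
Lemma Lact_simple : gmod_simple Lact.
Proof.
move=> S S0 SD SZ SX.
have [h|/existsNP[phi /not_implyP[Sphi phi0]]] := pselect (forall v, S v -> v = 0); first by right.
left=> v.
suff Sv0 : S Lv0.
  case: (Lact_hwmod) => _ _ _ _ /(_ v)[f wf ->]; rewrite /tact.
  rewrite big_seq; apply: big_ind => // t tf; apply: SZ.
  have {tf} := wf t tf; elim: (t.2) => //= X w IH hw; apply: SX; first by apply: hw; rewrite inE eqxx.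
  by apply: IH => Z Zw; apply: hw; rewrite inE Zw orbT.
have [w hw0] : exists w, ssval phi w <> 0.
  apply/existsNP => h; apply: phi0; apply: Lmod_inj; exact/funext.
have [psi Spsi psi0] : exists2 psi, S psi & Lev psi <> 0.
  exists (foldr Lact phi (map tl w)).
    elim: w {hw0} => //= X w IH; apply: SX => //; exact: sl_tl.
  move: hw0; case: (LmodP phi) => f wf ephi.
  have e : forall w, ssval (foldr Lact phi (map tl w)) = mcoef (foldr fact (tact fact f 1) w).
    by elim=> //= X w' ->; rewrite wact0_mcoef fact_tl.
  by rewrite /Lev e ephi /mcoef.
have gm := Lact_gmod; have hwm := Lact_hwmod.
have evh a (x : Lmod) : Lev (el Lact a a x) = fg a * Lev x.
  rewrite /Lev /= /wact0 /=; case: (LmodP x) => f wf ->.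
  by rewrite /mcoef /= fact_tl ev0_fact_diag.
have evhop (x : Lmod) : Lev (hop Lact x) = hlam fg * Lev x.
  rewrite /hop -scaleN1r LevZ Lev_sum /hlam mulN1r mulNr mulr_suml; congr (- _).
  by apply: eq_bigr => a _; rewrite LevZ evh mulrA.
have negS x : neg Lact fg x -> Lev x = 0.
  elim=> // [u v' _ h1 _ h2|s u hs]; first by rewrite LevD h1 h2 addr0.
  have := evhop u; rewrite (hs : hop Lact u = _) LevZ => /eqP.
  rewrite -subr_eq0 -mulrBl addrAC subrr sub0r mulf_eq0 oppr_eq0 pnatr_eq0 /=.
  by move/eqP.
have Shop x : S x -> S (hop Lact x).
  move=> Sx; rewrite /hop -scaleN1r; apply: (SZ (-1)); apply: big_ind => // a _.
  by apply: (SZ _ _); apply: (SX _ _) => //; exact: sl_eb.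
have Shprod R x : S x -> S (hprod Lact fg R x).
  move=> Sx; elim: R => //= R IH; apply: SD; first exact: Shop.
  by rewrite -scaleN1r; apply: (SZ _ _); apply: (SZ _ _).
have [e hneg] : exists e, neg Lact fg (psi - e *: Lv0).
  case: (hwm) => _ _ _ _ /(_ psi)[f wf ->].
  by case: (low_tens gm (hwmod_hwvec hwm) wf) => r; apply: (low_neg gm hwm).
have e0 : e != 0.
  apply/eqP => h; rewrite h scale0r subr0 in hneg.
  exact/psi0/negS.
have [R /(_ R (leqnn R)) hR] := neg_hprod gm hneg.
have := Shprod R _ Spsi.
have -> : hprod Lact fg R psi = (e * \prod_(t < R) t.+1%:R) *: Lv0.
  rewrite -[psi](subrK (e *: Lv0)) hprodD // hR add0r hprodZ // (hprod_eig gm R (heig_v0 hwm)) scalerA.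
  by congr (_ * _ *: _); apply: eq_bigr => t _; rewrite subr0.
move/(SZ (e * \prod_(t < R) t.+1%:R)^-1); rewrite scalerA mulVf ?scale1r //.
by rewrite mulf_neq0 //; apply/prodf_neq0 => t _; rewrite pnatr_eq0.
Qed.
End Existence.

(** * sl_3 without integral roots: Shapovalov form and a regular character *)

Section RankTwo.
Variable F : numClosedFieldType.
Local Notation mat := 'M[F]_3.
Variables (V : lmodType F) (act : mat -> V -> V) (v0 : V) (g : 'I_3 -> F) (xi : V -> F).
Hypotheses (hv0 : hwmod act v0 g) (vac : vacuum act v0 g xi).
Let gm : is_gmod act. Proof. by case: hv0. Qed.
Local Notation el := (el act).
Local Notation i0 := (ord0 : 'I_3).
Local Notation i1 := (Ordinal (isT : (1 < 3)%N)).
Local Notation i2 := (ord_max : 'I_3).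
Let nu1 := g i0 - g i1.
Let nu2 := g i1 - g i2.
Hypotheses (nu1N : forall k : nat, nu1 != k%:R) (nu2N : forall k : nat, nu2 != k%:R)
  (nu12N : forall k : nat, nu1 + nu2 + 2 != k%:R).

Let f1 := el i1 i0.
Let f2 := el i2 i1.
Let ft := el i2 i0.
Let e1 := el i0 i1.
Let e2 := el i1 i2.
Let et := el i0 i2.

Lemma comm_ft_f1 u : f1 (ft u) = ft (f1 u).
Proof. by rewrite /f1 /ft el_comm //=; modring F. Qed.
Lemma comm_ft_f2 u : f2 (ft u) = ft (f2 u).
Proof. by rewrite /f2 /ft el_comm //=; modring F. Qed.
Lemma comm_f2_f1 u : f2 (f1 u) = f1 (f2 u) + ft u.
Proof. by rewrite /f2 /f1 /ft el_comm //=; modring F. Qed.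
Lemma comm_e2_f1 u : e2 (f1 u) = f1 (e2 u).
Proof. by rewrite /e2 /f1 el_comm //=; modring F. Qed.
Lemma comm_e2_ft u : e2 (ft u) = ft (e2 u) + f1 u.
Proof. by rewrite /e2 /f1 /ft el_comm //=; modring F. Qed.
Lemma comm_e1_ft u : e1 (ft u) = ft (e1 u) - f2 u.
Proof. by rewrite /e1 /f2 /ft el_comm //=; modring F. Qed.
Lemma comm_e1_f2 u : e1 (f2 u) = f2 (e1 u).
Proof. by rewrite /e1 /f2 el_comm //=; modring F. Qed.
Lemma comm_e2_e1 u : e2 (e1 u) = e1 (e2 u) - et u.
Proof. by rewrite /e1 /e2 /et el_comm //=; modring F. Qed.
Lemma comm_et_e1 u : et (e1 u) = e1 (et u).
Proof. by rewrite /e1 /et el_comm //=; modring F. Qed.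
Lemma comm_et_e2 u : et (e2 u) = e2 (et u).
Proof. by rewrite /e2 /et el_comm //=; modring F. Qed.

Lemma iter_comm (x y : V -> V) k u : (forall u, x (y u) = y (x u)) -> x (iter k y u) = iter k y (x u).
Proof. by move=> h; elim: k => //= k IH; rewrite h IH. Qed.

Definition fv (a b c : nat) : V := iter a f1 (iter b ft (iter c f2 v0)).

Lemma f1_fv a b c : f1 (fv a b c) = fv a.+1 b c. Proof. by []. Qed.
Lemma ft_fv a b c : ft (fv a b c) = fv a b.+1 c.
Proof. by rewrite /fv (iter_comm _ _ (fun u => esym (comm_ft_f1 u))). Qed.
Lemma f2_fv a b c : f2 (fv a b c) = fv a b c.+1 + a%:R *: fv a.-1 b.+1 c.
Proof.
rewrite /fv; set w := iter b ft (iter c f2 v0).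
have -> : iter b ft (iter c.+1 f2 v0) = f2 w.
  by rewrite iterS (iter_comm _ _ comm_ft_f2).
rewrite -[iter b.+1 ft _]/(ft w).
elim: a => [|a IH]; first by rewrite /= scale0r addr0.
rewrite iterS comm_f2_f1 IH /f1 elD // elZ // -/f1 /= -natr1.
case: a {IH} => [|a] /=; first by modring F.
by rewrite -comm_ft_f1 (iter_comm _ _ (fun u => esym (comm_ft_f1 u))); modring F.
Qed.

Let hd a : el a a v0 = g a *: v0. Proof. by case: hv0. Qed.

Lemma e2_fv a b c : e2 (fv a b c) =
  b%:R *: fv a.+1 b.-1 c + (c%:R * (nu2 - c%:R + 1)) *: fv a b c.-1.
Proof.
rewrite /fv (iter_comm _ _ comm_e2_f1).
have -> : e2 (iter b ft (iter c f2 v0)) =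
    iter b ft (e2 (iter c f2 v0)) + b%:R *: f1 (iter b.-1 ft (iter c f2 v0)).
  elim: b => [|b IH]; first by rewrite /= scale0r addr0.
  rewrite iterS comm_e2_ft IH /ft elD // elZ // -/ft /= -natr1.
  case: b {IH} => [|b] /=; first by modring F.
  by rewrite -comm_ft_f1; modring F.
rewrite [e2 (iter c f2 v0)](e_fiter hv0 (i := i1) (i' := i2)) // -/nu2 -/f2.
by rewrite /f1 /ft iterelZ // iterelD // !iterelZ // -/f1 -/ft iterSr addrC.
Qed.

Lemma e1_fv a b c : e1 (fv a b c) =
  (a%:R * (nu1 - b%:R + c%:R - a%:R + 1)) *: fv a.-1 b c - b%:R *: fv a b.-1 c.+1.
Proof.
rewrite /fv; set w := iter b ft (iter c f2 v0).
have ew : e1 w = - b%:R *: iter b.-1 ft (iter c.+1 f2 v0).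
  rewrite /w; elim: b {w} => [|b IH].
    rewrite /= (iter_comm _ _ comm_e1_f2) /e1.
    have -> : el i0 i1 v0 = 0 by case: hv0 => _ _ hu _ _; exact: hu.
    by rewrite (iter_el0 gm) oppr0 scale0r.
  rewrite iterS comm_e1_ft IH /ft elZ // -/ft (iter_comm _ _ comm_ft_f2) /= -natr1.
  case: b {IH} => [|b] /=; modring F.
have h0 : el i0 i0 w = (g i0 - b%:R) *: w.
  rewrite (el_eig_iter gm i2 i0 b (el_eig_iter gm i2 i1 c (hd i0))) /=.
  by congr (_ *: _); ring.
have h1 : el i1 i1 w = (g i1 - c%:R) *: w.
  rewrite (el_eig_iter gm i2 i0 b (el_eig_iter gm i2 i1 c (hd i1))) /=.
  by congr (_ *: _); ring.
have ne : i1 != i0 by [].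
have := sl2_comm gm a w ne; rewrite -/f1 -/e1 ew /f1 iterelZ // -/f1.
rewrite !(el_eig_iter gm i1 i0 _ h0) !(el_eig_iter gm i1 i0 _ h1) /= => h.
apply/subr0_eq; move: h; move: (e1 _) (iter a f1 _) => x y h.
transitivity (- (- b%:R *: y - (x + a%:R *: ((g i1 - c%:R + a.-1%:R * (1 - 0)) *: iter a.-1 f1 w -
   (g i0 - b%:R + a.-1%:R * (0 - 1)) *: iter a.-1 f1 w) - (a%:R * (a%:R - 1)) *: iter a.-1 f1 w))); last first.
  by rewrite [X in - (X - _)]h subrr oppr0.
case: a {h} => [|a] /=; first by modring F.
by rewrite -natr1 /nu1; modring F.
Qed.

Definition fT (a b c : nat) (u : V) : V := iter a e1 (iter b et (iter c e2 u)).

Lemma fTD a b c u v : fT a b c (u + v) = fT a b c u + fT a b c v.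
Proof. by rewrite /fT /e1 /e2 /et !iterelD. Qed.
Lemma fTZ a b c k u : fT a b c (k *: u) = k *: fT a b c u.
Proof. by rewrite /fT /e1 /e2 /et !iterelZ. Qed.

Lemma fT_e2 a b c u : fT a b c (e2 u) = fT a b c.+1 u.
Proof. by rewrite /fT -iterSr. Qed.

Lemma fT_e1 a b c u : fT a b c (e1 u) = fT a.+1 b c u - c%:R *: fT a b.+1 c.-1 u.
Proof.
have h : iter c e2 (e1 u) = e1 (iter c e2 u) - c%:R *: et (iter c.-1 e2 u).
  elim: c => [|c IH]; first by rewrite /= scale0r subr0.
  rewrite iterS IH /e2 elB // elZ // -/e2 comm_e2_e1 /= -natr1.
  case: c {IH} => [|c] /=; first by modring F.
  by rewrite -comm_et_e2; modring F.
rewrite /fT h; have -> : iter b et (e1 (iter c e2 u) - c%:R *: et (iter c.-1 e2 u)) =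
   e1 (iter b et (iter c e2 u)) - c%:R *: iter b.+1 et (iter c.-1 e2 u).
  rewrite -scaleNr /et iterelD // iterelZ // -/et -iterSr scaleNr.
  by rewrite (iter_comm _ _ (fun u => esym (comm_et_e1 u))).
by rewrite -scaleNr /e1 iterelD // iterelZ // -/e1 -iterSr scaleNr.
Qed.

(** A combination of PBW monomials of weight K alpha_1 + L alpha_2 below the top; B is a loose
    summation bound that stays fixed while K and L decrease. *)
Definition lcmb (B K L : nat) (c : nat -> F) : V :=
  \sum_(b < B) c b *: fv (K - b) b (L - b).

Definition cvan (K L : nat) (c : nat -> F) : Prop := forall b, (minn K L < b)%N -> c b = 0.

Lemma lcmb_e2 B K L c : cvan K L.+1 c -> (K < B)%N ->
  e2 (lcmb B K L.+1 c) = lcmb B K L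
    (fun b => b.+1%:R * c b.+1 + ((L.+1 - b)%:R * (nu2 - (L.+1 - b)%:R + 1)) * c b).
Proof.
move=> cv KB; rewrite /lcmb /e2 el_sum // -/e2.
under eq_bigr => b _ do rewrite /e2 elZ // -/e2 e2_fv scalerDr !scalerA.
under [RHS]eq_bigr => b _ do rewrite scalerDl.
rewrite !big_split /=; congr (_ + _); last first.
  apply: eq_bigr => b _; rewrite mulrC; case: (leqP b L) => bL; first by rewrite subSn.
  by rewrite (eqP (_ : L.+1 - b == 0)%N) ?subn_eq0 // !mul0r !scale0r.
case: B KB => // B KB; rewrite big_ord_recl /= mulr0 scale0r add0r [RHS]big_ord_recr /=.
rewrite [c B.+1]cv ?mulr0 ?scale0r ?addr0; last by rewrite gtn_min KB.
apply: eq_bigr => b _; rewrite /bump /= add1n mulrC.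
case: (ltnP b K) => bK; first by rewrite f1_fv subnSK // subSS.
by rewrite [c b.+1]cv ?mulr0 ?scale0r // gtn_min ltnS bK.
Qed.

Lemma lcmb_e1 B K L c : cvan K.+1 L c -> (L < B)%N ->
  e1 (lcmb B K.+1 L c) = lcmb B K L
    (fun b => ((K.+1 - b)%:R * (nu1 - b%:R + (L - b)%:R - (K.+1 - b)%:R + 1)) * c b - b.+1%:R * c b.+1).
Proof.
move=> cv LB; rewrite /lcmb /e1 el_sum // -/e1.
under eq_bigr => b _ do rewrite /e1 elZ // -/e1 e1_fv scalerBr !scalerA.
under [RHS]eq_bigr => b _ do rewrite scalerBl.
rewrite !sumrB /=; congr (_ - _).
  apply: eq_bigr => b _; rewrite mulrC; case: (leqP b K) => bK; first by rewrite subSn.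
  by rewrite (eqP (_ : K.+1 - b == 0)%N) ?subn_eq0 // !mul0r !scale0r.
case: B LB => // B LB; rewrite big_ord_recl /= mulr0 scale0r add0r [RHS]big_ord_recr /=.
rewrite [c B.+1]cv ?mulr0 ?scale0r ?addr0; last by rewrite gtn_min LB orbT.
apply: eq_bigr => b _; rewrite /bump /= add1n mulrC.
case: (ltnP b L) => bL; first by rewrite subnSK // subSS.
by rewrite [c b.+1]cv ?mulr0 ?scale0r // gtn_min !ltnS bL orbT.
Qed.

(** Nondegeneracy on one weight space, by induction on K + L: the images under e1 and e2 inherit the
    vanishing, so their coefficients are zero, and this gives the two recurrences E1 and E2 for
    c. *)
Lemma shapovalov B K L c : (K + L < B)%N -> cvan K L c ->
  (forall b, (b <= minn K L)%N -> xi (fT (K - b) b (L - b) (lcmb B K L c)) = 0) ->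
  forall b, c b = 0.
Proof.
case: (vac) => xD xZ x0 _ _.
have xN u : xi (- u) = - xi u by rewrite -scaleN1r xZ mulN1r.
have [s] := ubnP (K + L)%N; elim: s K L c => // s IH K L c hs hB cv hT.
have E2 : (0 < L)%N -> forall b, b.+1%:R * c b.+1 + ((L - b)%:R * (nu2 - (L - b)%:R + 1)) * c b = 0.
  case: L hs hB cv hT => // L hs hB cv hT _.
  apply: (IH K L); [by lia|by lia| |].
    move=> b hb; have [bL|bL] := leqP b L.
      by rewrite !cv ?mulr0 ?addr0 //; lia.
    by rewrite (eqP (_ : L.+1 - b == 0)%N) ?subn_eq0 // mul0r mul0r cv ?mulr0 ?addr0 //; lia.
  move=> b hb; rewrite -lcmb_e2 //; last by lia.
  by rewrite fT_e2 -subSn; [apply: hT; lia|lia].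
have E1 : (0 < K)%N -> forall b, ((K - b)%:R * (nu1 - b%:R + (L - b)%:R - (K - b)%:R + 1)) * c b - b.+1%:R * c b.+1 = 0.
  case: K hs hB cv hT {E2} => // K hs hB cv hT _.
  apply: (IH K L); [by lia|by lia| |].
    move=> b hb; have [bK|bK] := leqP b K.
      by rewrite !cv ?mulr0 ?subr0 //; lia.
    by rewrite (eqP (_ : K.+1 - b == 0)%N) ?subn_eq0 // mul0r mul0r cv ?mulr0 ?subr0 //; lia.
  move=> b hb; rewrite -lcmb_e1 //; last by lia.
  rewrite fT_e1 xD xN xZ -subSn; last by lia.
  rewrite hT; last by lia.
  have [bL|bL] := ltnP b L; last first.
    by rewrite (eqP (_ : L - b == 0)%N) ?subn_eq0 // mul0r subr0.
  rewrite -subnS (_ : (K - b = K.+1 - b.+1)%N); last by lia.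
  by rewrite hT ?mulr0 ?subr0 //; lia.
have nz1 (k : nat) : nu1 - k%:R != 0 by rewrite subr_eq0.
have nz2 (k : nat) : nu2 - k%:R != 0 by rewrite subr_eq0.
have nzS (k : nat) : k.+1%:R != 0 :> F by rewrite pnatr_eq0.
have step2 b : (b < L)%N -> c b.+1 = 0 -> c b = 0.
  move=> bL c1; have := E2 (leq_ltn_trans (leq0n b) bL) b; rewrite c1 mulr0 add0r => /eqP.
  rewrite -subnSK // -natr1 opprD addrA subrK natr1 !mulf_eq0 (negPf (nzS _)).
  by rewrite (negPf (nz2 _)) => /eqP.
(* For K < L, E2 descends from c_(K+1) = 0. For K > L, E1 at b = L has bracket nu1 - (K - 1) and
   gives c_L = 0 first. For K = L, adding E1 and E2 at b = 0 cancels c_1 and leaves K (nu1 + nu2 + 2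
   - K) c_0. *)
have c0 : c 0%N = 0.
  case: (ltngtP K L) => KL.
  - have cK : c K = 0.
      by apply: step2 => //; apply: cv; rewrite gtn_min ltnSn.
    have down j : (j <= K)%N -> c (K - j)%N = 0.
      elim: j => [|j IHj] hj; first by rewrite subn0.
      by apply: step2; [lia|rewrite subnSK //; apply: IHj; lia].
    by have := down K (leqnn K); rewrite subnn.
  - have cL : c L = 0.
      have K0 : (0 < K)%N by lia.
      have := E1 K0 L; rewrite subnn addr0 [c L.+1]cv; last by rewrite gtn_min ltnSn orbT.
      rewrite mulr0 subr0 => /eqP; rewrite !mulf_eq0.
      have -> : nu1 - L%:R - (K - L)%:R + 1 = nu1 - K.-1%:R.
        by rewrite natrB 1?ltnW // -{1}(prednK K0) -natr1; ring.
      rewrite (negPf (nz1 _)) orbF pnatr_eq0 subn_eq0 leqNgt KL => /eqP.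
      by [].
    have down j : (j <= L)%N -> c (L - j)%N = 0.
      elim: j => [|j IHj] hj; first by rewrite subn0.
      by apply: step2; [lia|rewrite subnSK //; apply: IHj; lia].
    by have := down L (leqnn L); rewrite subnn.
  - rewrite -KL in E2 hT hB cv hs E1 *; case: (posnP K) => [K0|K0].
      have := hT 0%N; rewrite K0 /= => /(_ isT); rewrite /lcmb.
      case: B hB {IH hT} => // B _; rewrite big_ord_recl /= big1 ?addr0.
        by rewrite xZ x0 mulr1.
      by move=> b _; rewrite [c _]cv ?scale0r // K0.
    have := congr2 +%R (E2 K0 0%N) (E1 K0 0%N); rewrite subn0 addr0 => /eqP.
    have -> : 1 * c 1%N + K%:R * (nu2 - K%:R + 1) * c 0%N +
      (K%:R * (nu1 - 0 + K%:R - K%:R + 1) * c 0%N - 1 * c 1%N) =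
      K%:R * (nu1 + nu2 + 2 - K%:R) * c 0%N by ring.
    rewrite !mulf_eq0 pnatr_eq0 eqn0Ngt K0 /= subr_eq0 (negPf (nu12N K)) => /eqP.
    by [].
elim=> [//|b cb].
have [bm|bm] := ltnP (minn K L) b.+1; first exact: cv.
have L0 : (0 < L)%N by lia.
have /eqP := E2 L0 b; rewrite cb mulr0 addr0 mulf_eq0 (negPf (nzS b)) => /eqP.
by [].
Qed.

Lemma xi_fT_mismatch k l m a b c : (k + l != a + b)%N || (l + m != b + c)%N ->
  xi (fT k l m (fv a b c)) = 0.
Proof.
case: (vac) => xD xZ x0 _ xd.
have h0 : el i0 i0 (fT k l m (fv a b c)) = (g i0 - (a + b)%:R + (k + l)%:R) *: fT k l m (fv a b c).
  rewrite (el_eig_iter gm i0 i1 k (el_eig_iter gm i0 i2 l (el_eig_iter gm i1 i2 m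
   (el_eig_iter gm i1 i0 a (el_eig_iter gm i2 i0 b (el_eig_iter gm i2 i1 c (hd i0))))))) /=.
  by congr (_ *: _); rewrite !natrD; ring.
have h2 : el i2 i2 (fT k l m (fv a b c)) = (g i2 + (b + c)%:R - (l + m)%:R) *: fT k l m (fv a b c).
  rewrite (el_eig_iter gm i0 i1 k (el_eig_iter gm i0 i2 l (el_eig_iter gm i1 i2 m
   (el_eig_iter gm i1 i0 a (el_eig_iter gm i2 i0 b (el_eig_iter gm i2 i1 c (hd i2))))))) /=.
  by congr (_ *: _); rewrite !natrD; ring.
move: h0 h2; set u := fT _ _ _ _ => h0 h2.
have := xd i0 u; have := xd i2 u; rewrite h0 h2 !xZ => E2 E0.
case/orP => ne; apply/eqP; move: ne; apply: contraNT => xu.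
  have /eqP := mulIf xu E0; rewrite -subr_eq0.
  have -> : g i0 - (a + b)%:R + (k + l)%:R - g i0 = (k + l)%:R - (a + b)%:R :> F by ring.
  by rewrite subr_eq0 eqr_nat.
have /eqP := mulIf xu E2; rewrite -subr_eq0.
have -> : g i2 + (b + c)%:R - (l + m)%:R - g i2 = (b + c)%:R - (l + m)%:R :> F by ring.
by rewrite subr_eq0 eqr_nat eq_sym.
Qed.

(** By [shapovalov] the Gram matrix of the weight space is invertible; row 0 of its inverse gives
    the functional dual to f1^K f2^L, which vanishes on other weights by [xi_fT_mismatch]. *)
Lemma dual_fv (K L : nat) : exists phi : V -> F,
  [/\ forall u v, phi (u + v) = phi u + phi v, forall e u, phi (e *: u) = e * phi u
    & forall a b c, phi (fv a b c) = [&& a == K, b == 0%N & c == L]%:R].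
Proof.
case: (vac) => xD xZ x0 _ _.
have xS (I : Type) (r : seq I) (P : pred I) (G : I -> V) :
    xi (\sum_(i <- r | P i) G i) = \sum_(i <- r | P i) xi (G i).
  apply: (big_morph xi xD); by rewrite -[X in xi X](scale0r 0) xZ mul0r.
pose m := minn K L.
pose G : 'M[F]_m.+1 := \matrix_(b', b) xi (fT (K - b') b' (L - b') (fv (K - b) b (L - b))).
have Gu : G \in unitmx.
  rewrite -unitmx_tr -row_free_unit; apply: inj_row_free => x xG.
  pose c b := if (b < m.+1)%N then x 0 (inord b) else 0.
  have c0 : forall b, c b = 0.
    apply: (@shapovalov (K + L).+1 K L); first by [].
      by move=> b mb; rewrite /c ltnNge mb.
    move=> b bm; have /rowP /(_ (inord b)) := xG; rewrite !mxE => <-.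
    have -> : lcmb (K + L).+1 K L c = \sum_(j < m.+1) x 0 j *: fv (K - j) j (L - j).
      rewrite /lcmb -!(big_mkord xpredT (fun j => c j *: fv (K - j) j (L - j))).
      rewrite (big_cat_nat (n := m.+1)) //=; last by rewrite /m; lia.
      rewrite [X in _ + X]big_nat_cond [X in _ + X]big1 ?addr0; last first.
        by move=> j /andP[/andP[mj _] _]; rewrite /c ltnNge mj scale0r.
      rewrite big_mkord; apply: eq_bigr => j _.
      by rewrite /c ltn_ord inord_val.
    have fTS (I : finType) (E : I -> V) k l e : fT k l e (\sum_i E i) = \sum_i fT k l e (E i).
      apply: (big_morph (fT k l e) (fTD k l e)).
      by rewrite -[X in fT _ _ _ X](scale0r 0) fTZ scale0r.
    rewrite fTS xS; apply: eq_bigr => j _.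
    by rewrite fTZ xZ !mxE inordK.
  apply/rowP => j; have := c0 j; rewrite /c ltn_ord inord_val mxE => -> //.
pose w : 'rV[F]_m.+1 := delta_mx 0 0 *m invmx G.
exists (fun u => \sum_(b < m.+1) w 0 b * xi (fT (K - b) b (L - b) u)); split.
- move=> u v; rewrite -big_split /=; apply: eq_bigr => b _; by rewrite fTD xD mulrDr.
- move=> e u; rewrite mulr_sumr; apply: eq_bigr => b _; by rewrite fTZ xZ mulrCA.
move=> a b c.
have [/andP[/eqP eK /eqP eL]|ne] := boolP ((a + b == K)%N && (b + c == L)%N); last first.
  rewrite big1 => [|j _]; last first.
    rewrite xi_fT_mismatch ?mulr0 //; have := ltn_ord j; move: ne; rewrite /m; lia.
  by have -> : [&& a == K, b == 0%N & c == L] = false by lia.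
have bm : (b < m.+1)%N by rewrite /m; lia.
have /rowP /(_ (Ordinal bm)) : w *m G = delta_mx 0 0 by rewrite /w -mulmxA mulVmx // mulmx1.
rewrite !mxE eqxx /= -val_eqE /= => e.
have -> : [&& a == K, b == 0%N & c == L] = (b == 0%N) by lia.
rewrite -e; apply: eq_bigr => j _; rewrite !mxE /=; congr (_ * xi (fT _ _ _ (fv _ _ _))); lia.
Qed.

Inductive fvspan : V -> Prop :=
| fvspan0 : fvspan 0
| fvspanD u v : fvspan u -> fvspan v -> fvspan (u + v)
| fvspanZ e u : fvspan u -> fvspan (e *: u)
| fvspan_fv a b c : fvspan (fv a b c).

Lemma lower3 (x y : 'I_3) : (y < x)%N -> [\/ (x, y) = (i1, i0), (x, y) = (i2, i0) | (x, y) = (i2, i1)].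
Proof.
move=> h.
have [e|e] := eqVneq x i2.
  have [e'|e'] := eqVneq y i0; first by rewrite e e'; constructor 2.
  constructor 3; rewrite e; congr (_, _); apply: val_inj.
  by move: h e'; rewrite e -val_eqE /= => h e'; lia.
constructor 1; congr (_, _); apply: val_inj => /=; move: h e (ltn_ord x); rewrite -val_eqE /=; lia.
Qed.

Lemma fvspan_all u : fvspan u.
Proof.
case: (hv0) => _ _ _ _ /(_ u)[f wf ->].
case: (low_tens gm (hwmod_hwvec hv0) wf) => r; elim=> {r}.
- by move=> _; exact: fvspan0.
- by move=> _; exact: (fvspan_fv 0 0 0).
- by move=> *; exact: fvspanD.
- by move=> *; exact: fvspanZ.
move=> r x y {}u yx _; elim=> [|u1 u2 _ h1 _ h2|e u1 _ h1|a b c].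
- by rewrite el0 //; exact: fvspan0.
- by rewrite elD //; exact: fvspanD.
- by rewrite elZ //; exact: fvspanZ.
case: (lower3 yx) => -[-> ->].
- exact: (fvspan_fv a.+1 b c).
- by rewrite -[el _ _ _]/(ft _) ft_fv; exact: fvspan_fv.
- by rewrite -[el _ _ _]/(f2 _) f2_fv; apply: fvspanD; [|apply: fvspanZ]; exact: fvspan_fv.
Qed.

(** The Whittaker functional psi_d is 1 on f1^a f2^c with a + c = d and 0 on all other monomials, in
    particular on those containing [ft]. *)
Lemma regular_assoc : assoc_var act (delta_mx i0 i1 + delta_mx i1 i2).
Proof.
pose phi K L := projT1 (cid (dual_fv K L)).
have phiP K L : [/\ forall u v, phi K L (u + v) = phi K L u + phi K L v,
    forall e u, phi K L (e *: u) = e * phi K L u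
    & forall a b c, phi K L (fv a b c) = [&& a == K, b == 0%N & c == L]%:R]
  := projT2 (cid (dual_fv K L)).
pose psi d u := \sum_(K < d.+1) phi K (d - K)%N u.
have psiD d u v : psi d (u + v) = psi d u + psi d v.
  by rewrite -big_split; apply: eq_bigr => K _; case: (phiP K (d - K)%N) => ->.
have psiZ d e u : psi d (e *: u) = e * psi d u.
  by rewrite mulr_sumr; apply: eq_bigr => K _; case: (phiP K (d - K)%N) => _ ->.
have psi0 d : psi d 0 = 0 by rewrite -[X in psi d X](scale0r 0) psiZ mul0r.
have psif d a b c : psi d (fv a b c) = ((b == 0%N) && (a + c == d)%N)%:R.
  rewrite /psi; have [ad|ad] := ltnP a d.+1.
    rewrite (bigD1 (Ordinal ad)) //= big1 ?addr0 => [|K ne]; last first.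
      case: (phiP K (d - K)%N) => _ _ ->; move: ne; rewrite -val_eqE /= eq_sym => /negPf -> //.
    case: (phiP a (d - a)%N) => _ _ ->; rewrite eqxx /=; congr (_%:R); congr nat_of_bool; lia.
  rewrite big1 => [|K _]; first by have -> : (b == 0%N) && (a + c == d)%N = false by lia.
  case: (phiP K (d - K)%N) => _ _ ->.
  by rewrite gtn_eqF // (leq_trans (ltn_ord K)).
apply: (whit_assoc gm hv0 (psi := psi)); last first.
  move=> a b ba; rewrite !mxE; apply/eqP; rewrite -natrD pnatr_eq0.
  move: ba; rewrite -!val_eqE /=; lia.
split=> //; last by move=> d; rewrite -[v0]/(fv 0 0 0) psif eq_sym.
move=> d a b u ba.
elim: (fvspan_all u) => [|u1 u2 _ h1 _ h2|e u1 _ h1|k l m].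
- by rewrite el0 // psi0; case: d => [|d]; rewrite ?psi0 mulr0.
- by rewrite elD // psiD h1 h2; case: d {h1 h2} => [|d]; rewrite ?psiD; ring.
- by rewrite elZ // psiZ h1; case: d {h1} => [|d]; rewrite ?psiZ; ring.
case: (lower3 ba) => -[-> ->].
- rewrite -[el _ _ _]/(fv k.+1 l m) psif !mxE /= addr0 mul1r.
  by case: d => [|d]; rewrite ?psif ?addSn ?andbF ?eqSS.
- rewrite -[el _ _ _]/(ft _) ft_fv psif !mxE /= addr0 mul0r //.
rewrite -[el _ _ _]/(f2 _) f2_fv psiD psiZ !psif /= mulr0 addr0 !mxE /= add0r mul1r.
by case: d => [|d]; rewrite ?psif ?addnS ?andbF ?eqSS.
Qed.
End RankTwo.

(** * Weights in shifted epsilon-coordinates and realisations of L(lam) *)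

Section Weights.
Variables (F : numClosedFieldType) (n : nat).
Local Notation N := n.+1.
Local Notation mat := 'M[F]_N.

(* The weight whose rho-shift has epsilon-coordinates [e]. *)
Definition lwt (e : 'I_N -> F) : weight F n := fromeps e - rho F n.

Lemma eps_fromeps (e : 'I_N -> F) j : eps (fromeps e) j = e j - e ord_max.
Proof.
rewrite /eps; under eq_bigr => i _.
  rewrite mxE (_ : widen_ord _ i = inord i); last by apply/val_inj; rewrite /= inordK // ltnS ltnW.
  rewrite (_ : lift ord0 i = inord i.+1); last by apply/val_inj; rewrite /= inordK // ltnS.
  over.
rewrite -(big_geq_mkord j n xpredT (fun i => e (inord i) - e (inord i.+1))) /=.
have jn : (j <= n)%N by rewrite -ltnS.
under eq_bigr => i _ do rewrite -opprB.
rewrite sumrN telescope_sumr // opprB inord_val; congr (_ - e _).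
by apply/val_inj; rewrite /= inordK.
Qed.

Lemma eps_step (mu : weight F n) (i : 'I_n) :
  eps mu (widen_ord (leqnSn n) i) - eps mu (lift ord0 i) = mu 0 i.
Proof.
rewrite /eps (bigD1 i) //= (eq_bigl (fun k : 'I_n => (lift ord0 i <= k)%N)) ?addrK // => k.
by rewrite lift0 ltn_neqAle andbC eq_sym val_eqE.
Qed.

Lemma epsD (mu nu : weight F n) j : eps (mu + nu) j = eps mu j + eps nu j.
Proof. by rewrite -big_split; apply: eq_bigr => i _; rewrite mxE. Qed.

Lemma lwtK (lam : weight F n) : lwt (eps (lam + rho F n)) = lam.
Proof. by apply/rowP => i; rewrite !mxE eps_step !mxE addrK. Qed.

Lemma eq_lwt (e e' : 'I_N -> F) : (forall x y, e x - e y = e' x - e' y) -> lwt e = lwt e'.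
Proof. by move=> h; apply/rowP => i; rewrite !mxE h. Qed.

Lemma lwt_inj (e e' : 'I_N -> F) : lwt e = lwt e' -> forall x y, e x - e y = e' x - e' y.
Proof.
move=> /addIr h x y; have hx := congr1 (fun l => eps l x) h; have hy := congr1 (fun l => eps l y) h.
move: hx hy; rewrite /= !eps_fromeps => hx hy.
by rewrite -[e x](subrK (e ord_max)) hx -[e y](subrK (e ord_max)) hy; ring.
Qed.

Lemma dot_lwt w (e : 'I_N -> F) : dot w (lwt e) = lwt (e \o w).
Proof.
rewrite /dot /lwt subrK; congr (_ - _); apply/rowP => i; rewrite !mxE !eps_fromeps /=.
by ring.
Qed.

Lemma wt_evalE (mu : weight F n) (d : 'rV[F]_N) : wt_eval mu d = \sum_j d 0 j * eps mu j.
Proof.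
rewrite /wt_eval /eps; under eq_bigr => i _ do rewrite mulr_sumr big_mkcond.
rewrite exchange_big /=; apply: eq_bigr => j _; rewrite mulr_sumr [RHS]big_mkcond.
by apply: eq_bigr => i _; case: ifP => // _; rewrite mulrC.
Qed.

Lemma eps_rho j : eps (rho F n) j = n%:R - j%:R.
Proof.
rewrite /eps; under eq_bigr => i _ do rewrite mxE.
rewrite -(big_geq_mkord j n xpredT (fun i => 1)) /= sumr_const_nat natrB //.
by rewrite -ltnS.
Qed.

(** The eigenvalue of the traceless letter E_aa on v0: adding a undoes the rho-shift up to a
    constant, and the mean is removed. *)
Definition ge (e : 'I_N -> F) (a : 'I_N) : F := e a + a%:R - (\sum_j (e j + j%:R)) / N%:R.

Lemma ge_sub e a b : ge e a - ge e b = e a - e b + a%:R - b%:R.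
Proof. by rewrite /ge; ring. Qed.

Lemma wt_eval_lwt e (d : 'rV[F]_N) : \sum_j d 0 j = 0 ->
  wt_eval (lwt e) d = \sum_j d 0 j * ge e j.
Proof.
move=> d0; rewrite wt_evalE.
have h c (u : 'I_N -> F) : \sum_j d 0 j * (u j - c) = \sum_j d 0 j * u j.
  by under eq_bigr => j _ do rewrite mulrBr; rewrite sumrB -mulr_suml d0 mul0r subr0.
rewrite /ge h -[RHS](h (e ord_max + n%:R)); apply: eq_bigr => j _; congr (_ * _).
have := epsD (lwt e) (rho F n) j; rewrite subrK eps_fromeps eps_rho => /eqP.
by rewrite -subr_eq => /eqP <-; ring.
Qed.

Lemma diag_act (V : lmodType F) (act : mat -> V -> V) (d : 'rV[F]_N) v :
  is_gmod act -> \sum_j d 0 j = 0 -> act (diag_mx d) v = \sum_j d 0 j *: el act j j v.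
Proof.
move=> gm d0; rewrite act_el //; last by rewrite /sl mxtrace_diag.
apply: eq_bigr => a _; rewrite (bigD1 a) //= mxE eqxx mulr1n big1 ?addr0 // => b ba.
by rewrite mxE eq_sym (negPf ba) mulr0n scale0r.
Qed.

Definition hwsimple (e : 'I_N -> F) (V : lmodType F) (act : mat -> V -> V) (v0 : V) : Prop :=
  hwmod act v0 (ge e) /\ gmod_simple act.

Lemma hw_simple_hwsimple (V : lmodType F) (act : mat -> V -> V) e :
  is_hw_simple act (lwt e) <-> exists v0, hwsimple e act v0.
Proof.
split.
  case=> gm [v0 [nz hd hu hg hs]]; exists v0; split; last exact: hs.
  split=> //.
    move=> a b ab; rewrite /el /eb -val_eqE (ltn_eqF ab) mul0r -scalemx1 scale0r subr0.
    exact: hu.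
  move=> a; pose d : 'rV[F]_N := \row_j ((j == a)%:R - N%:R^-1).
  have d0 : \sum_j d 0 j = 0.
    under eq_bigr => j _ do rewrite mxE.
    rewrite sumrB (bigD1 a) //= eqxx big1 => [|j /negPf -> //].
    by rewrite sumr_const card_ord -[_ *+ N]mulr_natr mulVf ?N_neq0 // addr0 subrr.
  have -> : el act a a v0 = act (diag_mx d) v0.
    rewrite /el; congr (act _ v0); apply/matrixP => x y; rewrite !mxE eqxx mul1r.
    case: (eqVneq x y) => [->|xy]; first by rewrite andbb mulr1n.
    rewrite !mulr0n subr0; case: eqP => //= e1; case: eqP => //= e2; by rewrite e1 e2 eqxx in xy.
  rewrite hd // wt_eval_lwt //; congr (_ *: _).
  under eq_bigr => j _ do rewrite mxE mulrBl.
  rewrite sumrB (bigD1 a) //= eqxx mul1r big1 ?addr0 => [|j /negPf ->]; last by rewrite mul0r.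
  rewrite -mulr_sumr (_ : \sum_j ge e j = 0) ?mulr0 ?subr0 //.
  rewrite sumrB sumr_const card_ord -[_ *+ N]mulr_natr mulfVK ?N_neq0 ?subrr //.
case=> v0 [[gm nz hu hd hg] hs]; split=> //; exists v0; split=> //.
  move=> d d0; rewrite diag_act // wt_eval_lwt // scaler_suml.
  by apply: eq_bigr => j _; rewrite hd scalerA.
move=> a b ab; have := hu _ _ ab; rewrite /el /eb -val_eqE (ltn_eqF ab) mul0r.
by rewrite -scalemx1 scale0r subr0.
Qed.

Lemma hwsimple_exists e : exists (V : lmodType F) (act : mat -> V -> V) v0, hwsimple e act v0.
Proof.
(* The counts compensate those of [fwt], leaving e_i + i. *)
pose c (i : 'I_N) : F := e i + i%:R - \sum_(l | l != i) ((l <= i)%N)%:R + \sum_(k | k != i) ((i <= k)%N)%:R.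
have fc a : fwt c a = e a + a%:R by rewrite /fwt /c; ring.
exists (Lmod c), (@Lact F n c), (Lv0 c); split; last exact: Lact_simple.
have -> : ge e = fg c; last exact: Lact_hwmod.
by apply: funext => a; rewrite /ge /fg fc; congr (_ - _ / _); apply: eq_bigr => j _; rewrite fc.
Qed.

Definition ni (e : 'I_N -> F) (x y : 'I_N) : Prop := forall z : int, e x - e y != z%:~R.

Definition avle (e e' : 'I_N -> F) : Prop :=
  forall (V : lmodType F) (act : mat -> V -> V) v0 (V' : lmodType F) (act' : mat -> V' -> V') v0',
    hwsimple e act v0 -> hwsimple e' act' v0' -> forall Y, assoc_var act' Y -> assoc_var act Y.

(** If f kills V, so does w f f2; then xi'(w f f2 v0') = 0 by [reflect_xi], and simplicity of V'
    gives f V' = 0. Thus Ann V is contained in Ann V', and the varieties are included the other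
    way. *)
Lemma avle_refl_step (i i' : 'I_N) e : i' = i.+1 :> nat -> ni e i i' -> avle e (e \o tperm i i').
Proof.
move=> ii' hni V act v0 V' act' v0' [hv hs] [hv' hs'] Y [sY hY]; split=> // f d wf deg ann.
apply: (hY f d wf deg) => v; case: (hv') => gm' _ _ _ /(_ v)[f2 wf2 ->].
have gm : is_gmod act by case: hv.
case: (vacuum_exists gm hv) => xi vac; case: (vacuum_exists gm' hv') => xi' vac'.
apply: (simple_xi hv' hs' vac') => w hw.
have wf1 : tens_wf [:: (1, w)] by move=> t; rewrite inE => /eqP -> X /hw.
have wf12 := tmul_wf wf1 wf.
have e1 u : foldr act' u w = tact act' [:: (1, w)] u by rewrite /tact big_seq1 scale1r.
rewrite e1 -(tact_tmul hv') // -(tact_tmul hv') //.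
have eg : ge (e \o tperm i i') = fun a => ge e a - (ge e i - ge e i' + 1) * ralpha F i i' a.
  apply: funext => a; rewrite ge_sub ii' -natr1 /ge (_ : \sum_j _ = \sum_j (e j + j%:R)).
    rewrite /ralpha /=; case: tpermP => [->|->|/eqP/negPf-> /eqP/negPf->]; last by ring.
      by rewrite eqxx (_ : i == i' = false) /=; [ring|rewrite -val_eqE /= ii' ltn_eqF].
    by rewrite eqxx (_ : i' == i = false) /=; [ring|rewrite -val_eqE /= ii' gtn_eqF].
  rewrite !big_split /=; congr (_ + _).
  by rewrite [RHS](reindex_inj (@perm_inj _ (tperm i i'))).
rewrite eg in hv' vac'.
apply: (reflect_xi ii' hv hv' _ vac vac') => [k|k|u].
- rewrite ge_sub ii' -natr1; apply/eqP => h; have /eqP := hni (k%:Z + 1); apply.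
  by rewrite rmorphD /= -pmulrn -h; ring.
- exact: tmul_wf.
rewrite !(tact_tmul hv) // ann /tact big_seq1 -[X in foldr act X](scale0r 0).
by rewrite foldr_actZ // scale0r scaler0.
Qed.
End Weights.

(** * Combinatorics of integrality classes along a line *)

Lemma const_run (T : Type) (cl : nat -> T) a b :
  (forall k, (a <= k < b)%N -> cl k = cl k.+1) -> forall x, (a <= x <= b)%N -> cl x = cl a.
Proof.
move=> h; elim=> [|x IH] /andP[ax xb]; first by have -> : a = 0%N by lia.
move: ax; rewrite leq_eqVlt => /orP[/eqP -> //|ax].
by rewrite -h ?IH //; lia.
Qed.

Definition swapn (s x : nat) : nat := if x == s then s.+1 else if x == s.+1 then s else x.

Definition far_pair (T : eqType) (n : nat) (cl : nat -> T) : Prop :=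
  exists i k, [/\ (i.+1 < k)%N, (k < n)%N, cl i != cl i.+1 & cl k != cl k.+1].

(** Let i be the first break. If no break lies beyond i + 1, the classes are A up to i, B at i + 1
    and C from i + 2 on; the remaining cases depend on which of them agree and on the room at either
    end. *)
Lemma class_cases (T : eqType) (cl : nat -> T) n : (1 < n)%N ->
  [\/ forall x y, (x <= n)%N -> (y <= n)%N -> cl x = cl y,
      exists2 m, (m <= n)%N & forall x, (x <= n)%N -> x != m ->
        cl x != cl m /\ forall y, (y <= n)%N -> y != m -> cl x = cl y,
      far_pair n cl
    | (exists s, [/\ (s < n)%N, cl s != cl s.+1 & far_pair n (fun x => cl (swapn s x))]) \/
      [/\ n = 2%N, cl 0%N != cl 1%N, cl 1%N != cl 2%N & cl 0%N != cl 2%N] ].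
Proof.
move=> n2; have [exb|nob] := pselect (exists i, (i < n)%N && (cl i != cl i.+1)); last first.
  constructor 1.
  suff h x : (x <= n)%N -> cl x = cl 0%N by move=> x y /h -> /h ->.
  move=> xn; apply: (const_run (b := n)) => // k kn; apply/eqP/negPn/negP => h.
  by apply: nob; exists k; lia.
case: (ex_minnP exb) => i /andP[ilt ib] imin.
have [[k [ik kn kb]]|nok] := pselect (exists k, [/\ (i.+1 < k)%N, (k < n)%N & cl k != cl k.+1]).
  by constructor 3; exists i, k.
have A x : (x <= i)%N -> cl x = cl i.
  move=> xi; have h0 y : (y <= i)%N -> cl y = cl 0%N.
    move=> yi; apply: (const_run (b := i)) => // k ki; apply/eqP/negPn/negP => h.
    by have := imin k; rewrite h andbT; lia.
  by rewrite h0 // [RHS]h0.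
have C x : (i.+2 <= x <= n)%N -> cl x = cl i.+2.
  move=> xi; apply: (const_run (b := n)) => // k ki; apply/eqP/negPn/negP => h.
  by apply: nok; exists k; split; [lia|lia|].
have sw s x : (x != s) && (x != s.+1) -> swapn s x = x.
  by rewrite /swapn; case: eqP => //; case: eqP.
have sw0 s : swapn s s = s.+1 by rewrite /swapn eqxx.
have sw1 s : swapn s s.+1 = s by rewrite /swapn gtn_eqF // eqxx.
have [/andP[i1 b1]|nb1] := boolP ((i.+1 < n)%N && (cl i.+1 != cl i.+2)).
  have [AC|AC] := eqVneq (cl i) (cl i.+2).
    constructor 2; exists i.+1 => // x xn xi.
    have h y : (y <= n)%N -> y != i.+1 -> cl y = cl i.
      move=> yn yi; case: (leqP y i) => yi'; first exact: A.
      by rewrite C -?AC //; lia.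
    by split=> [|y yn yi]; rewrite (h x) // (h y).
  have [i3|i3] := leqP i.+3 n.
    (* A B C C becomes A C B C, with breaks at i and i + 2. *)
    constructor 4; left; exists i.+1; split=> //; exists i, i.+2; split=> //.
    - by rewrite sw0 sw //; lia.
    - by rewrite sw1 sw ?[cl i.+3]C //; lia.
  case: (posnP i) => [i0|i0].
    by constructor 4; right; subst i; split=> //; lia.
  (* A A B C becomes A B A C, with breaks at i - 1 and i + 1. *)
  constructor 4; left; exists i; split=> //; exists i.-1, i.+1; split; [lia|lia| |].
  - by rewrite prednK // sw0 sw ?(A i.-1) //; lia.
  - by rewrite sw1 sw //; lia.
have B x : (i.+1 <= x <= n)%N -> cl x = cl i.+1.
  move=> xi; have [->//|ne] := eqVneq x i.+1.
  rewrite C; last by lia.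
  by move: nb1; rewrite negb_and negbK; case/orP => [|/eqP -> //]; lia.
case: (posnP i) => [i0|i0].
  constructor 2; exists 0%N => // x xn x0; subst i.
  split=> [|y yn y0]; first by rewrite (B x) 1?eq_sym //; lia.
  by rewrite (B x) ?(B y) //; lia.
have [i1|i1] := eqVneq i.+1 n.
  constructor 2; exists n => // x xn x0; rewrite -i1.
  split=> [|y yn y0]; first by rewrite A //; lia.
  by rewrite !A //; lia.
(* A A B B becomes A B A B. *)
constructor 4; left; exists i; split=> //; exists i.-1, i.+1; split; [lia|lia| |].
- by rewrite prednK // sw0 sw ?(A i.-1) //; lia.
- by rewrite sw1 sw ?[cl i.+2]B //; lia.
Qed.

(** * Minimal coset representatives *)

Section Parabolic.
Variable n : nat.
Local Notation N := n.+1.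
Implicit Types w : {perm 'I_N}.

Lemma inWpar_Sig1 w : inWpar (Sig1 n) w <-> forall a b : 'I_N, (0 < a)%N -> (a < b)%N -> (w a < w b)%N.
Proof.
split=> [h a b a0 ab|h a b ab wba inD].
  rewrite ltnNge leq_eqVlt; apply/negP => /orP[/eqP/val_inj/perm_inj e|wba].
    by rewrite e ltnn in ab.
  apply: (h _ _ ab wba) => i; rewrite (minn_idPl (ltnW ab)) => /andP[ai _].
  by rewrite inE -lt0n (leq_trans a0).
case: (posnP a) => [a0|a0]; last by have := h _ _ a0 ab; rewrite ltnNge ltnW.
have n0 : (0 < n)%N by rewrite -ltnS; apply: leq_ltn_trans (ltn_ord b); rewrite -a0.
have := inD (Ordinal n0); rewrite a0 (minn_idPl (leq0n b)) inE eqxx.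
have -> : maxn 0 b = b by apply/maxn_idPr.
by rewrite /= -{1}a0 ab => /(_ isT).
Qed.

Definition sprodn (j : nat) : {perm 'I_N} := (\prod_(0 <= i < j) tperm (inord i) (inord i.+1))%g.

Lemma sprodE (j : 'I_N) : sprod j = sprodn j.
Proof.
rewrite /sprod /sprodn (big_nat_widen _ _ _ _ _ (leq_ord j)) big_mkord.
apply: eq_bigr => i _; rewrite /srefl; congr tperm; apply/val_inj => /=.
  by rewrite inordK // ltnS ltnW.
by rewrite /bump /= add1n inordK // ltnS.
Qed.

Lemma sprodnS j : sprodn j.+1 = (sprodn j * tperm (inord j) (inord j.+1))%g.
Proof. by rewrite /sprodn big_nat_recr. Qed.

Lemma sprodnE j (x : 'I_N) : (j <= n)%N ->
  sprodn j x = (if x == 0%N :> nat then j else if (x <= j)%N then x.-1 else x) :> nat.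
Proof.
elim: j => [|j IH] jn.
  by rewrite /sprodn big_geq // perm1; case: eqP => // /eqP; rewrite leqn0 => /negPf ->.
have {}IH := IH (ltnW jn).
have v k : (k <= n)%N -> (inord k : 'I_N) = k :> nat by move=> kn; rewrite inordK.
rewrite sprodnS permM; have xN := ltn_ord x.
case: tpermP => [e|e|e1 e2].
- have := congr1 val e; rewrite /= IH !v; [|lia|lia].
  by case: ifP => // ?; case: ifP => ?; [lia|]; case: ifP => ?; lia.
- have := congr1 val e; rewrite /= IH !v; [|lia|lia].
  by case: ifP => ?; [lia|]; case: ifP => ?; [lia|]; case: ifP => ?; lia.
have {}e1 : sprodn j x != j :> nat by apply/eqP => e; apply: e1; apply/val_inj; rewrite /= v //; lia.
have {}e2 : sprodn j x != j.+1 :> nat by apply/eqP => e; apply: e2; apply/val_inj; rewrite /= v //; lia.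
by move: e1 e2; rewrite IH; case: ifP => ?; [lia|]; case: ifP => ?; case: ifP => ?; lia.
Qed.

(** A permutation increasing on 1, ..., n is determined by its value j at 0, since the other values
    follow in order; [gap] bounds w x between x - 1 and x. *)
Lemma inWpar_sprod w : inWpar (Sig1 n) w <-> exists j : 'I_N, w = sprod j.
Proof.
rewrite inWpar_Sig1; split=> [inc|[j ->] a b a0 ab]; last first.
  rewrite sprodE !sprodnE ?leq_ord //.
  rewrite (gtn_eqF a0) (gtn_eqF (ltn_trans a0 ab)); case: ifP => ?; case: ifP => ?; lia.
have gap k (x y : 'I_N) : (0 < x)%N -> y = (x + k)%N :> nat -> (w x + k <= w y)%N.
  elim: k x y => [|k IH] x y x0 e; first by have -> : y = x; [apply: val_inj => /=; rewrite e addn0|rewrite addn0].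
  have h : (x + k < N)%N by have := ltn_ord y; lia.
  have := IH x (Ordinal h) x0 erefl; have := inc (Ordinal h) y; rewrite /=.
  move=> h1 h2; have {}h1 : (w (Ordinal h) < w y)%N by apply: h1; lia.
  by lia.
have up (x : 'I_N) : (0 < x)%N -> (w x <= x)%N.
  move=> x0; have := gap (n - x)%N x ord_max x0; have := ltn_ord x; have := ltn_ord (w ord_max).
  by rewrite /=; lia.
have lo (x : 'I_N) : (0 < x)%N -> (x.-1 <= w x)%N.
  move=> x0; have h : (1 < N)%N by have := ltn_ord x; lia.
  by have := gap x.-1 (Ordinal h) x isT; rewrite /=; lia.
have inj x y : w x = w y :> nat -> x = y by move/val_inj/perm_inj.
exists (w ord0); rewrite sprodE; apply/permP => x; apply/val_inj.
rewrite /= sprodnE ?leq_ord //; case: eqP => [x0|/eqP x0].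
  by congr (val (w _)); apply/val_inj.
rewrite -lt0n in x0; have xN := ltn_ord x; have := up x x0; have := lo x x0; set j := w ord0.
have jN := ltn_ord j; case: (leqP x j) => xj h1 h2; apply/eqP/negPn/negP => ne.
  have := gap (j - x)%N x j x0; have jj : (0 < j)%N by lia.
  have := up j jj => h3 h4; have e : j = ord0 :> 'I_N by apply: inj; rewrite -/j; lia.
  by rewrite e in jj.
have j1 : (j.+1 < N)%N by lia.
have := gap (x - j.+1)%N (Ordinal j1) x isT => h4.
have := lo (Ordinal j1) isT; rewrite /= => h5.
by have := inj (Ordinal j1) ord0 _; rewrite -/j => h6; have := congr1 val (h6 ltac:(move: h4; rewrite /=; lia)).
Qed.

Lemma sprodn0 j : (j <= n)%N -> sprodn j ord0 = inord j.
Proof. by move=> jn; apply/val_inj; rewrite /= sprodnE //= inordK. Qed.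
End Parabolic.

(** * Admissible weights in integral coordinates *)

Section Admissible.
Variables (F : numClosedFieldType) (n p q : nat).
Hypotheses (hn : (2 <= n)%N) (hq : (0 < q)%N) (hcop : coprime p q) (hpn : (n.+1 <= p)%N).
Local Notation N := n.+1.
Implicit Types (c h : 'I_N -> int) (w : {perm 'I_N}).

(** Here c stands for mu + rho and h for eta in epsilon-coordinates: [alcove] is the interior of the
    p-dilated fundamental alcove, and [spread] is C(w, eta). *)
Definition alcove c : Prop := forall a b : 'I_N, (a < b)%N -> 1 <= c a - c b <= p%:Z - 1.

Definition spread w h : Prop := forall a b : 'I_N, (a < b)%N ->
  if ((w^-1)%g a < (w^-1)%g b)%N then 0 <= h a - h b <= q%:Z - 1 else 1 <= h a - h b <= q%:Z.

Definition eW c h (x : 'I_N) : F := (c x)%:~R - (p%:R / q%:R) * (h x)%:~R.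

Lemma qF_neq0 : q%:R != 0 :> F. Proof. by rewrite pnatr_eq0 -lt0n. Qed.

(** Clearing denominators, an integral difference would make q divide p (h x - h y), hence h x - h y
    by coprimality. *)
Lemma eW_ni c h x y : ~~ (q %| h x - h y)%Z -> ni (eW c h) x y.
Proof.
move=> nd z; apply/eqP => e; move/negP: nd; apply.
have /eqP : (p%:Z * (h x - h y))%:~R = (q%:Z * (c x - c y - z))%:~R :> F.
  rewrite !intrM !intrB -e /eW -!pmulrn; have := qF_neq0.
  by move: (p%:R : F) (q%:R : F) => P Q Q0; field.
rewrite eqr_int => /eqP e1.
have : (q %| p%:Z * (h x - h y))%Z by rewrite e1 dvdz_mulr.
by rewrite Gauss_dvdzr // coprimezE coprime_sym.
Qed.

Lemma eW_int c h x y t : h x - h y = q%:Z * t -> eW c h x - eW c h y = (c x - c y - p%:Z * t)%:~R.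
Proof.
move=> e; have : (h x)%:~R = (h y)%:~R + q%:R * t%:~R :> F.
  by rewrite -[h x](subrK (h y)) e addrC intrD intrM -pmulrn.
rewrite /eW !intrB intrM -pmulrn => ->; have := qF_neq0.
by move: (p%:R : F) (q%:R : F) => P Q Q0; field.
Qed.

Lemma sum_range (G : 'I_n -> int) (a b : 'I_N) : (a < b)%N ->
  \sum_(i < n | (a <= i)%N) G i - \sum_(i < n | (b <= i)%N) G i = \sum_(i < n | (a <= i < b)%N) G i.
Proof.
move=> ab; rewrite (bigID (fun i : 'I_n => (i < b)%N)) /=.
rewrite [X in _ + X - _](eq_bigl (fun i : 'I_n => (b <= i)%N)) ?addrK // => i.
by rewrite -leqNgt andbC; case: leqP => //= bi; lia.
Qed.

Lemma sum_m1 (m : 'I_n -> nat) : \sum_(i < n) ((m i)%:Z + 1 : int) = (\sum_i m i)%N%:Z + n%:Z.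
Proof. by rewrite big_split /= -(big_morph Posz PoszD erefl) sumr_const card_ord natz. Qed.

Definition cofm (m : 'I_n -> nat) (x : 'I_N) : int := \sum_(i < n | (x <= i)%N) ((m i)%:Z + 1).

Lemma alcove_cofm (m : 'I_n -> nat) : (\sum_i m i <= p - N)%N -> alcove (cofm m).
Proof.
move=> hm a b ab; rewrite /cofm sum_range //.
have an : (a < n)%N by have := ltn_ord b; lia.
have pos (P : pred 'I_n) : 0 <= \sum_(i < n | P i) ((m i)%:Z + 1 : int) by apply: sumr_ge0 => i _; lia.
apply/andP; split.
  rewrite (bigD1 (Ordinal an)) /=; last by rewrite leqnn.
  have := pos (fun i : 'I_n => (a <= i < b)%N && (i != Ordinal an)).
  by move: (\sum_(i < n | _) _) => S; lia.
have : \sum_(i < n) ((m i)%:Z + 1 : int) <= p%:Z - 1.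
  by rewrite sum_m1; lia.
apply: le_trans; rewrite [leRHS](bigID (fun i : 'I_n => (a <= i < b)%N)) /=.
have := pos (fun i : 'I_n => ~~ (a <= i < b)%N).
by move: (\sum_(i < n | ~~ _) _) (\sum_(i < n | (a <= i < b)%N) _) => S S'; lia.
Qed.

Lemma eps_PrZ (mu : weight F n) m (v : weight F n) (h : 'I_N -> int) k x :
  (forall i, mu 0 i = (m i)%:R) -> eps v x = (h x)%:~R ->
  eps (mu - k *: v + rho F n) x = (cofm m x)%:~R - k * (h x)%:~R.
Proof.
move=> hm <-; rewrite /eps /cofm rmorph_sum mulr_sumr -sumrB; apply: eq_bigr => i _.
by rewrite !mxE hm /= intrD -pmulrn; ring.
Qed.

Lemma admissible_data (lam : weight F n) : admissible p q lam ->
  exists c h w, [/\ alcove c, spread w h & lam = lwt (eW c h \o w)].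
Proof.
case=> mu [w [eta [[m [hm sm]] hC ->]]].
pose h (x : 'I_N) : int := \sum_(i < n | (x <= i)%N) eta 0 i.
exists (cofm m), h, w; split; first exact: alcove_cofm.
  by move=> a b ab; have := hC a b ab; rewrite /pair_int /h sum_range.
rewrite -{1}[_ - _](lwtK) dot_lwt; apply: eq_lwt => x y.
have e z : eps (map_mx (fun z : int => z%:~R) eta : weight F n) z = (h z)%:~R.
  by rewrite /eps /h rmorph_sum; apply: eq_bigr => i _; rewrite mxE.
by rewrite /= !(eps_PrZ _ hm (e _)).
Qed.

Definition dlt0 (a : nat) (x : 'I_N) : int := if x == ord0 then a%:Z else 0.

Lemma eps_omega1 (x : 'I_N) : eps (omega1 F n) x = (dlt0 1 x)%:~R.
Proof.
have n0 : (0 < n)%N by lia.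
rewrite /eps; have [->|x0] := eqVneq x ord0.
  rewrite (bigD1 (Ordinal n0)) //= mxE /= big1 ?addr0 // => i.
  by rewrite mxE -val_eqE /= => /negPf ->.
rewrite big1 /dlt0 ?(negPf x0) // => i xi; rewrite mxE ifN //.
by move: x0 xi; rewrite -val_eqE /=; lia.
Qed.

Lemma Lambda_data (lam : weight F n) : Lambda p q lam ->
  exists c a, [/\ alcove c, (1 <= a <= q.-1)%N & lam = lwt (eW c (dlt0 a))].
Proof.
case=> mu [a [[m [hm sm]] ha ->]]; exists (cofm m), a; split=> //; first exact: alcove_cofm.
rewrite -{1}[_ - _]lwtK; apply: eq_lwt => x y.
rewrite !(eps_PrZ _ hm (eps_omega1 _)) /eW /dlt0.
have e (z : 'I_N) : (if z == ord0 then a%:Z else 0)%:~R = a%:R * (if z == ord0 then 1%:Z else 0)%:~R :> F.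
  by case: ifP => _; rewrite ?mulr0 // mulr1 -pmulrn.
by rewrite !e !mulrA.
Qed.

Lemma data_Lambda c a : alcove c -> (1 <= a <= q.-1)%N -> Lambda p q (lwt (eW c (dlt0 a))).
Proof.
(* The 1 removes rho; the sum of the m_i then telescopes to c_0 - c_n - n, at most p - 1 - n. *)
move=> ac ha; pose m (i : 'I_n) : nat := absz (c (widen_ord (leqnSn n) i) - c (lift ord0 i) - 1)%R.
have mE i : (m i)%:Z = c (widen_ord (leqnSn n) i) - c (lift ord0 i) - 1.
  rewrite /m gez0_abs // subr_ge0.
  by have /andP[] := ac (widen_ord (leqnSn n) i) (lift ord0 i) (ltnSn i).
have sm : \sum_(i < n) ((m i)%:Z + 1) = c ord0 - c ord_max.
  under eq_bigr => i _.
    rewrite mE subrK (_ : widen_ord _ i = inord i); last by apply/val_inj; rewrite /= inordK // ltnS ltnW.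
    rewrite (_ : lift ord0 i = inord i.+1); last by apply/val_inj; rewrite /= inordK // ltnS.
    over.
  rewrite -(big_mkord xpredT (fun i => c (inord i) - c (inord i.+1))).
  under eq_bigr => i _ do rewrite -opprB.
  rewrite sumrN telescope_sumr // opprB; congr (c _ - c _); apply/val_inj; by rewrite /= inordK.
exists (\row_i (m i)%:R), a; split=> //.
  exists m; split=> [i|]; first by rewrite mxE.
  have /andP[_] := ac ord0 ord_max (ltnW hn : (0 < n)%N); rewrite -sm sum_m1.
  by move: (\sum_(i < n) m i)%N => S; lia.
have mF i : (m i)%:R = (c (widen_ord (leqnSn n) i) - c (lift ord0 i) - 1)%:~R :> F.
  by rewrite -mE pmulrn.
apply/rowP => i; rewrite !mxE mF /eW /dlt0 !intrB.
have -> : (lift ord0 i == ord0) = false by [].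
have -> : (widen_ord (leqnSn n) i == ord0) = (val i == 0%N) by [].
by case: ifP => _; rewrite -?pmulrn /=; ring.
Qed.

(** With eta = b omega_1 the pairing is b on the roots eps_0 - eps_y, which meets both clauses of C
    as 1 <= b <= q - 1, and 0 on the other positive roots, whose positivity w preserves. *)
Lemma dot_alcove_admissible w c a : alcove c -> (1 <= a <= q.-1)%N -> inWpar (Sig1 n) w ->
  admissible p q (dot (w^-1)%g (lwt (eW c (dlt0 a)))).
Proof.
move=> ac ha /inWpar_Sig1 hw; case: (data_Lambda ac ha) => mu [b [hmu hb ->]].
exists mu, (w^-1)%g, (\row_i (if val i == 0%N then b%:Z else 0)); split=> //.
  move=> x y xy; rewrite invgK /pair_int.
  have [x0|x0] := posnP x; last first.
    rewrite hw // big1 => [|i /andP[xi _]]; first by lia.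
    by rewrite mxE; case: eqP => // i0; rewrite i0 in xi; lia.
  have n0 : (0 < n)%N by lia.
  rewrite (bigD1 (Ordinal n0)) /=; last by rewrite x0 /= -{1}x0.
  rewrite mxE /= big1 => [|i /andP[_ i0]]; first by case: ifP => _; lia.
  by rewrite mxE ifN.
congr (dot _ (_ - _)); apply/rowP => i; rewrite !mxE; case: ifP => _; last by rewrite !mulr0.
by rewrite mulr1 -pmulrn.
Qed.

(** Congruence modulo q leaves two values for h(w x) - h(w y): 0 if w x < w y, and -q otherwise. In
    the second case p - (c(w y) - c(w x)) is positive by the alcove bound. *)
Lemma eW_dominant c h w : alcove c -> spread w h ->
  (forall x y, (q %| h x - h y)%Z) -> forall x y : 'I_N, (x < y)%N ->
  exists k : nat, eW c h (w x) - eW c h (w y) = k.+1%:R.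
Proof.
move=> ac sp cong x y xy.
have fin (t : int) (k : nat) : h (w x) - h (w y) = q%:Z * t -> c (w x) - c (w y) - p%:Z * t = k.+1%:Z ->
    exists k : nat, eW c h (w x) - eW c h (w y) = k.+1%:R.
  by move=> e1 e2; exists k; rewrite (eW_int _ e1) e2 -pmulrn.
have /dvdzP[t et] := cong (w x) (w y).
have [wxy|wxy] := ltnP (w x) (w y).
  have := sp _ _ wxy; rewrite !permK xy => /andP[h1 h2].
  have t0 : t = 0 by nia.
  have /andP[c1 c2] := ac _ _ wxy.
  by apply: (fin 0 (absz (c (w x) - c (w y) - 1)%R)); [rewrite et t0; ring|lia].
have {}wxy : (w y < w x)%N.
  by rewrite ltn_neqAle wxy andbT; apply/eqP => /val_inj/perm_inj e; rewrite e ltnn in xy.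
have := sp _ _ wxy; rewrite !permK ltnNge (ltnW xy) /= => /andP[h1 h2].
have t0 : t = -1 by nia.
have /andP[c1 c2] := ac _ _ wxy.
by apply: (fin (-1) (absz (c (w x) - c (w y) + p%:Z - 1)%R)); [rewrite et t0; ring|lia].
Qed.

(* Adding (p, q) to the coordinates (c, h) of the positions m, ..., n and moving
   them to the front does not change c - (p/q) h. *)
Lemma rotate_to_alcove c h w (m : 'I_N) : alcove c -> spread w h ->
  (forall x, x != m -> ~~ (q %| h x - h m)%Z) ->
  (forall x y, x != m -> y != m -> (q %| h x - h y)%Z) ->
  exists c' a w', [/\ alcove c', (1 <= a <= q.-1)%N, inWpar (Sig1 n) w' &
    lwt (eW c h \o w) = lwt (eW c' (dlt0 a) \o (w'^-1)%g)].
Proof.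
move=> ac sp hm hx.
have hsp (x y : 'I_N) : (x < y)%N -> 0 <= h x - h y <= q%:Z.
  by move=> xy; have := sp x y xy; case: ifP => _; lia.
(* Position m being off the common class excludes the extreme values 0 and q. *)
have hlt (x : 'I_N) : (x < m)%N -> 1 <= h x - h m <= q%:Z - 1.
  move=> xm; have /hm : x != m by rewrite -val_eqE /= ltn_eqF.
  have := hsp _ _ xm => /andP[h1 h2] nd.
  have : h x - h m != 0 by apply: contraNneq nd => ->; rewrite dvdz0.
  have : h x - h m != q%:Z by apply: contraNneq nd => ->.
  by lia.
have hgt (x : 'I_N) : (m < x)%N -> 1 <= h m - h x <= q%:Z - 1.
  move=> xm; have /hm : x != m by rewrite -val_eqE /= gtn_eqF.
  have := hsp _ _ xm => /andP[h1 h2]; rewrite -opprB rpredN => nd.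
  have : h m - h x != 0 by apply: contraNneq nd => ->; rewrite dvdz0.
  have : h m - h x != q%:Z by apply: contraNneq nd => ->.
  by lia.
have ne (x : 'I_N) : (x < m)%N || (m < x)%N -> x != m by rewrite -val_eqE /=; lia.
have hll (x y : 'I_N) : (x < m)%N -> (y < m)%N -> h x = h y.
  move=> xm ym; have /dvdzP[t et] : (q %| h x - h y)%Z by apply: hx; rewrite ne ?xm ?ym.
  have := hlt _ xm; have := hlt _ ym => /andP[? ?] /andP[? ?]; have t0 : t = 0 by nia.
  by apply/subr0_eq; rewrite et t0 mul0r.
have hgg (x y : 'I_N) : (m < x)%N -> (m < y)%N -> h x = h y.
  move=> xm ym; have /dvdzP[t et] : (q %| h x - h y)%Z by apply: hx; rewrite ne ?xm ?ym ?orbT.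
  have := hgt _ xm; have := hgt _ ym => /andP[? ?] /andP[? ?]; have t0 : t = 0 by nia.
  by apply/subr0_eq; rewrite et t0 mul0r.
have hlg (x y : 'I_N) : (x < m)%N -> (m < y)%N -> h x = h y + q%:Z.
  move=> xm ym; have /dvdzP[t et] : (q %| h x - h y)%Z by apply: hx; rewrite ne ?xm ?ym ?orbT.
  have := hlt _ xm; have := hgt _ ym; have := hsp x y (ltn_trans xm ym).
  move=> /andP[? ?] /andP[? ?] /andP[? ?]; have t1 : t = 1 by nia.
  by move: et; rewrite t1; lia.
have mN := ltn_ord m.
pose r (k : 'I_N) : 'I_N := inord (if (m + k < N)%N then m + k else m + k - N)%N.
have rE k : r k = (if (m + k < N)%N then m + k else m + k - N)%N :> nat.
  by rewrite /r inordK //; have := ltn_ord k; case: ifP => ?; lia.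
have r_inj : injective r.
  move=> k l /(congr1 val); rewrite /= !rE => e; apply/val_inj => /=.
  by have := ltn_ord k; have := ltn_ord l; move: e; case: ifP => ?; case: ifP => ?; lia.
pose w' : {perm 'I_N} := (perm r_inj * w^-1)%g.
have w'E k : w' k = (w^-1)%g (r k) by rewrite permM [perm _ k]permE.
pose c' (k : 'I_N) : int := c (r k) + (if (m + k < N)%N then p%:Z else 0).
pose h' (k : 'I_N) : int := h (r k) + (if (m + k < N)%N then q%:Z else 0).
(* After the rotation h' equals H everywhere except at 0, so subtracting this constant, which does
   not affect the weight, leaves a omega_1. *)
pose H := h' ord_max.
have h'E k : k != ord0 -> h' k = H.
  rewrite -val_eqE /= => k0; rewrite /H /h'; have kN := ltn_ord k.
  have rn := rE ord_max; have rk := rE k; move: rn rk; rewrite /=.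
  case: ifP => b1; case: ifP => b2 rn rk.
  - by rewrite (@hgg (r k) (r ord_max)) ?rn ?rk //; lia.
  - by lia.
  - by have := @hlg (r ord_max) (r k); rewrite rn rk; lia.
  - have : (r k < m)%N by rewrite rk; lia.
    have : (r ord_max < m)%N by rewrite rn; lia.
    by move=> h1 h2; rewrite (hll _ _ h2 h1).
have r0 : r ord0 = m by apply/val_inj; rewrite /= rE addn0 mN.
have h'0 : 1 <= h' ord0 - H <= q%:Z - 1.
  rewrite /H /h' r0 addn0 mN; have := rE ord_max; rewrite /=.
  case: ifP => b1 rn.
    have : (m < r ord_max)%N by rewrite rn; lia.
    by move/hgt; lia.
  have : (r ord_max < m)%N by rewrite rn; lia.
  by move/hlt; lia.
pose a := absz (h' ord0 - H)%R.
have aE : a%:Z = h' ord0 - H by rewrite /a gez0_abs //; lia.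
exists c', a, w'; split.
- move=> x y xy; rewrite /c'; have := rE x; have := rE y; have := ltn_ord y.
  case: ifP => b1; case: ifP => b2 yN ey ex.
  + by have := ac (r x) (r y); rewrite ex ey; lia.
  + by lia.
  + have := ac (r y) (r x); rewrite ex ey; lia.
  + by have := ac (r x) (r y); rewrite ex ey; lia.
- by lia.
- apply/inWpar_Sig1 => x y x0 xy; rewrite !w'E; have := rE x; have := rE y; have := ltn_ord y.
  case: ifP => b1; case: ifP => b2 yN ey ex.
  + have rxy : (r x < r y)%N by lia.
    have := sp _ _ rxy; rewrite (@hgg (r x) (r y)) ?subrr; [|lia|lia].
    by case: ifP.
  + by lia.
  + have ryx : (r y < r x)%N by lia.
    have := sp _ _ ryx; rewrite (@hlg (r y) (r x)); [|lia|lia].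
    case: ifP => [_|/negbT h1 _]; first by lia.
    have h2 : (w^-1)%g (r y) != (w^-1)%g (r x) :> nat.
      by apply/eqP => /val_inj/perm_inj e; rewrite e ltnn in ryx.
    by move: h1 h2; lia.
  + have rxy : (r x < r y)%N by lia.
    have := sp _ _ rxy; rewrite (@hll (r x) (r y)) ?subrr; [|lia|lia].
    by case: ifP.
have eE x : eW c h (w x) = eW c' (dlt0 a) ((w'^-1)%g x) - p%:R / q%:R * H%:~R.
  set k := (w'^-1)%g x; have -> : w x = r k.
    by have := permKV w' x; rewrite -/k w'E => <-; rewrite permKV.
  have -> : eW c h (r k) = eW c' h' k.
    rewrite /eW /c' /h'; case: ifP => _; last by rewrite !addr0.
    rewrite !intrD -!pmulrn; have := qF_neq0.
    by move: (p%:R : F) (q%:R : F) => P Q Q0; field.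
  have hk : h' k = dlt0 a k + H.
    rewrite /dlt0; case: eqVneq => [->|/h'E -> //]; last by rewrite add0r.
    by rewrite aE subrK.
  by rewrite /eW hk intrD; ring.
by apply: eq_lwt => x y; rewrite /= !eE; ring.
Qed.
End Admissible.

(** * The closure of O_min compared with V(J) *)

Section Closure.
Variables (F : numClosedFieldType) (n : nat).
Hypothesis hn : (2 <= n)%N.
Local Notation N := n.+1.
Local Notation mat := 'M[F]_N.

Let n0 : (0 < n)%N. Proof. exact: ltnW. Qed.

Definition entp (i j : 'I_N) : {mpoly F[N * N]} := 'X_(mxvec_index i j).

Lemma entpE i j (Y : mat) : (entp i j).@[coords Y] = Y i j.
Proof. by rewrite /entp mevalXU /coords mxvecE. Qed.

Definition killp (X : mat) : {mpoly F[N * N]} :=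
  \sum_a \sum_b ((2 * N)%:R * X b a) *: entp a b.

Lemma killpE X (Y : mat) : (killp X).@[coords Y] = killing Y X.
Proof.
rewrite /killp rmorph_sum /killing /mxtrace mulr_sumr; apply: eq_bigr => a _.
rewrite rmorph_sum mxE mulr_sumr; apply: eq_bigr => b _.
by rewrite /= mevalZ entpE; ring.
Qed.

Definition symbp (f : tens F n) (d : nat) : {mpoly F[N * N]} :=
  \sum_(t <- f | size t.2 == d) t.1 *: \prod_(X <- t.2) killp X.

Lemma symbpE f d (Y : mat) : (symbp f d).@[coords Y] = symb f d Y.
Proof.
rewrite /symbp rmorph_sum; apply: eq_bigr => t _; rewrite /= mevalZ rmorph_prod.
by congr (_ * _); apply: eq_bigr => X _; exact: killpE.
Qed.

Lemma assoc_var_zclosed (V : lmodType F) (act : mat -> V -> V) (S : mat -> Prop) Y :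
  (forall X, S X -> assoc_var act X) -> zclosure S Y -> assoc_var act Y.
Proof.
move=> hS hY; split.
  have := hY (\sum_a entp a a); rewrite rmorph_sum /= /sl /mxtrace => h.
  rewrite -[RHS]h => [|X /hS[+ _]]; first by apply: eq_bigr => a _; rewrite entpE.
  by rewrite rmorph_sum /= /sl /mxtrace => {2}<-; apply: eq_bigr => a _; rewrite entpE.
move=> f d wf deg ann; rewrite -symbpE; apply: hY => X /hS[_ hX].
by rewrite symbpE; exact: hX.
Qed.

Lemma mmap_horner (v : 'I_(N * N) -> {poly F}) (p : {mpoly F[N * N]}) t :
  (mmap polyC v p).[t] = p.@[fun k => (v k).[t]].
Proof.
rewrite /meval /mmap horner_sum; apply: eq_bigr => m _; rewrite hornerM hornerC; congr (_ * _).
by rewrite /mmap1 horner_prod; apply: eq_bigr => k _; rewrite horner_exp.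
Qed.

(** The line through E_(1,N) lies in O_min away from 0, and a polynomial in one variable with
    infinitely many zeros vanishes at 0 too. *)
Lemma zclosure_Omin0 : zclosure (@Omin F n) 0.
Proof.
move=> p hp; pose E : mat := delta_mx ord0 ord_max.
have OE : Omin E by exists 1%:M; rewrite ?unitmx1 // invmx1 mul1mx mulmx1.
pose r : {poly F} := mmap polyC (fun k => (coords E k)%:P * 'X) p.
have rE t : r.[t] = p.@[coords (t *: E)].
  rewrite /r mmap_horner; congr (_.@[_]); apply: funext => k.
  by rewrite hornerM hornerC hornerX /coords linearZ /= mxE mulrC.
have r0 : r = 0.
  apply/eqP/negPn/negP => rn0.
  have := max_poly_roots (rs := [seq k.+1%:R | k <- iota 0 (size r)]) rn0.
  rewrite size_map size_iota ltnn => h; suff : false by []; apply: h.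
    apply/allP => x /mapP[k _ ->]; rewrite /root rE hp //.
    by case: (Omin_stable F n0) => _; apply=> //; rewrite pnatr_eq0.
  rewrite map_inj_uniq ?iota_uniq // => x y /eqP; rewrite eqr_nat => /eqP[].
  by [].
by have := rE 0; rewrite r0 horner0 scale0r.
Qed.

Lemma zclosure_minor Y i j k l : zclosure (@Omin F n) Y -> Y i j * Y k l = Y i l * Y k j.
Proof.
move=> /(_ (entp i j * entp k l - entp i l * entp k j)).
rewrite rmorphB !rmorphM /= !entpE => h; apply/subr0_eq/h => X /(Omin_rank1 n0)[u [v [_ _ _ ->]]].
by rewrite rmorphB !rmorphM /= !entpE !mxE !big_ord1; ring.
Qed.

Lemma zclosure_two_deltas (i i' k k' : 'I_N) : i != k -> i' != k' ->
  ~ zclosure (@Omin F n) (delta_mx i i' + delta_mx k k').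
Proof.
move=> ik ik' h; have := zclosure_minor i i' k k' h; rewrite !mxE !eqxx /=.
rewrite (negPf ik) (negPf ik') [k == i]eq_sym (negPf ik) [k' == i']eq_sym (negPf ik') /=.
by rewrite !addr0 !add0r !mulr1 mulr0 => /eqP; rewrite oner_eq0.
Qed.

Section Module.
Variables (V : lmodType F) (act : mat -> V -> V) (v0 : V) (e : 'I_N -> F).
Hypothesis hs : hwsimple e act v0.

Let hv0 : hwmod act v0 (ge e). Proof. by case: hs. Qed.
Let gm : is_gmod act. Proof. by case: hv0. Qed.

Lemma assoc_var_stable : tvstable (assoc_var act).
Proof.
split=> [a b Y ba|c Y _]; last exact: assoc_var_scale.
apply: (assoc_var_conj gm); first by rewrite /sl mxtrace_mulC ba mxtrace0.
by rewrite mulmxA -[a *m b *m a]mulmxA ba mulmx0 mul0mx.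
Qed.

Lemma ni_nu (i i' : 'I_N) : i' = i.+1 :> nat -> ni e i i' -> forall k : nat, ge e i - ge e i' != k%:R.
Proof.
move=> ii' h k; rewrite ge_sub ii' -natr1; apply/eqP => hk; have /eqP := h (k%:Z + 1); apply.
by rewrite intrD -pmulrn -hk; ring.
Qed.

Lemma assoc_var_delta (i i' : 'I_N) : i' = i.+1 :> nat -> ni e i i' ->
  assoc_var act (delta_mx i i').
Proof.
move=> ii' hni; case: (vacuum_exists gm hv0) => xi vac; case: (vac) => xD xZ _ _ xd.
have w0 := whit_vacuum vac.
have hi d u : (d == 0%N)%:R * xi (el act i i u - el act i' i' u) =
    (ge e i - ge e i') * ((d == 0%N)%:R * xi u).
  by rewrite xD -scaleN1r xZ !xd; ring.
have := whit_addroot gm hv0 ii' (ni_nu ii' hni) w0 _ _ _ hi; rewrite add0r => h.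
apply: (whit_assoc gm hv0 (h _ _ _)); try by move=> *; rewrite mxE.
move=> a b ba; rewrite mxE; case: eqP => //= ea; case: eqP => //= eb; move: ba.
by rewrite ea eb ii' ltnn.
Qed.

(** [whit_addroot] is applied twice, starting from the vacuum; [addroot_weight] ensures that the
    second coroot still acts by a scalar. *)
Lemma assoc_var_two_deltas (i i' k k' : 'I_N) : i' = i.+1 :> nat -> k' = k.+1 :> nat -> (i' < k)%N ->
  ni e i i' -> ni e k k' -> assoc_var act (delta_mx i i' + delta_mx k k').
Proof.
move=> ii' kk' ik hi hk; case: (vacuum_exists gm hv0) => xi vac; case: (vac) => xD xZ _ _ xd.
have w0 := whit_vacuum vac.
have wt (x y : 'I_N) d u : (d == 0%N)%:R * xi (el act x x u - el act y y u) =
    (ge e x - ge e y) * ((d == 0%N)%:R * xi u).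
  by rewrite xD -scaleN1r xZ !xd; ring.
have := whit_addroot gm hv0 ii' (ni_nu ii' hi) w0 _ _ _ (wt i i'); rewrite add0r => w1.
have {}w1 := w1 (fun _ => mxE _ _ _ _) (fun _ => mxE _ _ _ _) (mxE _ _ _ _).
have ne (x y : 'I_N) : (x < y)%N -> (x == y) = false by move=> xy; rewrite -val_eqE /= ltn_eqF.
have [e1 e2 e3 e4] : [/\ (i == k) = false, (i == k') = false, (i' == k) = false & (i' == k') = false].
  by split; apply: ne; lia.
have wt1 := addroot_weight gm (ge e i - ge e i') (negbT e1) (negbT e2) (negbT e3) (negbT e4) (wt k k').
have h := whit_addroot gm hv0 kk' (ni_nu kk' hk) w1 _ _ _ wt1.
apply: (whit_assoc gm hv0 (h _ _ _)).
- by move=> b; rewrite mxE [k == i']eq_sym e3 andbF.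
- by move=> a; rewrite mxE [k' == i]eq_sym e2.
- by rewrite mxE [k == i]eq_sym e1.
move=> a b ba; rewrite !mxE; apply/eqP; rewrite -natrD pnatr_eq0 addn_eq0 !eqb0 !negb_and.
by rewrite -!val_eqE /=; lia.
Qed.

Lemma zclosure_sub_assoc (i i' : 'I_N) : i != i' -> assoc_var act (delta_mx i i') ->
  forall Y, zclosure (@Omin F n) Y -> assoc_var act Y.
Proof.
move=> ii' hi Y; apply: assoc_var_zclosed => X /(Omin_rank1 n0)[u [v [u0 w0 vu ->]]].
apply/(rank1_tveq n0 u0 w0 vu assoc_var_stable).
have eE : delta_mx i i' = (delta_mx i 0 : 'cV[F]_N) *m (delta_mx 0 i' : 'rV[F]_N).
  by rewrite mul_delta_mx.
have nzd m1 m2 (x : 'I_m1) (y : 'I_m2) : (delta_mx x y : 'M[F]_(m1, m2)) != 0.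
  by apply/eqP => /matrixP/(_ x y); rewrite !mxE !eqxx => /eqP; rewrite oner_eq0.
have h0 : (delta_mx 0 i' : 'rV[F]_N) *m (delta_mx i 0 : 'cV[F]_N) = 0.
  by rewrite mul_delta_mx_0 // eq_sym.
by apply: (proj1 (rank1_tveq n0 (nzd _ _ _ _) (nzd _ _ _ _) h0 assoc_var_stable)); rewrite -eE.
Qed.

Lemma assoc_var_minimal : (forall i i' : 'I_N, (0 < i)%N -> i' = i.+1 :> nat ->
    exists k : nat, e i - e i' = k.+1%:R) ->
  forall Y, assoc_var act Y -> Y = 0 \/ Omin Y.
Proof.
move=> dom Y hY; have h1 : (1 < N)%N by lia.
pose o : 'I_N := Ordinal h1; case: (vacuum_exists gm hv0) => xi vac.
have lo (a : 'I_N) : (1 < a)%N -> lnil act a o.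
  move=> a1; apply: (lnil_range hv0 _ vac) => //; first by case: hs.
  move=> i i' oi _ ii'; case: (dom i i' oi ii') => k hk; exists k.
  by rewrite ge_sub hk ii' -!natr1; ring.
apply: (minors_rank1 assoc_var_stable) hY => //; last by move=> X [].
have r3 : rel3 (assoc_var act) ord0 o ord_max.
  by move=> X hX; exact: (minor_relation hv0 (o := o) erefl hn lo hX).
by apply: (rel3_all assoc_var_stable) r3; rewrite -val_eqE /=; lia.
Qed.

Lemma dominant_not_Omin : (forall i i' : 'I_N, i' = i.+1 :> nat ->
    exists k : nat, e i - e i' = k.+1%:R) -> ~ assoc_var act (delta_mx ord0 ord_max).
Proof.
move=> dom h; case: (vacuum_exists gm hv0) => xi vac.
have lo : lnil act ord_max ord0.
  apply: (lnil_range hv0 _ vac) => //; first by case: hs.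
  move=> i i' _ _ ii'; case: (dom i i' ii') => k hk; exists k.
  by rewrite ge_sub hk ii' -!natr1; ring.
case: (lo v0) => d /(nil_corner hv0)/(_ h).
by rewrite mxE !eqxx => /eqP; rewrite oner_eq0.
Qed.
End Module.

(** * Weights with one nonintegral coordinate *)

Section Union.
Variable e : 'I_N -> F.
Hypothesis dom : forall i i' : 'I_N, (0 < i)%N -> i' = i.+1 :> nat ->
  exists k : nat, e i - e i' = k.+1%:R.
Hypothesis odd : forall i : 'I_N, i != ord0 -> ni e ord0 i.

Lemma ni_sym (f : 'I_N -> F) x y : ni f x y -> ni f y x.
Proof. by move=> h z; rewrite -opprB eqr_oppLR -intrN. Qed.

Lemma sprodnV_odd j (x : 'I_N) : (j <= n)%N -> x != j :> nat -> ni (e \o (sprodn n j)^-1%g) (inord j) x.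
Proof.
move=> jn xj z; rewrite /= -sprodn0 // permK; apply: odd; apply/eqP => h; move/eqP: xj; apply.
by have := permKV (sprodn n j) x; rewrite h sprodn0 // => <-; rewrite inordK.
Qed.

(** The exceptional coordinate e_0 moves from position j to j + 1, so the reflecting simple root is
    nonintegral. *)
Lemma avle_sprodn j : (j < n)%N -> avle (e \o (sprodn n j)^-1%g) (e \o (sprodn n j.+1)^-1%g).
Proof.
move=> jn; have -> : e \o (sprodn n j.+1)^-1%g =
    (e \o (sprodn n j)^-1%g) \o tperm (inord j) (inord j.+1).
  by apply: funext => x; rewrite /= sprodnS invMg tpermV permM.
apply: avle_refl_step; first by rewrite !inordK // ltnS ltnW.
by apply: sprodnV_odd; [exact: ltnW|rewrite inordK ?gtn_eqF].
Qed.

Lemma assoc_var_sprodn j (V : lmodType F) (act : mat -> V -> V) v0 : (j <= n)%N ->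
  hwsimple (e \o (sprodn n j)^-1%g) act v0 -> forall Y, assoc_var act Y -> Y = 0 \/ Omin Y.
Proof.
elim: j V act v0 => [|j IH] V act v0 jn hs Y hY.
  have e1 : e \o (sprodn n 0)^-1%g = e by apply: funext => x; rewrite /= /sprodn big_geq // invg1 perm1.
  by rewrite e1 in hs; exact: (assoc_var_minimal hs dom).
case: (hwsimple_exists (e \o (sprodn n j)^-1%g)) => V1 [act1 [v1 hs1]].
exact: (IH _ _ _ (ltnW jn) hs1 _ (avle_sprodn jn hs1 hs hY)).
Qed.

(** The upper bound is transported from j = 0. The lower bound takes a nonintegral simple root,
    found to the right of position j, or to its left when j = n. *)
Lemma assoc_var_sprodn_closure j (V : lmodType F) (act : mat -> V -> V) v0 : (j <= n)%N ->
  hwsimple (e \o (sprodn n j)^-1%g) act v0 -> forall Y, assoc_var act Y <-> zclosure (@Omin F n) Y.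
Proof.
move=> jn hs Y; split.
  move/(assoc_var_sprodn jn hs) => [->|OY]; first exact: zclosure_Omin0.
  by move=> p; apply.
have [jn'|nj] := ltnP j n.
  have ii' : (inord j.+1 : 'I_N) = (inord j : 'I_N).+1 :> nat by rewrite !inordK // ltnS.
  apply: (zclosure_sub_assoc hs (i := inord j) (i' := inord j.+1)).
    by rewrite -val_eqE /= ii' ltn_eqF.
  by apply: (assoc_var_delta hs ii'); apply: sprodnV_odd; rewrite // ii' inordK ?gtn_eqF.
have ii' : (inord j : 'I_N) = (inord j.-1 : 'I_N).+1 :> nat by rewrite !inordK; lia.
apply: (zclosure_sub_assoc hs (i := inord j.-1) (i' := inord j)).
  by rewrite -val_eqE /= ii' ltn_eqF.
apply: (assoc_var_delta hs ii'); apply: ni_sym; apply: sprodnV_odd => //.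
by move: ii'; rewrite inordK //; lia.
Qed.
End Union.
End Closure.

Lemma regular_rank_two (F : numClosedFieldType) (V : lmodType F) (act : 'M[F]_3 -> V -> V) v0 e
  (i1 : 'I_3) : i1 = 1%N :> nat -> hwsimple e act v0 -> ni e ord0 i1 -> ni e i1 ord_max ->
  ni e ord0 ord_max -> assoc_var act (delta_mx ord0 i1 + delta_mx i1 ord_max).
Proof.
have -> : i1 = 1%N :> nat <-> i1 = Ordinal (isT : (1 < 3)%N).
  by split=> [h|->//]; apply/val_inj.
move=> -> hs n01 n12 n02; case: (hs) => hv0 _; have gm : is_gmod act by case: hv0.
case: (vacuum_exists gm hv0) => xi vac; apply: (regular_assoc hv0 vac).
- exact: ni_nu n01.
- exact: ni_nu n12.
(* Here nu1 + nu2 + 2 equals e_0 - e_2. *)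
move=> k; apply/eqP => hk; have /eqP := n02 k%:Z; apply.
by rewrite -pmulrn -hk /ge /=; ring.
Qed.

(** * The two inclusions and disjointness *)

Section Assembly.
Variables (F : numClosedFieldType) (n p q : nat).
Hypotheses (hn : (2 <= n)%N) (hq : (0 < q)%N) (hcop : coprime p q) (hpn : (n.+1 <= p)%N).
Local Notation N := n.+1.
Local Notation eW := (eW F (n := n) p q).

Lemma dlt0_ndvd a (i : 'I_N) : (1 <= a <= q.-1)%N -> i != ord0 ->
  ~~ (q %| dlt0 a (ord0 : 'I_N) - dlt0 a i)%Z.
Proof.
move=> ha i0; rewrite /dlt0 eqxx (negPf i0) subr0 dvdzE /= gtnNdvd //; lia.
Qed.

Lemma eW_dlt0_dom c a (i i' : 'I_N) : alcove p c -> (0 < i)%N -> i' = i.+1 :> nat ->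
  exists k : nat, eW c (dlt0 a) i - eW c (dlt0 a) i' = k.+1%:R.
Proof.
move=> ac i0 ii'; have /andP[c1 _] : 1 <= c i - c i' <= p%:Z - 1 by apply: ac; rewrite ii'.
exists (absz (c i - c i' - 1)%R); rewrite (eW_int F p hq c (t := 0)).
  by rewrite mulr0 subr0 pmulrn; congr (_%:~R); lia.
by rewrite /dlt0 -!val_eqE /= ii' (gtn_eqF i0) subrr mulr0.
Qed.

Lemma union_PrOmin c a w : alcove p c -> (1 <= a <= q.-1)%N -> inWpar (Sig1 n) w ->
  PrOmin p q (dot (w^-1)%g (lwt (eW c (dlt0 a)))).
Proof.
move=> ac ha hw; split; first exact: dot_alcove_admissible.
move=> V act; rewrite dot_lwt => /hw_simple_hwsimple[v0 hs] Y.
case/inWpar_sprod: hw hs => j ->; rewrite sprodE => hs.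
apply: (assoc_var_sprodn_closure hn _ _ (leq_ord j) hs) => [i i'|i i0].
  exact: eW_dlt0_dom.
exact/eW_ni/dlt0_ndvd.
Qed.

(** The exceptional coordinates sit at j and j'. With a third index x, available as N >= 3, the
    difference between positions j' and x is integral for the first weight and nonintegral for the
    second. *)
Lemma union_disjoint c a c' a' (w w' : {perm 'I_N}) : (1 <= a' <= q.-1)%N ->
  inWpar (Sig1 n) w -> inWpar (Sig1 n) w' -> w != w' ->
  dot (w^-1)%g (lwt (eW c (dlt0 a))) != dot (w'^-1)%g (lwt (eW c' (dlt0 a'))).
Proof.
move=> ha /inWpar_sprod[j ->] /inWpar_sprod[j' ->] jj'; apply/eqP; rewrite !dot_lwt => /lwt_inj E.
have {}jj' : j != j' by apply: contraNneq jj' => ->.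
have [x [xj xj']] : exists x : 'I_N, x != j /\ x != j'.
  pose t := (if (j != 0%N :> nat) && (j' != 0%N :> nat) then 0
             else if (j != 1%N :> nat) && (j' != 1%N :> nat) then 1 else 2)%N.
  by exists (inord t); rewrite -!val_eqE /= inordK; move: jj'; rewrite /t -val_eqE /=;
     case: ifP => ?; [lia|case: ifP => ?; lia|lia|case: ifP => ?; lia].
have inv0 (k y : 'I_N) : y != k -> ((sprod k)^-1)%g y != ord0.
  apply: contraNneq => h; rewrite -(permKV (sprod k) y) h sprodE sprodn0 ?leq_ord //.
  by rewrite inord_val.
have := E j' x; rewrite /= (eW_int F p hq c (t := 0)); last first.
  by rewrite /dlt0 !ifN ?inv0 ?subrr ?mulr0 // eq_sym.
have odd i : i != ord0 -> ni (eW c' (dlt0 a')) ord0 i by move=> i0; apply/eW_ni/dlt0_ndvd.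
have /= := sprodnV_odd odd (leq_ord j') xj'; rewrite inord_val -sprodE => h1 h2.
by have /eqP := h1 (c (((sprod j)^-1)%g j') - c (((sprod j)^-1)%g x) - p%:Z * 0); apply.
Qed.

Lemma PrOmin_union (lam : weight F n) : PrOmin p q lam ->
  exists2 w : {perm 'I_N}, inWpar (Sig1 n) w & exists2 mu, Lambda p q mu & lam = dot (w^-1)%g mu.
Proof.
case=> /(admissible_data hn hq hcop hpn)[c [h [w [ac sp ->]]]] hO.
set e := eW c h \o w in hO *.
case: (hwsimple_exists e) => V [act [v0 hs]].
have {}hO : forall Y, assoc_var act Y <-> zclosure (@Omin F n) Y.
  by apply: hO; apply/hw_simple_hwsimple; exists v0.
(* Positions are labelled by h modulo q; different labels give nonintegral differences by
   [eW_ni]. *)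
pose cl k := (h (w (inord k)) %% q)%Z.
have clE x y : (cl x == cl y) = (q %| h (w (inord x)) - h (w (inord y)))%Z.
  by rewrite -eqz_mod_dvd.
have ni_cl x y : cl x != cl y -> ni e (inord x) (inord y).
  by rewrite clE => nd z; exact: (eW_ni F hq hcop c nd z).
have iK k : (k <= n)%N -> (inord k : 'I_N) = k :> nat by move=> kn; rewrite inordK.
have iS k : (k < n)%N -> (inord k.+1 : 'I_N) = (inord k : 'I_N).+1 :> nat.
  by move=> kn; rewrite !iK // ltnW.
have two i k (e' : 'I_N -> F) (V' : lmodType F) (act' : 'M[F]_N -> V' -> V') v0' :
    (i.+1 < k)%N -> (k < n)%N -> hwsimple e' act' v0' ->
    ni e' (inord i) (inord i.+1) -> ni e' (inord k) (inord k.+1) ->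
    ~ (forall Y, assoc_var act' Y -> zclosure (@Omin F n) Y).
  move=> ik kn hs' h1 h2 hZ.
  have i1 : (i < n)%N by lia.
  have i2 : ((inord i.+1 : 'I_N) < (inord k : 'I_N))%N by rewrite !iK //; lia.
  have := hZ _ (assoc_var_two_deltas hn hs' (iS i i1) (iS k kn) i2 h1 h2).
  by apply: zclosure_two_deltas => //; rewrite -val_eqE /= !iK; lia.
case: (class_cases cl hn).
- move=> hc; exfalso.
  have cong x y : (q %| h x - h y)%Z.
    have := clE ((w^-1)%g x) ((w^-1)%g y); rewrite !inord_val !permKV => <-.
    by apply/eqP/hc; exact: leq_ord.
  have dom (i i' : 'I_N) : i' = i.+1 :> nat -> exists k : nat, e i - e i' = k.+1%:R.
    by move=> ii'; apply: (eW_dominant F hn hq hcop hpn ac sp cong); rewrite ii'.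
  have zO : zclosure (@Omin F n) (delta_mx ord0 ord_max).
    move=> r; apply; exists 1%:M; first exact: unitmx1.
    by rewrite invmx1 mul1mx mulmx1.
  exact: (dominant_not_Omin hn hs dom (proj2 (hO _) zO)).
- case=> m mn hm.
  have neP x : x != w (inord m) -> ((w^-1)%g x : nat) != m.
    apply: contraNneq => hx; rewrite -hx inord_val permKV //.
  have [||c' [a [w' [ac' ha hw' E]]]] := rotate_to_alcove F hn hq hcop hpn ac sp (m := w (inord m)).
  + move=> x /neP xm; have [+ _] := hm _ (leq_ord _) xm.
    by rewrite clE inord_val permKV.
  + move=> x y /neP xm /neP ym; have [_ /(_ _ (leq_ord _) ym)/eqP] := hm _ (leq_ord _) xm.
    by rewrite clE !inord_val !permKV.
  exists w' => //; exists (lwt (eW c' (dlt0 a))); first exact: data_Lambda.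
  by rewrite dot_lwt.
- case=> i [k [ik kn hi hk]]; exfalso.
  by apply: (two i k e V act v0 ik kn hs (ni_cl _ _ hi) (ni_cl _ _ hk)) => Y /hO.
case=> [[s [sn hsb [i [k [ik kn hi hk]]]]]|[n2 h01 h12 h02]]; exfalso.
  pose e' := e \o tperm (inord s) (inord s.+1).
  case: (hwsimple_exists e') => V' [act' [v0' hs']].
  have sle := avle_refl_step (iS s sn) (ni_cl _ _ hsb) hs hs'.
  have sw x : (x <= n)%N -> tperm (inord s) (inord s.+1) (inord x : 'I_N) = inord (swapn s x).
    move=> xn; rewrite /swapn; have [->|xs] := eqVneq x s; first by rewrite tpermL.
    have [->|xs1] := eqVneq x s.+1; first by rewrite tpermR.
    by rewrite tpermD // -val_eqE /= !iK // 1?eq_sym // ltnW.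
  apply: (two i k e' V' act' v0' ik kn hs').
  - by move=> z; rewrite /e' /= !sw; [exact: (ni_cl _ _ hi z)|lia|lia].
  - by move=> z; rewrite /e' /= !sw; [exact: (ni_cl _ _ hk z)|lia|lia].
  - by move=> Y /sle/hO.
have e0 : inord 0 = ord0 :> 'I_N by apply/val_inj; rewrite /= iK.
have e2 : inord 2 = ord_max :> 'I_N by apply/val_inj; rewrite /= iK n2.
have i1 : (inord 1 : 'I_N) = 1%N :> nat by rewrite iK // ltnW.
move: (ni_cl _ _ h01) (ni_cl _ _ h12) (ni_cl _ _ h02); rewrite e0 e2 => N01 N12 N02.
have := zclosure_two_deltas (F := F) hn (i := ord0) (i' := inord 1) (k := inord 1) (k' := ord_max).
move=> /(_ _ _); apply; try by rewrite -val_eqE /= i1 ?n2.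
apply/hO; move: (inord 1) i1 N01 N12 N02 => o i1 N01 N12 N02.
(* [regular_rank_two] is stated for 3 x 3 matrices, so e is made opaque in order to substitute n =
   2. *)
clear -n2 hs i1 N01 N12 N02; clearbody e; subst n.
exact: regular_rank_two i1 hs N01 N12 N02.
Qed.
End Assembly.

Theorem mainTheorem2 (F : numClosedFieldType) (n p q : nat)
  (hn : (2 <= n)%N) (hp : (0 < p)%N) (hq : (0 < q)%N) (hcop : coprime p q)
  (hpn : (n.+1 <= p)%N) :
  (* W^p = {e, s1, s1 s2, ..., s1 s2 ... sn} *)
  (forall w : {perm 'I_n.+1},
     inWpar (Sig1 n) w <-> exists j : 'I_n.+1, w = sprod j) /\
  (* Pr_k^{O_min} = union over w in W^p of w^-1 . Lambda_k(p) *)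
  (forall lam : weight F n,
     PrOmin p q lam <->
     exists2 w : {perm 'I_n.+1}, inWpar (Sig1 n) w &
       exists2 mu, Lambda p q mu & lam = dot (w^-1)%g mu) /\
  (* the union is disjoint *)
  (forall w w' : {perm 'I_n.+1}, inWpar (Sig1 n) w -> inWpar (Sig1 n) w' ->
     w != w' -> forall mu mu' : weight F n, Lambda p q mu -> Lambda p q mu' ->
     dot (w^-1)%g mu != dot (w'^-1)%g mu') /\
  (* non-emptiness for q >= 2 *)
  ((2 <= q)%N -> exists lam : weight F n, PrOmin p q lam).
Proof.
have U (w : {perm 'I_n.+1}) (mu : weight F n) : inWpar (Sig1 n) w -> Lambda p q mu ->
    PrOmin p q (dot (w^-1)%g mu).
  by move=> hw /(Lambda_data hn hq hcop hpn)[c [a [ac ha ->]]]; exact: union_PrOmin.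
split; first exact: inWpar_sprod.
split; first by move=> lam; split=> [|[w hw [mu hmu ->]]]; [exact: PrOmin_union|exact: U].
split.
  move=> w w' hw hw' ne mu mu' /(Lambda_data hn hq hcop hpn)[c [a [_ _ ->]]].
  by move=> /(Lambda_data hn hq hcop hpn)[c' [a' [_ ha' ->]]]; exact: union_disjoint.
(* Witness w = 1, mu = 0, a = 1, with a <= q - 1 because q >= 2. *)
move=> q2; exists (dot (1^-1)%g (- ((p%:R / q%:R) * 1%:R) *: omega1 F n)); apply: U.
  by move=> a b ab; rewrite !perm1 ltnNge ltnW.
exists 0, 1%N; split; [|lia|by rewrite scaleNr sub0r].
by exists (fun=> 0%N); split=> [i|]; rewrite ?mxE // big1.
Qed.
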